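(* Every triangle-free t-perfect graph is $199052$-colourable.
   Context: All graphs are finite and simple. For a graph $G=(V,E)$, $\mathrm{STAB}(G)\subseteq\mathbb{R}^V$ is the convex hull of the incidence vectors of stable sets of $G$, and $\mathrm{TSTAB}(G)$ is the set of $x\in\mathbb{R}^V$ with $x_v\ge0$ for all vertices $v$, $x_u+x_v\le 1$ for all edges $uv$, and $\sum_{v\in V(C)}x_v\le\frac{|V(C)|-1}{2}$ for every odd cycle $C$. $G$ is t-perfect if $\mathrm{STAB}(G)=\mathrm{TSTAB}(G)$. A graph is triangle-free if it has no clique of size three, and $k$-colourable if its vertex set is a union of $k$ stable sets. *)

(* Defs.v *)
From mathcomp Require Import all_boot all_order all_algebra.
From mathcomp Require Import boolp classical_sets functions reals convex.

Set Implicit Arguments.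
Unset Strict Implicit.
Unset Printing Implicit Defensive.

Import Order.TTheory GRing.Theory Num.Theory.
Local Open Scope ring_scope.

Record sgraph := SGraph {
  vertex :> finType;
  adj : rel vertex;
  adj_sym : symmetric adj;
  adj_irrefl : irreflexive adj }.

Section Graph.
Variable G : sgraph.

Definition stable (S : {set G}) : Prop := {in S &, forall u v, ~~ adj u v}.

Definition clique (K : {set G}) : Prop :=
  {in K &, forall u v, u != v -> adj u v}.

Definition triangle_free : Prop :=
  ~ exists K : {set G}, clique K /\ #|K| = 3%N.

(* The colour classes may overlap or be empty. *)
Definition colourable (k : nat) : Prop :=
  exists S : 'I_k -> {set G},
    (forall i, stable (S i)) /\ (\bigcup_i S i)%SET = [set: G]%SET.

(* A cycle is given by the cyclic sequence of its distinct vertices; it need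
   not be induced. *)
Definition odd_cycle (c : seq G) : bool :=
  [&& (2 < size c)%N, odd (size c), uniq c & cycle (@adj G) c].

End Graph.

Definition convex_hull (R : realType) (M : lmodType R) (A : set M) : set M :=
  smallest (@convex_set R M) A.

Section Polytopes.
Variables (R : realType) (G : sgraph).

(* R^G; R^o makes the function space an R-module. *)
Notation RG := (G -> R^o).

Definition incidence (S : {set G}) : RG := fun v => (v \in S)%:R.

Definition STAB : set RG :=
  convex_hull [set x | exists2 S : {set G}, stable S & x = incidence S]%classic.

Definition TSTAB : set RG :=
  [set x | [/\ forall v, 0 <= x v,
               forall u v, adj u v -> x u + x v <= 1
             & forall c, odd_cycle c ->
                 \sum_(v <- c) x v <= ((size c)%:R - 1) / 2]]%classic.

End Polytopes.

Arguments STAB : clear implicits.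
Arguments TSTAB : clear implicits.

Definition t_perfect (R : realType) (G : sgraph) : Prop :=
  STAB R G = TSTAB R G.

(* Main.v *)
(* Testing t-perfection on suitable points of TSTAB gives two facts.  If all odd
   cycles inside A are longer than 2k, the point k/(2k+1) on A yields a stable
   set meeting every (2k+1)-cycle of A; deleting two stable sets thus leaves a
   set A without odd cycles of length at most 7.  Secondly there is no induced
   odd cycle (rim) with a connected bipartite hub X, Y, disjoint from the rim,
   Y without neighbours on the rim, such that X sees rim positions i < j <= k < l
   with j - i and l - k odd.

   If A needed too many colours, so would a level of a breadth-first levelling
   of A, and in it a level of a second levelling.  In the latter one grows a
   "rope" of five odd cycles strung on induced paths: either arc of each cycle
   may be used, so the lengths of the five segments between consecutive spots
   have arbitrary parities.  The spots get pairwise nonconflicting parents in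
   the outer levelling, three of which lie in one class of a hub made of the
   lower outer levels.  The rope is closed to an induced cycle through the lower
   levels of the inner levelling, avoiding contacts by colouring arguments that
   use the same wheels.  Choosing the parities so that the three spots are at odd
   distances on an odd rim contradicts the second fact. *)
Require Import Defs.
From mathcomp Require Import all_boot all_order all_algebra.
From mathcomp Require Import boolp classical_sets reals convex interval_inference.
From mathcomp Require Import zify ring lra.

Set Implicit Arguments.
Unset Strict Implicit.
Unset Printing Implicit Defensive.

Import Order.TTheory GRing.Theory Num.Theory.

(** * Points of TSTAB *)

(** The second fact asks for two odd arcs between contacts on a rim that is itself odd, so three
    parities must be right at once, and it is not known beforehand which spots share a hub class.
    Hence every segment of the rope is adjustable: among five spots three lie in one class, and the
    segment after the fifth sets the parity of the rim. Further contacts between the rim and [X] do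
    no harm, since a contact merely makes a rim vertex positive; only [Y] has to stay away. So the
    parents of the spots need not be private neighbours: it suffices that they are nonadjacent to
    each other and to each other's chosen parents.

    Length 7 is what the local arguments consume: two walks of length 3 to a common end, together
    with an edge between their starts, close to an odd walk of length 7, so the vertices starting
    such walks form a stable set. Everything to be avoided is a union of few such sets or is
    coloured by means of a wheel, and costs a fixed number of colours; passing to a level of a
    levelling halves the number of colours available. Altogether 18046 colours suffice, which is
    below the bound of the theorem. *)

Section Polytope.
Variables (R : realType) (G : sgraph).
Local Open Scope ring_scope.

(** An open half-space is convex. The strict form lets [t_perfect_tight] conclude by deriving
    [b < b]. *)
Lemma STAB_lt (l : G -> R) (b : R) (x : G -> R^o) :
    (forall S : {set G}, stable S -> \sum_(v in S) l v < b) ->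
  STAB R G x -> \sum_v l v * x v < b.
Proof.
move=> lb xS.
pose H : set (G -> R^o) := [set y | \sum_v l v * y v < b]%classic.
suff : H x by [].
apply: xS; split; last first.
  move=> _ [S Sst ->]; rewrite /H /=.
  apply: le_lt_trans (lb S Sst); rewrite [leRHS]big_mkcond /=.
  apply: ler_sum => v _; rewrite /incidence; case: (v \in S) => /=.
    by rewrite mulr1.
  by rewrite mulr0.
apply/convex_setW => y z; rewrite !inE /H /= => yH zH k k0 k1.
rewrite inE /H /=.
rewrite (eq_bigr (fun v => k%:num * (l v * y v) + (1 - k%:num) * (l v * z v))); last first.
  move=> v _; have -> : (conv k y z : G -> R^o) v = k%:num * y v + (1 - k%:num) * z v by [].
  by ring.
rewrite big_split /= -!mulr_sumr.
have h1 : k%:num * \sum_v l v * y v < k%:num * b by rewrite ltr_pM2l.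
have h2 : (1 - k%:num) * \sum_v l v * z v < (1 - k%:num) * b.
  by rewrite ltr_pM2l // subr_gt0.
set A := (\sum_v _ * y _) in h1 *; set B := (\sum_v _ * z _) in h2 *.
set kk := k%:num in h1 h2 *.
by lra.
Qed.

(** A point of STAB on the face where [a] attains [bt] is a convex combination of stable sets on
    this face, one of which has at least the average value of [g]. Instead of decomposing [x], the
    proof evaluates the single functional [M * a + g], with [M] so large that losing one unit of [a]
    outweighs all of [g]. *)
Lemma t_perfect_tight (x : G -> R^o) (a g : G -> nat) (bt : nat) :
    t_perfect R G -> TSTAB R G x ->
    (forall S : {set G}, stable S -> (\sum_(v in S) a v <= bt)%N) ->
    \sum_v (a v)%:R * x v = bt%:R ->
  exists S : {set G}, [/\ stable S, \sum_(v in S) a v = bt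
    & \sum_v (g v)%:R * x v <= (\sum_(v in S) g v)%N%:R].
Proof.
move=> tp xT ab ax.
have xS : STAB R G x by rewrite tp.
have x0 v : 0 <= x v by case: xT.
apply: contrapT => nS.
pose M := (\sum_v g v).+1.
pose b : R := \sum_v (M * a v + g v)%N%:R * x v.
suff : b < b by rewrite ltxx.
apply: STAB_lt xS => S Sst.
rewrite /b -natr_sum big_split /= -big_distrr /=.
rewrite (eq_bigr (fun v => M%:R * ((a v)%:R * x v) + (g v)%:R * x v)); last first.
  by move=> v _; rewrite natrD natrM mulrDl mulrA.
rewrite big_split /= -mulr_sumr ax natrD natrM.
have gx0 : 0 <= \sum_v (g v)%:R * x v by apply: sumr_ge0 => v _; rewrite mulr_ge0.
have := ab S Sst; rewrite leq_eqVlt => /orP[/eqP aS|aS].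
  rewrite aS ltrD2l ltNge; apply/negP => gS; apply: nS; by exists S.
have gS : (\sum_(v in S) g v < M)%N.
  rewrite ltnS [leqRHS](bigID (mem S)) /=; exact: leq_addr.
have : ((M * \sum_(v in S) a v + \sum_(v in S) g v)%N < (M * bt)%N)%N by nia.
rewrite -(ltr_nat R) natrD !natrM => h.
by apply: lt_le_trans h _; rewrite lerDl.
Qed.

(** No counting along the cycle is needed: the incidence vector of [S] lies in STAB, hence in TSTAB,
    and satisfies the inequality of [c]. *)
Lemma odd_cycle_stable (S : {set G}) (c : seq G) :
    t_perfect R G -> stable S -> odd_cycle c ->
  (count (mem S) c <= (size c)./2)%N.
Proof.
move=> tp Sst oc.
have : STAB R G (incidence R S).
  by move=> C [_ CS]; apply: CS; exists S.
rewrite tp => -[_ _ /(_ c oc)].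
rewrite /incidence -natr_sum.
have -> : (\sum_(v <- c) (v \in S) = count (mem S) c)%N by rewrite -sum1_count [RHS]big_mkcond /=; apply: eq_bigr => v _; case: (v \in S).
have /and4P[_ odd_c _ _] := oc.
rewrite -[in X in X -> _](odd_double_half (size c)) odd_c add1n -natr1 addrK -muln2 natrM mulfK ?pnatr_eq0 //.
by rewrite ler_nat.
Qed.

Lemma sum_even_path (x : G -> R) n (p : seq G) :
    (forall u v, adj u v -> x u + x v <= 1) ->
  size p = n.*2 -> sorted (@adj G) p -> \sum_(v <- p) x v <= n%:R.
Proof.
move=> xe; elim: n p => [|n IH] p.
  by move=> /size0nil ->; rewrite big_nil.
case: p => [|u [|v p]] //=; rewrite doubleS => -[sp] /andP[uv vp].
rewrite !big_cons -natr1 addrA addrC.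
apply: lerD (xe _ _ uv); apply: IH => //; exact: path_sorted vp.
Qed.

(** A cycle through a zero of [x] satisfies its inequality by the edge inequalities alone: without
    that vertex it is a path on an even number of vertices, which splits into edges. Only cycles
    inside the support remain to be checked. *)
Lemma TSTAB_intro (x : G -> R^o) :
    (forall v, 0 <= x v) -> (forall u v, adj u v -> x u + x v <= 1) ->
    (forall c, odd_cycle c -> (forall v, v \in c -> x v != 0) ->
      \sum_(v <- c) x v <= ((size c)%:R - 1) / 2) ->
  TSTAB R G x.
Proof.
move=> x0 xe xc; split => // c oc.
have [/hasP[v vc /eqP xv]|/hasPn nz] := boolP (has (fun v => x v == 0) c); last exact: xc.
have /and4P[c3 odd_c uc cc] := oc.
have [i p ep] := rot_to vc.
have -> : \sum_(v <- c) x v = \sum_(v <- rot i c) x v.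
  by apply: perm_big; rewrite perm_sym perm_rot.
rewrite ep big_cons xv add0r.
have sp : size c = (size p).+1 by rewrite -(size_rot i) ep.
have pp : path (@adj G) v p.
  by move: cc; rewrite -(rot_cycle i) ep /= rcons_path => /andP[].
rewrite sp -natr1 addrK.
have hp : size p = (size p)./2.*2 by move: odd_c; rewrite sp; lia.
rewrite hp -muln2 natrM mulfK ?pnatr_eq0 //.
apply: sum_even_path => //; exact: path_sorted pp.
Qed.

End Polytope.

(** * Points of TSTAB given by signs and labels *)

Section SignedSupport.
Variables (R : realType) (G : sgraph) (U : {set G}) (sg : G -> bool) (lb : G -> nat).
Local Open Scope ring_scope.

Definition sign_vector : G -> R^o :=
  fun v => if v \in U then if sg v then 3^-1 else 2 / 3 else 0.

Hypothesis edgeU : {in U &, forall u v, adj u v ->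
  sg u != sg v /\ lb u = lb v \/ [/\ sg u, sg v & lb u <> lb v]}.

Let w (v : G) : nat := if sg v then 1 else 2.

Fixpoint nplus (u : G) (p : seq G) : nat :=
  if p is v :: p' then ((sg u && sg v) + nplus v p')%N else 0%N.

(** Every step either changes the sign or is counted by [nplus]. *)
Lemma nplus_parity u p : path (@adj G) u p -> {subset u :: p <= U} ->
  odd (nplus u p + size p) = sg u (+) sg (last u p).
Proof.
elim: p u => [|v p IH] u /=; first by rewrite addbb.
move=> /andP[uv vp] sU.
have uU : u \in U by apply: sU; rewrite inE eqxx.
have vpU : {subset v :: p <= U} by move=> z zp; apply: sU; rewrite inE zp orbT.
have vU : v \in U by apply: vpU; rewrite inE eqxx.
rewrite addnS -addnA /= oddD IH //.
have := edgeU uU vU uv.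
by case: (sg u); case: (sg v); case: (sg _) => //=; case=> [[]|[]].
Qed.

(** The steps counted by [nplus] are exactly those that change the label. In particular a closed
    walk cannot have just one of them. *)
Lemma nplus_label u p : path (@adj G) u p -> {subset u :: p <= U} ->
  (nplus u p = 0%N -> lb u = lb (last u p)) /\
  (nplus u p = 1%N -> lb u <> lb (last u p)).
Proof.
elim: p u => [|v p IH] u //= /andP[uv vp] sU.
have uU : u \in U by apply: sU; rewrite inE eqxx.
have vpU : {subset v :: p <= U} by move=> z zp; apply: sU; rewrite inE zp orbT.
have vU : v \in U by apply: vpU; rewrite inE eqxx.
have [IH0 IH1] := IH v vp vpU.
have := edgeU uU vU uv.
case: (sg u); case: (sg v) => /=; rewrite ?add0n ?add1n; case=> [[] // _ e|[] // _ _ e]; rewrite ?e; split => //.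
by move=> [] /IH0 <-.
Qed.

(** Double counting: a step has weight 3 if the signs differ and 2 if both are positive, and every
    entry of the walk except the two ends belongs to two steps. *)
Lemma sum_weights u p : path (@adj G) u p -> {subset u :: p <= U} ->
  (2 * \sum_(v <- u :: p) w v + nplus u p = 3 * size p + w u + w (last u p))%N.
Proof.
elim: p u => [|v p IH] u /=; first by rewrite big_seq1; lia.
move=> /andP[uv vp] sU.
have uU : u \in U by apply: sU; rewrite inE eqxx.
have vpU : {subset v :: p <= U} by move=> z zp; apply: sU; rewrite inE zp orbT.
have vU : v \in U by apply: vpU; rewrite inE eqxx.
have := IH v vp vpU; rewrite [in X in _ -> X]big_cons.
have := edgeU uU vU uv; rewrite /w.
set s := bigop _ _ _.
by case: (sg u); case: (sg v) => /=; case=> [[] // _ _|[] // _ _ _]; lia.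
Qed.

(** On an odd cycle of length n in the support, [nplus] is odd by [nplus_parity] and not 1 by
    [nplus_label], hence at least 3. So twice the weight, in thirds, is at most 3n - 3, which is the
    inequality of the cycle. *)
Lemma sign_vector_TSTAB : TSTAB R G sign_vector.
Proof.
apply: TSTAB_intro.
- by move=> v; rewrite /sign_vector; case: ifP => // _; case: ifP => _; lra.
- move=> u v uv; rewrite /sign_vector.
  have [uU|_] := boolP (u \in U); have [vU|_] := boolP (v \in U); try by do ?[case: ifP => _]; lra.
  by have := edgeU uU vU uv; case: (sg u); case: (sg v) => //=; try lra; case=> [[]|[]].
move=> c oc nz.
have cU v : v \in c -> v \in U.
  by move=> /nz; rewrite /sign_vector; case: ifP; rewrite ?eqxx.
have /and4P[c3 odd_c uc cc] := oc.
have -> : \sum_(v <- c) sign_vector v = (\sum_(v <- c) w v)%N%:R / 3.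
  rewrite natr_sum mulr_suml big_seq [RHS]big_seq.
  by apply: eq_bigr => v vc; rewrite /sign_vector cU // /w; case: (sg v); rewrite ?mul1r.
case: c c3 odd_c cc cU {oc uc nz} => // u p _ odd_c cc cU.
have sU : {subset u :: rcons p u <= U}.
  by move=> z; rewrite inE mem_rcons inE orbA orbb -in_cons; apply: cU.
have := nplus_parity cc sU; rewrite last_rcons addbb size_rcons => par.
have [_] := nplus_label cc sU; rewrite last_rcons => n1.
have := sum_weights cc sU; rewrite last_rcons size_rcons -rcons_cons big_rcons /= => sw.
have n3 : (3 <= nplus u (rcons p u))%N.
  move: par n1 odd_c => /=; case: (nplus _ _) => [|[|[|k]]] //=; rewrite ?add0n ?add1n ?add2n /=.
  - by move=> ->.
  - by move=> _ /(_ erefl).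
  - by case: (odd _).
move: sw; set s := (\sum_(v <- u :: p) w v)%N => sw.
have : (2 * s + 3 <= 3 * (size p).+1)%N by lia.
rewrite -(ler_nat R) natrD !natrM /= => h.
set n := (size p).+1%:R in h *.
by lra.
Qed.

End SignedSupport.

(** * Connected sets and induced cycles *)

Section GraphNotions.
Variable G : sgraph.

Definition restrict (A : {set G}) : rel G :=
  fun u v => [&& u \in A, v \in A & adj u v].

Definition conn (A : {set G}) : Prop :=
  {in A &, forall u v, connect (restrict A) u v}.

Definition induced_cycle (x0 : G) (c : seq G) : Prop :=
  [/\ (2 < size c)%N, uniq c & forall a b, (a < b < size c)%N ->
      adj (nth x0 c a) (nth x0 c b) = (b == a.+1) || (a == 0) && (b.+1 == size c)].

Lemma induced_cycle_odd x0 c : induced_cycle x0 c -> odd (size c) -> odd_cycle c.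
Proof.
move=> [s3 uc ac] oc; rewrite /odd_cycle s3 oc uc /=.
have adjS i : (i.+1 < size c)%N -> adj (nth x0 c i) (nth x0 c i.+1).
  by move=> ip; rewrite ac ?eqxx // ltnSn.
have adj0 : adj (nth x0 c 0) (nth x0 c (size c).-1).
  by rewrite ac; lia.
case: c adjS adj0 {s3 uc ac oc} => //= u p adjS adj0.
rewrite rcons_path adj_sym -nth_last; apply/andP; split.
  by apply/(pathP x0) => i ip; apply: (adjS i).
by case: p adj0 {adjS} => //= v p; rewrite (set_nth_default x0) //=.
Qed.

Lemma nth_rot_lt (x0 : G) c i t : i + t < size c -> nth x0 (rot i c) t = nth x0 c (i + t).
Proof.
move=> h; rewrite nth_cat size_drop nth_drop.
by rewrite ltn_subRL h.
Qed.

Lemma nth_rot_ge (x0 : G) c i t : i <= size c -> t < size c -> size c <= i + t ->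
  nth x0 (rot i c) t = nth x0 c (i + t - size c).
Proof.
move=> ic tc h; rewrite nth_cat size_drop ltn_subRL ltnNge h /= nth_take; last by lia.
by congr nth; lia.
Qed.

Lemma induced_cycle_rot (x0 : G) c i : i < size c -> induced_cycle x0 c -> induced_cycle x0 (rot i c).
Proof.
move=> ic [s3 uc ac]; split; rewrite ?size_rot ?rot_uniq // => a b /andP[ab bc].
have [h1|h1] := ltnP (i + a) (size c); have [h2|h2] := ltnP (i + b) (size c).
- by rewrite !nth_rot_lt // ac; lia.
- rewrite nth_rot_lt // nth_rot_ge //; last exact: ltnW.
  by rewrite adj_sym ac; lia.
- by lia.
- rewrite !nth_rot_ge //; [|lia..].
  by rewrite ac; lia.
Qed.

End GraphNotions.

(** * Stable sets that are tight on given edges *)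

Section TightEdges.
Variables (R : realType) (G : sgraph).
Local Open Scope ring_scope.

(** The functional [a] adds up the inequalities of all tight edges, so a stable set attaining its
    maximum has exactly one end of each. The sum runs over ordered pairs, whence the factor 2 in
    [a]. *)
Lemma tight_edges (x : G -> R^o) (tight : rel G) (g : G -> nat) :
    t_perfect R G -> TSTAB R G x -> symmetric tight -> subrel tight (@adj G) ->
    (forall u v, tight u v -> x u + x v = 1) ->
  exists S : {set G}, [/\ stable S, forall u v, tight u v -> (u \in S) = (v \notin S)
    & \sum_v (g v)%:R * x v <= (\sum_(v in S) g v)%N%:R].
Proof.
move=> tp xT tS tA tx.
pose a (v : G) : nat := (2 * \sum_(u | tight v u) 1)%N.
pose bt : nat := (\sum_v \sum_(u | tight v u) 1)%N.
have deg (b : bool) v : (\sum_(u | tight v u) b = if b then \sum_(u | tight v u) 1 else 0)%N.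
  by case: b; rewrite // big1.
have aE (S : {set G}) : (\sum_(v in S) a v = \sum_v \sum_(u | tight v u) ((v \in S) + (u \in S)))%N.
  rewrite /a -big_distrr /= mul2n -addnn.
  under [RHS]eq_bigr => v _ do rewrite big_split /=.
  rewrite big_split /=; congr (_ + _)%N.
    by rewrite big_mkcond /=; apply: eq_bigr => v _; rewrite deg.
  rewrite [RHS](exchange_big_dep predT) //= big_mkcond /=; apply: eq_bigr => v _.
  under [RHS]eq_bigl => u do rewrite tS.
  by rewrite deg.
have le1 (S : {set G}) v u : stable S -> tight v u -> ((v \in S) + (u \in S) <= 1)%N.
  move=> Sst /tA vu; case vS: (v \in S); case uS: (u \in S) => //.
  by have := Sst v u vS uS; rewrite vu.
have abt (S : {set G}) : stable S -> (\sum_(v in S) a v <= bt)%N.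
  move=> Sst; rewrite aE; apply: leq_sum => v _; apply: leq_sum => u; exact: le1.
have ax : \sum_v (a v)%:R * x v = bt%:R.
  rewrite /bt natr_sum.
  have -> : \sum_v (a v)%:R * x v = \sum_v \sum_(u | tight v u) (x v + x u).
    under [RHS]eq_bigr => v _ do rewrite big_split /=.
    rewrite big_split /=.
    have -> : \sum_i \sum_(i0 | tight i i0) x i0 = \sum_i \sum_(i0 | tight i i0) x i.
      rewrite (exchange_big_dep predT) //=; apply: eq_bigr => v _.
      by under eq_bigl => u do rewrite tS.
    rewrite -big_split /=; apply: eq_bigr => v _.
    rewrite sumr_const /a natrM sum1_card -mulrA [_ * x v]mulr_natl; lra.
  apply: eq_bigr => v _; rewrite natr_sum; apply: eq_bigr => u; exact: tx.
have [S [Sst aS gS]] := t_perfect_tight g tp xT abt ax.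
exists S; split=> // u v uv.
have := @leqif_sum _ predT _ _ _ (fun v _ => @leqif_sum _ (tight v) _ _ _ (fun u tvu => leqif_eq (le1 S v u Sst tvu))).
rewrite -aE -/bt => -[_]; rewrite aS eqxx => /esym/forallP /(_ u) /forallP /(_ v).
by rewrite uv /=; case: (u \in S); case: (v \in S).
Qed.

End TightEdges.

(** * Counting signs along a rim *)

Section RimSign.

(* Greedy signs on the rim: [true] at the contacts and never two consecutive
   [false]; labels increase between two consecutive [true]. *)
Fixpoint rim_sign (f : nat -> bool) (t : nat) : bool :=
  if t is t'.+1 then f t || ~~ rim_sign f t' else true.

Fixpoint rim_label (f : nat -> bool) (t : nat) : nat :=
  if t is t'.+1 then rim_label f t' + (rim_sign f t' && rim_sign f t) else 0.

Definition rim_minus (f : nat -> bool) (t : nat) : nat :=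
  \sum_(u < t) ~~ rim_sign f u.

Lemma rim_minusS f t : rim_minus f t.+1 = rim_minus f t + ~~ rim_sign f t.
Proof. by rewrite /rim_minus big_ord_recr. Qed.

Lemma rim_labelS f t :
  rim_label f t.+1 = rim_label f t + (rim_sign f t && rim_sign f t.+1).
Proof. by []. Qed.

Lemma rim_labelE f t : rim_label f t + 2 * rim_minus f t + ~~ rim_sign f t = t.
Proof.
elim: t => [|t IH]; first by rewrite /rim_minus big_ord0.
rewrite rim_minusS /= -[in RHS]IH.
by case: (rim_sign f t); case: (f t.+1) => /=; lia.
Qed.

Lemma rim_minus_le f b L : 2 * rim_minus f (b + L) <= 2 * rim_minus f b + L.+1.
Proof.
elim/ltn_ind: L => -[|[|L]] IH; first by rewrite addn0; lia.
  by rewrite addn1 rim_minusS; case: rim_sign => /=; lia.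
have := IH L (ltnW (ltnSn _)).
rewrite !addnS !rim_minusS /=.
by case: (f (b + L).+1) => /=; case: (rim_sign f (b + L)) => /=; lia.
Qed.

Lemma rim_minus_contact f b L : rim_sign f b ->
  2 * rim_minus f (b + L) <= 2 * rim_minus f b + L.
Proof.
move=> fb; case: L => [|L]; first by rewrite addn0; lia.
by rewrite addnS -addSn (leq_trans (rim_minus_le _ _ _)) // rim_minusS fb addn0.
Qed.

(** [m] counts the pairs of consecutive positive vertices on the closed rim; its second summand is
    the pair formed by the last vertex and position 0. The positions 0, j, k, l cut the rim into
    four arcs that start with a positive vertex, so at most half of each arc is negative, and an odd
    arc falls short of this by another half. Two arcs are odd by hypothesis and [n] is odd, so a
    third one is odd; this gives [2 * rim_minus f n + 3 <= n]. *)
Lemma rim_plus f j k l n :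
    rim_sign f j -> rim_sign f k -> rim_sign f l ->
    0 < j -> j <= k -> k < l -> l < n -> odd j -> odd (l - k) -> odd n ->
  let m := rim_label f n.-1 + rim_sign f n.-1 in
  [/\ m + 2 * rim_minus f n = n, 2 < m & odd m].
Proof.
move=> fj fk fl j0 jk kl ln oj okl on m.
have mE : m + 2 * rim_minus f n = n.
  rewrite {}/m; case: n ln {on} => // n _; rewrite rim_minusS /=.
  rewrite -[in RHS](rim_labelE f n) {fj fk fl okl oj}.
  by case: (rim_sign f n) => /=; lia.
have : 2 * rim_minus f n + 3 <= n.
  have := @rim_minus_contact f 0 j isT; rewrite add0n.
  have := @rim_minus_contact f j (k - j) fj; rewrite (subnKC jk).
  have := @rim_minus_contact f k (l - k) fk; rewrite (subnKC (ltnW kl)).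
  have := @rim_minus_contact f l (n - l) fl; rewrite (subnKC (ltnW ln)).
  have -> : rim_minus f 0 = 0 by rewrite /rim_minus big_ord0.
  move: (rim_minus f j) (rim_minus f k) (rim_minus f l) (rim_minus f n) => a b d e.
  clear mE m fj fk fl.
  have ej := odd_double_half j; have el := odd_double_half (l - k); have en := odd_double_half n.
  rewrite oj okl on in ej el en.
  by lia.
have : odd (m + 2 * rim_minus f n) by rewrite mE.
rewrite oddD oddM /= addbF; move: mE; clearbody m.
by move: (rim_minus f n) => e mE om h; split=> //; lia.
Qed.

End RimSign.

(** * Wheels *)

Section Wheel.
Variables (R : realType) (G : sgraph) (X Y : {set G}) (x0 : G) (c : seq G).
Hypothesis tp : t_perfect R G.
Hypothesis Xst : stable X.
Hypothesis Yst : stable Y.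
Hypothesis dXY : [disjoint X & Y].
Hypothesis cXY : conn (X :|: Y).
Hypothesis oc : odd (size c).
Hypothesis ic : induced_cycle x0 c.
Hypothesis dc : {in c, forall v, v \notin X :|: Y}.
Hypothesis Yc : {in Y & c, forall y v, ~~ adj y v}.

Let n := size c.
Let ct t := [exists x in X, adj x (nth x0 c t)].

(* Rim and hub carry the point with values 1/3 on X and on positive rim vertices,
   2/3 on Y and on negative ones; labelling the rim modulo m shows that it is in
   TSTAB.  A stable set tight on all edges with different signs cannot reach the
   value n - 1/3 of the weight 2 on the rim and m - 1 at one vertex of X. *)
Lemma wheel0 j k l : ct 0 -> ct j -> ct k -> ct l ->
  0 < j -> j <= k -> k < l -> l < n -> odd j -> odd (l - k) -> False.
Proof.
move=> c0 cj ck cl j0 jk kl ln oj okl.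
have [n2 uc ac] := ic.
pose s := rim_sign ct.
have sct t : ct t -> s t by case: t => //= t; rewrite /s /= => ->.
pose m := rim_label ct n.-1 + s n.-1.
have [mE m3 mo] : [/\ m + 2 * rim_minus ct n = n, 2 < m & odd m].
  by apply: rim_plus j0 jk kl ln oj okl oc; exact: sct.
have m0 : 0 < m by apply: leq_trans m3.
pose U := X :|: Y :|: [set v in c].
pose sg v := if v \in X then true else if v \in Y then false else s (index v c).
(* Labels on the rim are residues below [m], so the value [m] on the hub differs from all of them,
   as the edges between [X] and positive rim vertices require. *)
pose lb v := if v \in X :|: Y then m else rim_label ct (index v c) %% m.
have idx v : v \in c -> (index v c < n)%N by rewrite index_mem.
have cX v : v \in c -> (v \in X = false) * (v \in Y = false).
  by move=> /dc; rewrite !inE; case: (v \in X); case: (v \in Y).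
have XYn v : v \in X -> v \in Y = false by move=> vX; rewrite (disjointFr dXY vX).
have rimE a b : (a < b < n)%N -> adj (nth x0 c a) (nth x0 c b) ->
    s a != s b /\ rim_label ct a = rim_label ct b %[mod m] \/
    [/\ s a, s b & rim_label ct a <> rim_label ct b %[mod m]].
  move=> /andP[ab bn]; rewrite ac ?ab // => /orP[/eqP eb|/andP[/eqP ea /eqP eb]].
    rewrite eb rim_labelS -/(s a) -/(s a.+1).
    have : s a || s a.+1 by rewrite /s /=; case: rim_sign; rewrite ?orbT.
    case: (s a); case: (s a.+1) => //= _; rewrite ?addn0; [right|by left|by left].
    split=> // /eqP; rewrite -[X in X == _ %[mod _]]addn0 eqn_modDl !modn_small //; exact: ltn_trans m3.
  have {}eb : b = n.-1 by rewrite -[n]eb.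
  rewrite ea eb /= mod0n.
  move: mE; rewrite /m -/(s n.-1); case: (s n.-1) => /= mE'.
    right; split=> // /esym /eqP; rewrite addn1 modn_small // => /eqP e.
    by move: m3; rewrite /m e; case: (s n.-1).
  by left; rewrite addn0 modnn.
have edge : {in U &, forall u v, adj u v ->
    sg u != sg v /\ lb u = lb v \/ [/\ sg u, sg v & lb u <> lb v]}.
  have esym u v : sg v != sg u /\ lb v = lb u \/ [/\ sg v, sg u & lb v <> lb u] ->
      sg u != sg v /\ lb u = lb v \/ [/\ sg u, sg v & lb u <> lb v].
    by rewrite eq_sym => -[[-> ->]|[-> -> /nesym]]; [left|right].
  have hub u v : u \in X :|: Y -> v \in U -> adj u v ->
      sg u != sg v /\ lb u = lb v \/ [/\ sg u, sg v & lb u <> lb v].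
    move=> uXY; rewrite inE => /orP[vXY|vc] uv.
      left; rewrite /lb uXY vXY; split=> //; move: uXY vXY; rewrite /sg !inE.
      have [uX|uX] := boolP (u \in X); have [vX|vX] := boolP (v \in X) => //=.
      - by have := Xst uX vX; rewrite uv.
      - by move=> _ ->.
      - by move=> ->.
      - by move=> uY vY; have := Yst uY vY; rewrite uv.
    move: vc; rewrite inE => vc; right; rewrite /lb /sg uXY (negbTE (dc vc)) !(cX v vc).
    have uX : u \in X.
      by move: uXY; rewrite inE => /orP[//|uY]; have := Yc uY vc; rewrite uv.
    rewrite uX; split=> //.
      by apply: sct; apply/existsP; exists u; rewrite uX nth_index.
    by move=> e; have := ltn_pmod (rim_label ct (index v c)) m0; rewrite -e ltnn.
  move=> u v uU vU uv.
  have [uXY|uXY] := boolP (u \in X :|: Y); first exact: hub.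
  have [vXY|vXY] := boolP (v \in X :|: Y); first by apply: esym; apply: hub; rewrite // adj_sym.
  have uc' : u \in c by move: uU; rewrite inE (negbTE uXY) inE.
  have vc' : v \in c by move: vU; rewrite inE (negbTE vXY) inE.
  have rim (u' v' : G) : u' \in c -> v' \in c -> adj u' v' -> (index u' c < index v' c)%N ->
      sg u' != sg v' /\ lb u' = lb v' \/ [/\ sg u', sg v' & lb u' <> lb v'].
    move=> u'c v'c uv' iuv; rewrite /sg /lb (negbTE (dc u'c)) (negbTE (dc v'c)) !(cX u') // !(cX v') //.
    by apply: rimE; rewrite ?iuv ?idx // !nth_index.
  have [iuv|ivu|e] := ltngtP (index u c) (index v c).
  - exact: rim.
  - by apply: esym; apply: rim; rewrite // adj_sym.
  - by move: uv; rewrite -(nth_index x0 uc') e nth_index // adj_irrefl.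
have [h hX] : exists h, h \in X by move: c0 => /existsP[h /andP[hX _]]; exists h.
pose x := sign_vector R U sg.
have xT : TSTAB R G x by apply: sign_vector_TSTAB edge.
pose tight (u v : G) := [&& u \in U, v \in U, adj u v & sg u != sg v].
pose g v := (2 * (v \in c) + m.-1 * (v == h))%N.
have hU : h \in U by rewrite !inE hX.
have cU v : v \in c -> v \in U by move=> vc; rewrite !inE vc orbT.
have [|||S [Sst St gS]] := @tight_edges R G x tight g tp xT.
- by move=> u v; rewrite /tight adj_sym eq_sym andbCA.
- by move=> u v /and4P[].
- move=> u v /and4P[uU vU uv]; rewrite /x /sign_vector uU vU.
  by case: (sg u); case: (sg v) => //= _; lra.
have sgc t : t < n -> sg (nth x0 c t) = s t.
  by move=> tn; rewrite /sg !(cX _ (mem_nth _ _)) // index_uniq.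
have cn : \sum_(v <- c) ~~ sg v = rim_minus ct n.
  by rewrite (big_nth x0) big_mkord; apply: eq_bigr => t _; rewrite sgc.
have cntS : count (mem S) c = \sum_(v <- c) (v \in S).
  by rewrite -sum1_count big_mkcond; apply: eq_bigr => v _ /=; case: (v \in S).
have gSE : \sum_(v in S) g v <= n.-1.
  have -> : \sum_(v in S) g v = 2 * count (mem S) c + m.-1 * (h \in S).
    rewrite big_split /= -!big_distrr /= cntS; congr (_ * _ + _ * _).
      rewrite big_uniq // big_mkcond [RHS]big_mkcond; apply: eq_bigr => v _ /=.
      by case: (v \in S); case: (v \in c).
    rewrite big_mkcond (bigD1 h) //= eqxx big1 => [|v /negbTE ->]; first by case: (h \in S).
    by case: (v \in S).
  (* Without [h], the rim contributes at most n - 1 by its odd cycle inequality. With [h], tightness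
     carries membership through the connected hub and around the rim: [S] contains [X], and on the
     rim exactly the negative vertices. *)
  have [hS|hS] := boolP (h \in S); last first.
    have := odd_cycle_stable tp Sst (induced_cycle_odd ic oc); rewrite -/n /= => cS.
    have en := odd_double_half n; rewrite (_ : odd n = true) in en; last exact: oc.
    by clear -cS en; lia.
  have hubS p u : path (restrict (X :|: Y)) u p -> (u \in S) = (u \in X) ->
      (last u p \in S) = (last u p \in X).
    elim: p u => //= w p IH u /andP[/and3P[uXY wXY uw] wp] uS; apply: IH => //.
    have sgu : sg u = (u \in X) by move: uXY; rewrite /sg inE; case: (u \in X) => //= ->.
    have sgw : sg w = (w \in X) by move: wXY; rewrite /sg inE; case: (w \in X) => //= ->.
    have uU : u \in U by rewrite inE uXY.
    have wU : w \in U by rewrite inE wXY.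
    have sguw : sg u != sg w.
      have [[//]|[]] := edge u w uU wU uw.
      by rewrite sgu sgw => uX wX; have := Xst uX wX; rewrite uw.
    have := St u w; rewrite /tight uU wU uw sguw => /(_ isT); rewrite uS -sgu -sgw.
    by move: sguw; case: (sg u); case: (sg w); case: (w \in S).
  have XS v : v \in X -> v \in S.
    move=> vX; have /connectP[p hp e] : connect (restrict (X :|: Y)) h v.
      by apply: cXY; rewrite inE ?hX ?vX.
    by rewrite e hubS ?hS ?hX // -e.
  have ctS t : ct t -> nth x0 c t \notin S.
    move=> /existsP[u /andP[uX ut]]; apply/negP => tS.
    by have := Sst _ _ (XS u uX) tS; rewrite ut.
  have cS t : t < n -> (nth x0 c t \in S) = ~~ s t.
    elim: t => [|t IH] tn; first by rewrite (negbTE (ctS _ c0)).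
    have {}IH := IH (ltnW tn).
    have att : adj (nth x0 c t) (nth x0 c t.+1) by rewrite ac ?ltnSn ?eqxx.
    have [ctt|nct] := boolP (ct t.+1); first by rewrite (negbTE (ctS _ ctt)) sct.
    have st1 : s t.+1 = ~~ s t by rewrite /s /= (negbTE nct).
    rewrite st1 negbK; have [st|st] := boolP (s t); last first.
      apply: negbTE; apply/negP => tS.
      have t0S : nth x0 c t \in S by rewrite IH st.
      by have := Sst _ _ t0S tS; rewrite att.
    have := St (nth x0 c t) (nth x0 c t.+1).
    rewrite /tight !cU ?mem_nth ?(ltnW tn) // att !sgc ?(ltnW tn) // st1 IH st /=.
    by move=> /(_ isT) /esym /negbFE.
  have -> : count (mem S) c = rim_minus ct n.
    by rewrite cntS (big_nth x0) big_mkord; apply: eq_bigr => t _; rewrite cS.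
  by clear -mE m3; lia.
have gx : (\sum_v (g v)%:R * x v = n%:R - 3^-1 :> R)%R.
  have xE v : v \in U -> x v = ((1 + ~~ sg v)%N%:R / 3)%R.
    by move=> vU; rewrite /x /sign_vector vU; case: (sg v); rewrite ?mul1r.
  under eq_bigr => v _ do rewrite natrD mulrDl !natrM -!mulrA.
  rewrite big_split /= -!mulr_sumr.
  have -> : (\sum_v (v == h)%:R * x v = 3^-1 :> R)%R.
    rewrite (bigD1 h) //= eqxx big1 => [|v /negbTE ->]; last by rewrite mul0r.
    by rewrite xE // /sg hX /= addn0; lra.
  have -> : (\sum_v (v \in c)%:R * x v = (n + rim_minus ct n)%N%:R / 3 :> R)%R.
    rewrite -cn -[X in (X + _)%N]sum1_size -big_split /= natr_sum mulr_suml [RHS]big_uniq //.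
    rewrite [RHS]big_mkcond; apply: eq_bigr => v _ /=.
    by case: ifP => vc; rewrite ?mul1r ?mul0r // xE ?cU.
  have -> : (m.-1%:R = m%:R - 1 :> R)%R by rewrite -subn1 natrB.
  have : (n%:R = m%:R + 2 * (rim_minus ct n)%:R :> R)%R by rewrite -natrM -natrD mE.
  rewrite natrD; move: (n%:R)%R (m%:R)%R ((rim_minus ct n)%:R)%R => a b d; lra.
move: gS; rewrite gx leNgt => /negP; apply.
apply: (@le_lt_trans _ _ (n.-1)%:R)%R; first by rewrite ler_nat.
have n0 : 0 < n by apply: leq_ltn_trans ln.
by rewrite -subn1 natrB //; lra.
Qed.
End Wheel.

(** The rest of the proof uses t-perfection only through this property and [hit_odd_cycles]. With
    [j = k], three contacts at successive odd distances suffice. Rim vertices may have any further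
    neighbours in [X]. *)
Definition wheel_free (G : sgraph) := forall (X Y : {set G}) (x0 : G) c i j k l,
    stable X -> stable Y -> [disjoint X & Y] -> conn (X :|: Y) ->
    odd (size c) -> induced_cycle x0 c ->
    {in c, forall v, v \notin X :|: Y} -> {in Y & c, forall y v, ~~ adj y v} ->
    i < j -> j <= k -> k < l -> l < size c -> odd (j - i) -> odd (l - k) ->
    (forall t, t \in [:: i; j; k; l] -> exists2 x, x \in X & adj x (nth x0 c t)) ->
  False.

(** * The two facts used about t-perfect graphs *)

Section TPerfect.
Variables (R : realType) (G : sgraph).
Hypothesis tp : t_perfect R G.

Lemma t_perfect_wheel_free : wheel_free G.
Proof.
move=> X Y x0 c i j k l Xst Yst dXY cXY oc ic dc Yc ij jk kl lc oij okl ct.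
have ile : i < size c by lia.
apply: (@wheel0 R G X Y x0 (rot i c) tp Xst Yst dXY cXY _ _ _ _ (j - i) (k - i) (l - i)).
- by rewrite size_rot.
- exact: induced_cycle_rot.
- by move=> v; rewrite mem_rot; apply: dc.
- by move=> y v yY; rewrite mem_rot; apply: Yc.
1-4: have ctI t : i <= t < size c -> t \in [:: i; j; k; l] ->
    [exists x in X, adj x (nth x0 (rot i c) (t - i))]
  by move=> /andP[it tc] /ct [x xX xt]; apply/existsP; exists x;
     rewrite xX nth_rot_lt subnKC.
- by rewrite -[0](subnn i); apply: ctI; rewrite ?inE ?eqxx // leqnn.
- by apply: ctI; rewrite ?inE ?eqxx ?orbT //; lia.
- by apply: ctI; rewrite ?inE ?eqxx ?orbT //; lia.
- by apply: ctI; rewrite ?inE ?eqxx ?orbT //; lia.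
- by lia.
- by lia.
- by lia.
- by rewrite size_rot; lia.
- by [].
- by rewrite subnBA; [rewrite subnK|]; [|lia..].
Qed.

Local Open Scope ring_scope.

(** Since [(2k+1) q = k], the inequalities of the (2k+1)-cycles in [A] are tight at [x] and those of
    longer cycles hold. The sum of the tight ones is a functional maximal at [x]; a stable set
    attaining the same maximum has k > 0 vertices on each of these cycles. *)
Lemma hit_odd_cycles (A : {set G}) k : (0 < k)%N ->
    (forall c, odd_cycle c -> {subset c <= A} -> (k.*2 < size c)%N) ->
  exists2 S : {set G}, stable S &
    forall c, odd_cycle c -> {subset c <= A :\: S} -> (k.+1.*2 < size c)%N.
Proof.
move=> k0 gA.
pose q : R := k%:R / k.*2.+1%:R.
pose x : G -> R^o := fun v => if v \in A then q else 0.
have qE : k.*2.+1%:R * q = k%:R by rewrite /q mulrCA divff ?mulr1 // pnatr_eq0.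
have q2 : q + q <= 1.
  by rewrite /q -mulrDl ler_pdivrMr ?ltr0n // mul1r -natrD ler_nat; lia.
have q0 : 0 <= q by rewrite /q divr_ge0.
have xT : TSTAB R G x.
  apply: TSTAB_intro.
  - by move=> v; rewrite /x; case: ifP.
  - by move=> u v _; rewrite /x; case: ifP => _; case: ifP => _; lra.
  move=> c oc nz.
  have cA : {subset c <= A} by move=> v /nz; rewrite /x; case: ifP; rewrite ?eqxx.
  rewrite big_seq (eq_bigr (fun=> q)); last by move=> v vc; rewrite /x cA.
  rewrite -big_seq big_const_seq count_predT iter_addr_0 -mulr_natl.
  have := gA c oc cA; have /and4P[_ odd_c _ _] := oc => kc.
  have kc' : (k.*2.+1%:R <= (size c)%:R :> R) by rewrite ler_nat.
  have k1 : (k.*2.+1%:R = 2 * k%:R + 1 :> R) by rewrite -natr1 -mul2n natrM.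
  by nra.
(* Cycles are taken as tuples, so each occurs once for every starting point and direction; this only
   multiplies its inequality. *)
pose F := [pred t : (k.*2.+1).-tuple G | odd_cycle t && all (mem A) t].
pose a v : nat := (\sum_(t | F t) count_mem v t)%N.
have count_sum (f : G -> R) (s : seq G) : \sum_v (count_mem v s)%:R * f v = \sum_(v <- s) f v.
  elim: s => [|u s IH]; first by rewrite big_nil big1 // => v _; rewrite mul0r.
  rewrite big_cons -IH /=; under eq_bigr => v _ do rewrite natrD mulrDl.
  rewrite big_split /=; congr (_ + _); rewrite (bigD1 u) //= eqxx mul1r.
  by rewrite big1 ?addr0 // => v; rewrite eq_sym => /negbTE ->; rewrite mul0r.
have aS (S : {set G}) : (\sum_(v in S) a v = \sum_(t | F t) count (mem S) t)%N.
  rewrite exchange_big /=; apply: eq_bigr => t _.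
  elim: {t}(tval t) => [|u s IH] /=; first by rewrite big1.
  rewrite big_split /= IH; congr (_ + _)%N.
  by rewrite big_mkcond (bigD1 u) //= eqxx big1 ?addn0 => [|v]; [case: ifP|rewrite eq_sym => /negbTE ->; case: ifP].
have cnt (S : {set G}) t : stable S -> F t -> (count (mem S) t <= k)%N.
  move=> Sst /andP[oc _]; have := odd_cycle_stable tp Sst oc.
  by have -> : ((size t)./2 = k)%N by rewrite size_tuple; lia.
have := @t_perfect_tight R G x a (fun=> 0%N) (\sum_(t | F t) k)%N tp xT.
case.
- by move=> S Sst; rewrite aS; apply: leq_sum => t; apply: cnt.
- rewrite (eq_bigr (fun v => \sum_(t | F t) (count_mem v t)%:R * x v)); last by move=> v _; rewrite /a natr_sum mulr_suml.
  rewrite exchange_big natr_sum /=; apply: eq_bigr => t /andP[_ /allP tA].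
  rewrite count_sum big_seq (eq_bigr (fun=> q)); last by move=> v /tA vA; rewrite /x [v \in A]vA.
  by rewrite -big_seq big_const_seq count_predT iter_addr_0 size_tuple -[LHS]mulr_natl qE.
move=> S [Sst]; rewrite aS => e _; exists S => // c oc cAS.
have kc : (k.*2 < size c)%N by apply: gA => // v /cAS; rewrite inE => /andP[].
have /and4P[_ odd_c _ _] := oc.
suff : size c != k.*2.+1 by lia.
apply/eqP => sc; have st : size c == k.*2.+1 by rewrite sc.
pose t := Tuple st.
have Ft : F t by rewrite /= oc; apply/allP => v /cAS; rewrite inE => /andP[].
have := @leqif_sum _ F _ _ _ (fun t Ft => leqif_eq (cnt S t Sst Ft)).
rewrite e => -[_]; rewrite eqxx => /esym/forallP /(_ t); rewrite Ft /= => /eqP ct.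
have /hasP[v vc vS] : has (mem S) c by rewrite has_count ct.
by have := cAS v vc; rewrite inE [v \in S]vS.
Qed.

End TPerfect.

(* [classical_sets] shadows lemmas of [fintype] and [finset]. *)
From mathcomp Require Import all_boot.

(** * Colourings and components *)

Section Colouring.
Variable G : sgraph.
Implicit Types (A B C D H K S T : {set G}) (u v w x y z : G).

Definition kcol B k : Prop := exists f : G -> nat,
  {in B, forall v, f v < k} /\ {in B &, forall u v, adj u v -> f u <> f v}.

Lemma kcolS B C k : C \subset B -> kcol B k -> kcol C k.
Proof.
move=> /subsetP CB [f [fk fa]]; exists f; split; first by move=> v /CB; apply: fk.
by move=> u v /CB uB /CB vB; apply: fa.
Qed.

Lemma kcol_le B k l : k <= l -> kcol B k -> kcol B l.
Proof.
move=> kl [f [fk fa]]; exists f; split=> // v vB.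
exact: leq_trans (fk v vB) kl.
Qed.

Lemma kcolU B C k l : kcol B k -> kcol C l -> kcol (B :|: C) (k + l).
Proof.
move=> [f [fk fa]] [g [gl ga]].
exists (fun v => if v \in B then f v else k + g v); split.
  move=> v; rewrite inE; case: ifP => [vB _|_ /= vC]; first by rewrite ltn_addr // fk.
  by rewrite ltn_add2l gl.
move=> u v; rewrite !inE; case: ifP => [uB _|_ /= uC]; case: ifP => [vB _|_ /= vC] uv.
- exact: fa.
- by have := fk u uB; lia.
- by have := fk v vB; lia.
- by have := ga u v uC vC uv; lia.
Qed.

Lemma kcol_stable B : stable B -> kcol B 1.
Proof.
move=> Bst; exists (fun=> 0); split=> // u v uB vB uv.
by have := Bst u v uB vB; rewrite uv.
Qed.

Lemma ncol_exists B k : ~ kcol B k -> exists v, v \in B.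
Proof.
move=> nB; apply: contrapT => h; apply: nB.
by exists (fun=> 0); split=> [v vB|u v uB]; case: h; [exists v|exists u].
Qed.

Lemma ncolD B C D k l : B \subset C :|: D -> kcol C k -> ~ kcol B (k + l) -> ~ kcol D l.
Proof. by move=> sB cC nB cD; apply: nB; apply: kcolS sB _; apply: kcolU. Qed.

Lemma restrict_sym B : symmetric (restrict B).
Proof. by move=> u v; rewrite /restrict adj_sym andbCA. Qed.

Lemma connect_restrict_sym B : connect_sym (restrict B).
Proof. by apply: sym_connect_sym; apply: restrict_sym. Qed.

Lemma connect_restrictS B C u v : B \subset C ->
  connect (restrict B) u v -> connect (restrict C) u v.
Proof.
move=> /subsetP BC; apply: connect_sub => x y /and3P[xB yB xy].
by apply: connect1; rewrite /restrict !BC.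
Qed.

Lemma conn_root r B : (forall v, v \in B -> connect (restrict B) r v) -> conn B.
Proof.
move=> cr u v uB vB; apply: connect_trans (cr v vB).
by rewrite connect_restrict_sym cr.
Qed.

Lemma conn1 v : conn [set v].
Proof. by move=> u w; rewrite !inE => /eqP -> /eqP ->. Qed.

Lemma connU B C u v : conn B -> conn C -> u \in B -> v \in C -> (u == v) || adj u v ->
  conn (B :|: C).
Proof.
move=> cB cC uB vC uv; apply: (@conn_root u) => w; rewrite inE => /orP[wB|wC].
  by apply: connect_restrictS (cB u w uB wB); apply: subsetUl.
apply: (@connect_trans _ _ v); last first.
  by apply: connect_restrictS (cC v w vC wC); apply: subsetUr.
case/orP: uv => [/eqP ->//|uv]; apply: connect1.
by rewrite /restrict !inE uB vC orbT.
Qed.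

Lemma conn_add B u v : conn B -> u \in B -> adj u v -> conn (v |: B).
Proof.
move=> cB uB uv; rewrite setUC; apply: (connU cB (@conn1 v) uB (set11 v)).
by rewrite uv orbT.
Qed.

Lemma connect_cut B S u v : connect (restrict B) u v -> u \in S -> v \notin S ->
  exists x y, [/\ x \in S, y \notin S & restrict B x y].
Proof.
move=> /connectP[p hp ->]; elim: p u hp => [|w p IH] u /=; first by move=> _ ->.
move=> /andP[uw wp] uS vS; have [wS|wS] := boolP (w \in S); first exact: IH wp wS vS.
by exists u, w.
Qed.

Definition component B v : {set G} := [set u in B | connect (restrict B) v u].

Lemma component_sub B v : component B v \subset B.
Proof. by apply/subsetP => u; rewrite inE => /andP[]. Qed.

Lemma component_conn B v : v \in B -> conn (component B v).
Proof.
move=> vB; apply: (@conn_root v) => u; rewrite inE => /andP[uB /connectP[p hp ->]].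
elim/last_ind: p hp {uB} => [|p w IH] //; rewrite rcons_path last_rcons => /andP[hp pw].
apply: connect_trans (IH hp) _; apply: connect1.
have /and3P[lB wB lw] := pw; rewrite /restrict !inE lB wB lw !andbT.
apply/andP; split; first by apply/connectP; exists p.
by apply/connectP; exists (rcons p w); rewrite ?last_rcons // rcons_path hp.
Qed.

Lemma component_out B v x y : x \in component B v -> y \notin component B v -> adj x y -> y \notin B.
Proof.
rewrite inE => /andP[xB vx] ny xy; apply: contra ny => yB.
rewrite inE yB; apply: connect_trans vx _; apply: connect1.
by rewrite /restrict xB yB.
Qed.

Lemma kcol_component B k : (forall v, v \in B -> kcol (component B v) k) -> kcol B k.
Proof.
move=> cB.
have /choice[f fP] : forall v, exists f : G -> nat, v \in B ->
    {in component B v, forall u, f u < k} /\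
    {in component B v &, forall u w, adj u w -> f u <> f w}.
  move=> v; have [vB|vB] := boolP (v \in B); last by exists (fun=> 0).
  by have [f fP] := cB v vB; exists f.
pose r v := root (restrict B) v.
have rB v : v \in B -> r v \in B.
  move=> vB; have := connect_root (restrict B) v; rewrite -/(r v) => /connectP[p hp ->].
  by elim: p v vB hp => //= w p IH v vB /andP[/and3P[_ wB _]]; apply: IH.
have rc v : v \in B -> v \in component B (r v).
  by move=> vB; rewrite inE vB connect_restrict_sym connect_root.
exists (fun v => f (r v) v); split.
  by move=> v vB; have [h _] := fP (r v) (rB v vB); apply: h; apply: rc.
move=> u v uB vB uv.
have -> : r u = r v.
  by apply/eqP; rewrite (root_connect (@connect_restrict_sym B)); apply: connect1; rewrite /restrict uB vB.
have [_ h] := fP (r v) (rB v vB); apply: h => //; last exact: rc.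
by rewrite inE uB connect_restrict_sym (connect_trans _ (connect_root _ v)) // connect1 // /restrict uB vB.
Qed.

Lemma ncol_component B k : ~ kcol B k -> exists2 C : {set G}, C \subset B & conn C /\ ~ kcol C k.
Proof.
move=> nB; apply: contrapT => h; apply: nB; apply: kcol_component => v vB.
apply: contrapT => nc; apply: h; exists (component B v); first exact: component_sub.
by split=> //; apply: component_conn.
Qed.

(** The device for discarding a cheap set from a connected one: what is kept is again connected,
    still needs many colours, and can be entered from a discarded vertex. *)
Lemma ncol_component_adj H S k l : conn H -> ~ kcol H (k + l) -> kcol (H :&: S) k ->
    (exists x, x \in H :&: S) ->
  exists K : {set G}, [/\ conn K, K \subset H :\: S, ~ kcol K l
    & exists t x, [/\ t \in H :&: S, x \in K & adj t x]].
Proof.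
move=> cH nH cHS [z zHS].
have nD : ~ kcol (H :\: S) l.
  by apply: ncolD cHS nH; apply/subsetP => v vH; rewrite !inE vH; case: (v \in S).
have [v vB nv] : exists2 v, v \in H :\: S & ~ kcol (component (H :\: S) v) l.
  apply: contrapT => h; apply: nD; apply: kcol_component => v vB.
  by apply: contrapT => nc; apply: h; exists v.
exists (component (H :\: S) v); split=> //; [exact: component_conn|exact: component_sub|].
have vC : v \in component (H :\: S) v by rewrite inE vB /=.
have zC : z \notin component (H :\: S) v.
  by move: zHS; rewrite !inE => /andP[_ ->].
have vH : v \in H by move: vB; rewrite inE => /andP[].
have zH : z \in H by move: zHS; rewrite inE => /andP[].
have [x [y [xC yC /and3P[xH yH xy]]]] := connect_cut (cH v z vH zH) vC zC.
exists y, x; rewrite adj_sym xC xy inE yH; split=> //.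
have := component_out xC yC xy; rewrite inE yH andbT negbK; exact.
Qed.

End Colouring.

(** * Induced paths and cycles *)

Section Walks.
Variables (G : sgraph) (x0 : G).
Implicit Types (A B C D H K S T : {set G}) (u v w x y z : G) (c p q : seq G).
Notation nth := (nth x0).

Definition induced_path p : Prop :=
  uniq p /\ forall a b, a < b < size p -> adj (nth p a) (nth p b) = (b == a.+1).

(** A repeated vertex splits an odd closed walk into two closed walks, and a chord splits an odd
    cycle of length n into two cycles of total length n + 2. Either way one part is odd and
    shorter. *)
Lemma odd_closed_walk c : cycle (@adj G) c -> odd (size c) ->
  exists c' : seq G, [/\ {subset c' <= c}, odd (size c'), size c' <= size c
    & induced_cycle x0 c'].
Proof.
have [n] := ubnP (size c); elim: n c => // n IH c cn cc oc.
suff [[c' [sc' cc' oc' lc']]|ic] :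
    (exists c', [/\ {subset c' <= c}, cycle (@adj G) c', odd (size c') & size c' < size c])
    \/ induced_cycle x0 c.
- have [|d [dc od ld id]] := IH c' _ cc' oc'; first by lia.
  by exists d; split=> //; [move=> z /dc /sc'|lia].
- by exists c; split.
have [uc|] := boolP (uniq c); last first.
  move=> /(uniqPn x0)[i [j [ij jc eij]]]; left.
  pose d := rot i c; have ile : i < size c by apply: ltn_trans ij jc.
  have dE : d = nth c i :: (drop i.+1 c ++ take i c) by rewrite /d /rot (drop_nth x0 ile).
  have vd : nth c i \in drop i.+1 c ++ take i c.
    rewrite mem_cat eij; apply/orP; left.
    by rewrite -[j](subnKC ij) -nth_drop mem_nth // size_drop; lia.
  have cd : cycle (@adj G) d by rewrite rot_cycle.
  have sd : size d = size c by rewrite size_rot.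
  have mc z : z \in d -> z \in c by rewrite mem_rot.
  move: (nth c i) (drop i.+1 c ++ take i c) dE vd => v r dE vr.
  have /path.splitPr rE := vr; case: rE dE => p q dE.
  move: cd sd mc; rewrite dE /= rcons_cat cat_path /= size_cat /= => /and3P[vp pv vq] sd mc.
  have [op|op] := boolP (odd (size p).+1).
    exists (v :: p); split=> //=; last by rewrite -sd; lia.
      by move=> z; rewrite inE => /orP[zv|zp]; apply: mc; rewrite inE ?zv // mem_cat zp orbT.
    by rewrite rcons_path vp pv.
  exists (v :: q); split=> //=; [|by move: oc op; rewrite -sd /= oddD /=; case: (odd _); case: (odd _)|by rewrite -sd; lia].
  by move=> z zq; apply: mc; rewrite inE mem_cat zq !orbT.
have [[a [b [ab bc adjab n1 n2]]]|nch] := pselect (exists a b, [/\ a < b, b < size c,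
    adj (nth c a) (nth c b), b <> a.+1 & ~ (a = 0 /\ b.+1 = size c)]).
  left; pose d := rot a c; have ac : a < size c := ltn_trans ab bc.
  have dE : d = nth c a :: (drop a.+1 c ++ take a c) by rewrite /d /rot (drop_nth x0 ac).
  have cd : cycle (@adj G) d by rewrite rot_cycle.
  have sd : size d = size c by rewrite size_rot.
  have mc z : z \in d -> z \in c by rewrite mem_rot.
  have dropE : drop a.+1 c = take (b - a.+1) (drop a.+1 c) ++ nth c b :: drop b.+1 c.
    rewrite -{1}[drop a.+1 c](cat_take_drop (b - a.+1)) drop_drop subnK //.
    by rewrite (drop_nth x0 bc).
  have s1 : size (take (b - a.+1) (drop a.+1 c)) = b - a.+1.
    by rewrite size_takel // size_drop leq_sub2r // ltnW.
  have s2 : size (drop b.+1 c ++ take a c) = size c - b.+1 + a.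
    by rewrite size_cat size_drop size_takel // ltnW.
  move: dE; rewrite dropE -catA /=.
  move: (take (b - a.+1) _) (drop b.+1 c ++ take a c) s1 s2 adjab => p q s1 s2 adjab dE.
  move: (nth c a) (nth c b) adjab dE => v w vw dE.
  move: cd sd mc; rewrite dE /= rcons_cat cat_path /= size_cat /= => /and3P[vp pw wq] sd mc.
  have [op|op] := boolP (odd (size p)).
    exists (v :: rcons p w); split.
    - move=> z; rewrite inE mem_rcons inE => zz; apply: mc; rewrite inE mem_cat inE.
      by case/or3P: zz => ->; rewrite ?orbT.
    - by rewrite /= rcons_path last_rcons rcons_path vp pw /= adj_sym.
    - by rewrite /= size_rcons /= negbK.
    - by rewrite /= size_rcons; move: n2; rewrite -sd; lia.
  exists (v :: w :: q); split.
  - move=> z; rewrite !inE => zz; apply: mc; rewrite inE mem_cat inE.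
    by case/or3P: zz => ->; rewrite ?orbT.
  - by rewrite /= vw.
  - by move: oc op; rewrite -sd /= oddD /=; case: (odd _); case: (odd _).
  - by rewrite /= -sd; lia.
right.
have adjS i : i.+1 < size c -> adj (nth c i) (nth c i.+1).
  move: cc; case: (c) => //= u p; rewrite rcons_path => /andP[/(pathP x0) h _] ip.
  exact: (h i).
have adj0 : 0 < size c -> adj (nth c 0) (nth c (size c).-1).
  move: cc; case: (c) => //= u p; rewrite rcons_path => /andP[_ h] _.
  by rewrite adj_sym (nth_last x0 (u :: p)).
split=> //.
  case: (c) oc adj0 => [|u [|v [|w p]]] //= _ /(_ isT).
  by rewrite adj_irrefl.
move=> a b /andP[ab bc]; apply/idP/idP; last first.
  case/orP=> [/eqP e|/andP[/eqP -> /eqP eb]]; first by rewrite e; apply: adjS; rewrite -e.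
  by move: adj0; rewrite -eb => ->.
move=> adjab; apply: contrapT => /negP; rewrite negb_or negb_and => /andP[n1 n2].
apply: nch; exists a, b; split=> //; first exact/eqP.
by move=> [e1 e2]; move: n2; rewrite e1 e2 !eqxx.
Qed.

Lemma path_restrict B x p : path (restrict B) x p -> path (@adj G) x p /\ {subset p <= B}.
Proof.
elim: p x => //= y p IH x /andP[/and3P[_ yB xy] /IH[yp pB]].
by split; [rewrite xy|move=> z; rewrite inE => /orP[/eqP ->|/pB]].
Qed.

Lemma restrict_path B x p : path (@adj G) x p -> {subset x :: p <= B} -> path (restrict B) x p.
Proof.
elim: p x => //= y p IH x /andP[xy yp] pB.
rewrite /restrict xy !pB ?inE ?eqxx ?orbT //=; apply: IH => // z zp.
by apply: pB; rewrite inE zp orbT.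
Qed.

(** The colour records whether some walk of even length leads from the root. Adjacent vertices that
    both have one would close an odd walk; if neither has one, the edge prolongs an odd walk to an
    even one. *)
Lemma kcol2 B : (forall c, {subset c <= B} -> odd (size c) -> induced_cycle x0 c -> False) ->
  kcol B 2.
Proof.
move=> noc; apply: kcol_component => r rB.
pose ev v := exists p, [/\ path (restrict B) r p, last r p = v & ~~ odd (size p)].
have clash u v : adj u v -> ev u -> ev v -> False.
  move=> uv [p [rp lp op]] [q [rq lq oq]].
  have [rp' pB] := path_restrict rp; have [rq' qB] := path_restrict rq.
  pose c := r :: p ++ rev q.
  have cc : cycle (@adj G) c.
    rewrite /c /= rcons_cat -rev_cons cat_path rp' lp /=.
    rewrite lastI rev_rcons /= lq uv -lq.
    by rewrite rev_path; under eq_path => x y do rewrite adj_sym.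
  have oc : odd (size c) by rewrite /= size_cat size_rev oddD (negbTE op) (negbTE oq).
  have [c' [sc' oc' _ ic]] := odd_closed_walk cc oc.
  apply: (noc c') => // z /sc'; rewrite inE mem_cat mem_rev.
  by case/or3P=> [/eqP ->|/pB|/qB].
exists (fun v => `[< ev v >] : nat); split; first by move=> v _; case: `[< _ >].
move=> u v; rewrite inE => /andP[uB /connectP[pu ru eu]].
rewrite inE => /andP[vB _] uv.
have [eu'|eu'] := pselect (ev u); have [ev'|ev'] := pselect (ev v).
- by case: (clash u v).
- by rewrite asboolT // asboolF.
- by rewrite asboolF // asboolT.
case: ev'; exists (rcons pu v); rewrite rcons_path last_rcons ru /= -eu /restrict uB vB uv.
split=> //; rewrite size_rcons /= negbK.
by apply: contraT => oe; case: eu'; exists pu.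
Qed.

Lemma shortest_path B x y : x \in B -> connect (restrict B) x y ->
  exists p, [/\ induced_path (x :: p), {subset x :: p <= B} & last x p = y].
Proof.
move=> xB /connectP[p hp ey].
have [n] := ubnP (size p); elim: n p hp ey => // n IH p hp ey pn.
have [hp' pB] := path_restrict hp.
suff [[q [hq lq sq]]|ip] : (exists q, [/\ path (restrict B) x q, last x q = last x p & size q < size p])
    \/ induced_path (x :: p).
- by apply: (IH q) => //; [rewrite lq|lia].
- by exists p; split=> // z; rewrite inE => /orP[/eqP ->|/pB].
have [up|up] := boolP (uniq (x :: p)); last first.
  left; case: (shortenP hp) => q hq uq sq.
  exists q; split=> //; rewrite ltnNge; apply: contra up => pq.
  apply: (leq_size_uniq uq) => //= z; rewrite !inE => /orP[->//|/sq ->]; exact: orbT.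
have [[a [b [ab bc adjab n1]]]|nch] := pselect (exists a b, [/\ a < b, b < size (x :: p),
    adj (nth (x :: p) a) (nth (x :: p) b) & b <> a.+1]).
  left.
  have hab : restrict B (nth (x :: p) a) (nth (x :: p) b).
    have inB i : i < size (x :: p) -> nth (x :: p) i \in B.
      by move=> ip; have := mem_nth x0 ip; rewrite inE => /orP[/eqP ->|/pB].
    by rewrite /restrict adjab !inB // (ltn_trans ab).
  case: b ab bc n1 hab {adjab} => // b ab bc n1 hab.
  exists (take a p ++ drop b p).
  have bp : b < size p by [].
  have ap : a <= size p by lia.
  have dE : drop b p = nth (x :: p) b.+1 :: drop b.+1 p by rewrite (drop_nth x0 bp).
  have lE : last x (take a p) = nth (x :: p) a.
    have := nth_last x0 (x :: take a p); rewrite [size _]/= size_takel //= => <-.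
    by rewrite -[x :: take a p]/(take a.+1 (x :: p)) nth_take.
  split.
  - have := hp; rewrite -{1}(cat_take_drop a p) cat_path => /andP[h1 _].
    rewrite cat_path h1 /= lE dE /= hab /=.
    by move: hp; rewrite -{1}(cat_take_drop b p) cat_path dE /= => /and3P[].
  - by rewrite -{3}(cat_take_drop b p) !last_cat dE.
  - by rewrite size_cat size_takel // size_drop; lia.
right; split=> // a b /andP[ab bp]; apply/idP/eqP => [adjab|eb].
  by apply: contrapT => n1; apply: nch; exists a, b.
by rewrite eb; move/(pathP x0): hp' => /(_ a) /=; apply; rewrite eb in bp.
Qed.

Lemma induced_path_adj p a : induced_path p -> a.+1 < size p -> adj (nth p a) (nth p a.+1).
Proof. by move=> [_ h] ap; rewrite h ?eqxx // ltnSn. Qed.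

End Walks.

Section Paths.
Variables (G : sgraph) (x0 : G).
Implicit Types (A B C D H K S T : {set G}) (u v w x y z : G) (c p q : seq G).
Notation nth := (nth x0).
Notation induced_path := (induced_path x0).
Notation induced_cycle := (induced_cycle x0).

Lemma induced_path_take n p : induced_path p -> induced_path (take n p).
Proof.
move=> [up ap]; split; first exact: take_uniq.
move=> a b /andP[ab bp]; move: bp; rewrite size_take_min ltn_min => /andP[bn bp].
by rewrite !nth_take ?(ltn_trans ab) //; apply: ap; rewrite ab.
Qed.

Lemma induced_path_drop n p : induced_path p -> induced_path (drop n p).
Proof.
move=> [up ap]; split; first exact: drop_uniq.
move=> a b /andP[ab bp]; move: bp; rewrite size_drop => bp.
rewrite !nth_drop ap; last by apply/andP; split; lia.
by rewrite -addnS eqn_add2l.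
Qed.

Lemma induced_path_rev p : induced_path p -> induced_path (rev p).
Proof.
move=> [up ap]; split; first by rewrite rev_uniq.
move=> a b /andP[ab bp]; move: bp; rewrite size_rev => bp.
rewrite !nth_rev ?(ltn_trans ab) // adj_sym ap; last by apply/andP; split; lia.
by apply/eqP/eqP; lia.
Qed.

Lemma induced_path_cat p s q : induced_path (rcons p s) -> induced_path (s :: q) ->
  {in p & q, forall u v, u != v /\ ~~ adj u v} -> induced_path (rcons p s ++ q).
Proof.
move=> [up ap] [uq aq] pq; split.
  rewrite cat_uniq up (subseq_uniq (subseq_cons _ _) uq) andbT /=.
  apply/hasPn => v vq; rewrite mem_rcons inE negb_or; apply/andP; split.
    by apply: contraTneq vq => ->; move: uq => /= /andP[].
  by apply/negP => vp; have [] := pq v v vp vq; rewrite eqxx.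
move=> a b; rewrite size_cat size_rcons => /andP[ab bp].
have nq j : j < size q -> nth (s :: q) j.+1 = nth q j by [].
rewrite !nth_cat size_rcons.
have [ha|ha] := ltnP a (size p).+1; have [hb|hb] := ltnP b (size p).+1; last 2 first.
- by lia.
- by rewrite -!nq ?aq /=; lia.
- by apply: ap; rewrite ab size_rcons.
move: ha; rewrite ltnS leq_eqVlt => /orP[/eqP ea|ha].
  have -> : nth (rcons p s) a = nth (s :: q) 0 by rewrite nth_rcons ea ltnn eqxx.
  by rewrite -nq ?aq /=; lia.
have -> : nth (rcons p s) a = nth p a by rewrite nth_rcons ha.
have [_ /negbTE ->] : nth p a != nth q (b - (size p).+1) /\ ~~ adj (nth p a) (nth q (b - (size p).+1)).
  by apply: pq; apply: mem_nth; rewrite // ltn_subLR.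
by apply/esym/eqP; lia.
Qed.

(** As [q] is nonempty, [a] and [z] are the ends of an induced path on at least three vertices and
    therefore nonadjacent. *)
Lemma induced_close a p z q : induced_path (a :: rcons p z) -> induced_path (z :: rcons q a) ->
  q != [::] -> {in p & q, forall u v, u != v /\ ~~ adj u v} ->
  induced_cycle (a :: rcons p z ++ q).
Proof.
move=> [up ap] [uq aq] q0 pq.
have sq : 0 < size q by case: (q) q0.
have qa v : v \in q -> (v != z) && (v != a).
  move=> vq; apply/andP; split.
    by apply: contraTneq vq => ->; move: uq; rewrite /= mem_rcons inE negb_or -andbA => /and3P[].
  apply: contraTneq vq => ->; move: uq => /= /andP[_]; rewrite rcons_uniq => /andP[]; exact.
split.
- by rewrite /= size_cat size_rcons; lia.
- rewrite -cat_cons cat_uniq up /=; apply/andP; split.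
    apply/hasPn => v vq; rewrite inE mem_rcons inE !negb_or; have /andP[-> ->] := qa v vq.
    by apply/negP => vp; have [] := pq v v vp vq; rewrite eqxx.
  by move: uq => /= /andP[_]; rewrite rcons_uniq => /andP[].
move=> i j /andP[ij]; rewrite /= size_cat size_rcons => jn.
rewrite -cat_cons !nth_cat [size (_ :: rcons _ _)]/= size_rcons.
have nq t : t < size q -> nth q t = nth (z :: rcons q a) t.+1 by move=> tq; rewrite /= nth_rcons tq.
have [hi|hi] := ltnP i (size p).+2; have [hj|hj] := ltnP j (size p).+2; last 2 first.
- by lia.
- by rewrite !nq ?aq /= ?size_rcons; lia.
- by rewrite -[nth (a :: rcons p z) i]/(nth (a :: rcons p z) i) ap /= ?size_rcons; lia.
set t := j - (size p).+2; have tq : t < size q by rewrite /t; lia.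
case: i ij hi => [|i] ij hi /=.
  have -> : a = nth (z :: rcons q a) (size q).+1 by rewrite /= nth_rcons ltnn eqxx.
  by rewrite nq // adj_sym aq /= ?size_rcons /t; lia.
have [ei|hi'] : i = size p \/ i < size p by lia.
  have -> : nth (rcons p z) i = nth (z :: rcons q a) 0 by rewrite nth_rcons ei ltnn eqxx.
  by rewrite nq // aq /= ?size_rcons /t; lia.
have -> : nth (rcons p z) i = nth p i by rewrite nth_rcons hi'.
have [_ /negbTE ->] : nth p i != nth q t /\ ~~ adj (nth p i) (nth q t).
  by apply: pq; apply: mem_nth.
by rewrite orbF; apply/esym/eqP; move: hi' tq; rewrite /t; lia.
Qed.

Lemma induced_cycle_take n c : n < size c -> induced_cycle c -> induced_path (take n c).
Proof.
move=> nc [s3 uc ac]; split; first exact: take_uniq.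
move=> a b; rewrite size_takel ?(ltnW nc) // => /andP[ab bn].
by rewrite !nth_take ?ac; lia.
Qed.

(** The bounds on [i] exclude [s] and its two neighbours, so both arcs have inner vertices. On an
    odd cycle the two arcs have lengths of different parity: this is the source of all parity
    choices below. *)
Lemma induced_cycle_arcs s o i : 1 < i -> i < size o -> induced_cycle (s :: o) ->
  induced_path (take i.+1 (s :: o)) /\ induced_path (s :: rev (drop i (s :: o))).
Proof.
move=> i1 io ic; split; first by apply: induced_cycle_take.
have -> : s :: rev (drop i (s :: o)) = rev (take (size o - i).+2 (rot i (s :: o))).
  rewrite /rot take_cat size_drop /= ltnNge.
  have -> : (size o).+1 - i <= (size o - i).+2 by lia.
  have -> : (size o - i).+2 - ((size o).+1 - i) = 1 by lia.
  by case: i i1 {io} => //= i _; rewrite take0 rev_cat.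
apply: induced_path_rev; apply: induced_cycle_take; first by rewrite size_rot /=; lia.
by apply: induced_cycle_rot => //=; lia.
Qed.

Lemma path_conn x p : path (@adj G) x p -> conn [set v in x :: p].
Proof.
move=> hp; apply: (@conn_root _ x) => v; rewrite inE => /path.splitPl vp.
case: vp hp => p1 p2 <-; rewrite cat_path => /andP[h1 _].
apply/connectP; exists p1 => //; apply: restrict_path => // z.
by rewrite !inE mem_cat => /orP[->//|->]; rewrite orbT.
Qed.

Lemma induced_path_path x p : induced_path (x :: p) -> path (@adj G) x p.
Proof.
move=> ip; apply/(pathP x0) => i ib.
by apply: (@induced_path_adj _ x0 (x :: p) i ip).
Qed.

Lemma induced_path_conn p : induced_path p -> conn [set v in p].
Proof.
case: p => [|x p] ip; first by move=> u v; rewrite !inE.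
by apply: path_conn; apply: induced_path_path.
Qed.

End Paths.

(** * Contacts with a hub *)

Section WheelFree.
Variables (G : sgraph) (x0 : G) (A : {set G}).
Implicit Types (B C D E H K S T W X Y : {set G}) (u v w x y z : G) (c p q l : seq G).
Notation nth := (nth x0).
Notation induced_path := (induced_path x0).
Notation induced_cycle := (induced_cycle x0).

Hypothesis og : forall c, odd_cycle c -> {subset c <= A} -> 7 < size c.
Hypothesis wf : wheel_free G.

Lemma no_short_walk c : cycle (@adj G) c -> odd (size c) -> size c <= 7 -> {subset c <= A} -> False.
Proof.
move=> cc oc c7 cA; have [c' [sc' oc' lc' ic]] := odd_closed_walk x0 cc oc.
have := og (induced_cycle_odd ic oc') (fun z zc => cA z (sc' z zc)).
by rewrite ltnNge (leq_trans lc' c7).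
Qed.

(** An induced odd cycle in [W] would be the rim of a wheel with contacts at positions 0, 1 and
    2. *)
Lemma contacts_bipartite X Y W : stable X -> stable Y -> [disjoint X & Y] -> conn (X :|: Y) ->
    {in W, forall w, w \notin X :|: Y} -> {in Y & W, forall y w, ~~ adj y w} ->
    {in W, forall w, exists2 x, x \in X & adj x w} ->
  kcol W 2.
Proof.
move=> Xst Yst dXY cXY dW YW XW; apply: (@kcol2 _ x0) => c cW oc ic.
have [s3 _ _] := ic.
apply: (wf Xst Yst dXY cXY oc ic (i := 0) (j := 1) (k := 1) (l := 2)) => //.
- by move=> v /cW; apply: dW.
- by move=> y v yY /cW; apply: YW.
- move=> t; rewrite !inE => tt; apply: XW; apply: cW; apply: mem_nth.
  by case/or4P: tt => /eqP ->; apply: leq_trans s3.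
Qed.

Definition parity_class l (b : bool) : {set G} := [set v in l | odd (index v l) == b].

Lemma parity_class_stable l b : induced_path l -> stable (parity_class l b).
Proof.
move=> [ul al] u v; rewrite !inE => /andP[ul' /eqP ou] /andP[vl' /eqP ov].
have iu : index u l < size l by rewrite index_mem.
have iv : index v l < size l by rewrite index_mem.
have key (a c : nat) : a < c < size l -> odd a = b -> odd c = b -> ~~ adj (nth l a) (nth l c).
  move=> ac oa oc; rewrite al //; apply/eqP => e.
  by move: oc; rewrite e /= oa; case: (b).
have [lt|gt|e] := ltngtP (index u l) (index v l).
- by rewrite -(nth_index x0 ul') -(nth_index x0 vl'); apply: key => //; rewrite lt.
- by rewrite adj_sym -(nth_index x0 ul') -(nth_index x0 vl'); apply: key => //; rewrite gt.
- by rewrite -(nth_index x0 ul') e nth_index // adj_irrefl.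
Qed.

Lemma parity_classU l b : parity_class l b :|: parity_class l (~~ b) = [set v in l].
Proof.
apply/setP => v; rewrite !inE -andb_orr; case: (v \in l) => //=.
by case: (odd _); case: b.
Qed.

Lemma parity_class_disjoint l b : [disjoint parity_class l b & parity_class l (~~ b)].
Proof.
rewrite -setI_eq0; apply/eqP/setP => v; rewrite !inE.
by case: (v \in l) => //=; case: (odd _); case: b.
Qed.

(* A vertex seeing [l] in one parity class only can be added to the other
   class, so [l] with such vertices is the hub of wheels with rims in [K]. *)
Lemma exclusive_contacts l b E K : induced_path l -> l != [::] ->
    {in K & l, forall v u, u != v /\ ~~ adj u v} ->
    {in E, forall e, [/\ e \notin l, e \notin K, exists2 u, u \in parity_class l b & adj u e
      & {in parity_class l (~~ b), forall u, ~~ adj u e}]} ->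
  kcol [set v in K | [exists e in E, adj v e]] 4.
Proof.
move=> il l0 Kl El.
have cl : conn (parity_class l b :|: parity_class l (~~ b)).
  by rewrite parity_classU; apply: induced_path_conn il.
have [f [f2 fa]] : kcol E 2.
  refine (contacts_bipartite (parity_class_stable (b := b) il) (parity_class_stable (b := ~~ b) il)
     (parity_class_disjoint l b) cl _ _ _).
  - by move=> e /El[el _ _ _]; rewrite parity_classU inE.
  - by move=> y e yY /El[_ _ _]; apply.
  - by move=> e /El[_ _ ? _].
(* [E] itself is 2-colourable, by wheels with hub [l]. Its colour classes are stable and join the
   hub one at a time, at a cost of two colours each. *)
have half t : kcol [set v in K | [exists e in E, (f e == t) && adj v e]] 2.
  pose Et := [set e in E | f e == t].
  apply: (@contacts_bipartite (parity_class l (~~ b) :|: Et) (parity_class l b)).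
  - move=> u v; rewrite !in_setU => /orP[ul|uE] /orP[vl|vE].
    + exact: (parity_class_stable il ul vl).
    + by move: vE; rewrite inE => /andP[/El[_ _ _ h] _]; apply: h.
    + by move: uE; rewrite inE adj_sym => /andP[/El[_ _ _ h] _]; apply: h.
    + move: uE vE; rewrite !inE => /andP[uE /eqP fu] /andP[vE /eqP fv].
      by apply/negP => uv; have := fa u v uE vE uv; rewrite fu fv.
  - exact: parity_class_stable.
  - rewrite -setI_eq0; apply/eqP/setP => v; rewrite !inE.
    have [vE|] := boolP (v \in E).
      by have [/negbTE -> _ _ _] := El v vE; rewrite /= andbF.
    by case: (v \in l) => //=; rewrite ?andbF ?orbF //; case: (odd _); case: (b).

  - rewrite setUC setUA parity_classU; apply: (@conn_root _ (head x0 l)) => v.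
    have hl : head x0 l \in l by case: (l) l0 => //= u p _; rewrite inE eqxx.
    have cc u : u \in l -> connect (restrict ([set v in l] :|: Et)) (head x0 l) u.
      move=> ul; apply: connect_restrictS (subsetUl _ _) _.
      by apply: (induced_path_conn il); rewrite inE.
    rewrite in_setU in_set => /orP[|vE]; first exact: cc.
    have := vE; rewrite inE => /andP[/El[_ _ [u ub uv] _] _].
    have ul : u \in l by move: ub; rewrite inE => /andP[].
    apply: connect_trans (cc u ul) _; apply: connect1.
    by rewrite /restrict uv !in_setU vE in_set ul orbT.
  - move=> v; rewrite inE => /andP[vK _]; rewrite !inE; apply/negP.
    case/orP=> [/orP[/andP[vl _]|/andP[vE _]]|/andP[vl _]].
    + by have [/eqP] := Kl v v vK vl.
    + by have [_ /negP] := El v vE.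
    + by have [/eqP] := Kl v v vK vl.
  - move=> y v; rewrite !inE => /andP[yl _] /andP[vK _].
    by have [] := Kl v y vK yl.
  - move=> v; rewrite inE => /andP[_ /existsP[e /and3P[eE fe ve]]].
    by exists e; rewrite ?inE ?eE ?fe ?orbT // adj_sym.
apply: (@kcolS _ ([set v in K | [exists e in E, (f e == 0) && adj v e]] :|:
                  [set v in K | [exists e in E, (f e == 1) && adj v e]])); last first.
  by apply: (@kcolU _ _ _ 2 2).
apply/subsetP => v; rewrite !inE => /andP[-> /existsP[e /andP[eE ve]]] /=.
have := f2 e eE; case fe : (f e) => [|[|k]] // _; apply/orP; [left|right]; apply/existsP; exists e.
  by rewrite eE fe eqxx.
by rewrite eE fe eqxx.
Qed.

(** Let [W] be minimal and contain an induced odd cycle. By minimality each vertex o of the cycle is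
    a terminal or separates some terminal from the rest of the cycle. No terminal serves two cycle
    vertices: one outside the cycle has a path that meets the cycle first at some y, and this path
    avoids every other cycle vertex. So the cycle has at most 7 vertices, against [og]. *)
Lemma small_connector W (tau : seq G) : W \subset A -> conn W -> {subset tau <= W} -> size tau <= 7 ->
  exists T : {set G}, [/\ conn T, T \subset W, {subset tau <= T} & kcol T 2].
Proof.
have [n] := ubnP #|W|; elim: n W => // n IH W cn WA cW tW t7.
have [k2|nk] := pselect (kcol W 2); first by exists W; split.
have [c [cW' oc ic]] : exists c, [/\ {subset c <= W}, odd (size c) & induced_cycle c].
  apply: contrapT => h; apply: nk; apply: (@kcol2 _ x0) => c cW' oc ic.
  by apply: h; exists c.
have [[T [TW cT tT]]|nT] := pselect (exists T : {set G}, [/\ T \proper W, conn T & {subset tau <= T}]).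
  have [|||||T' [cT' T'T tT' kT']] := IH T => //.
  - by have := proper_card TW; lia.
  - exact: subset_trans (proper_sub TW) WA.
  by exists T'; split=> //; exact: subset_trans T'T (proper_sub TW).
have [s3 uc _] := ic.
have c7 : 7 < size c by apply: og (induced_cycle_odd ic oc) _ => z /cW' /(subsetP WA).
pose R o := [set v in W | v != o].
(* If no terminal served o, the component of [W] minus o containing the rest of the cycle would be a
   smaller connected set with all terminals. *)
have far o : exists t, o \in c -> t \in tau /\
    (t = o \/ forall v, v \in c -> v != o -> ~ connect (restrict (R o)) t v).
  have [oc'|_] := boolP (o \in c); last by exists o.
  suff [t [t1 t2]] : exists t, t \in tau /\
    (t = o \/ forall v, v \in c -> v != o -> ~ connect (restrict (R o)) t v) by exists t.
  apply: contrapT => h; apply: nT.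
  have ot : o \notin tau by apply/negP => ot; apply: h; exists o; split=> //; left.
  have [i p ep] := rot_to oc'.
  have up : uniq (o :: p) by rewrite -ep rot_uniq.
  have pc v : v \in p -> v \in c /\ v != o.
    move=> vp; split; first by rewrite -(mem_rot i) ep inE vp orbT.
    by apply: contraTneq vp => ->; case/andP: up.
  case: p ep up pc => [|r p] ep up pc.
    by have := size_rot i c; rewrite ep /=; lia.
  have rpc : path (@adj G) r p.
    have := induced_cycle_odd ic oc => /and4P[_ _ _].
    by rewrite -(rot_cycle i) ep /= rcons_path => /and3P[].
  have [rc ro] := pc r (mem_head _ _).
  have rR : r \in R o by rewrite inE cW'.
  have all_r v : v \in c -> v != o -> connect (restrict (R o)) r v.
    move=> vc vo; have vp : v \in r :: p.
      by move: vc; rewrite -(mem_rot i) ep inE (negbTE vo).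
    apply: (@connect_restrictS _ [set z in r :: p]).
      by apply/subsetP => z; rewrite inE => /pc[zc zo]; rewrite inE cW' ?zc.
    by apply: (path_conn rpc); rewrite inE // mem_head.
  exists (component (R o) r); split.
  - apply/properP; split.
      by apply: subset_trans (component_sub _ _) _; apply/subsetP => z; rewrite inE => /andP[].
    by exists o; [exact: cW'|rewrite !inE eqxx andbF].
  - exact: component_conn.
  - move=> t tt; have to : t != o by apply: contraNneq ot => <-.
    rewrite inE inE tW // to /=; apply: contrapT => nrt; apply: h; exists t; split=> //; right.
    move=> v vc vo tv; apply: nrt; apply: connect_trans (all_r v vc vo) _.
    by rewrite connect_restrict_sym.
have /choice[f fP] := far.
suff : size c <= size tau by lia.
rewrite -(size_map f); apply: uniq_leq_size; last first.
  by move=> t /mapP[o oc' ->]; have [] := fP o oc'.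
rewrite map_inj_in_uniq // => o o' oc1 oc2 e; apply/eqP; apply: contraT => oo'.
have [t1 h1] := fP o oc1; have [t2 h2] := fP o' oc2; move: h2; rewrite -e => h2.
set t := f o in t1 h1 h2.
have nto : t \notin c.
  apply/negP => tc; case: h1 => [to|h1]; case: h2 => [to'|h2].
  - by move: oo'; rewrite -to to' eqxx.
  - by apply: (h2 t tc); rewrite ?to.
  - by apply: (h1 t tc); rewrite ?to' 1?eq_sym.
  - by have [to|to] := eqVneq t o; [apply: (h2 t)|apply: (h1 t)]; rewrite ?to.
have {}h1 : forall v, v \in c -> v != o -> ~ connect (restrict (R o)) t v.
  by case: h1 => // to; move: nto; rewrite to oc1.
have {}h2 : forall v, v \in c -> v != o' -> ~ connect (restrict (R o')) t v.
  by case: h2 => // to; move: nto; rewrite to oc2.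
pose S := component [set v in W | v \notin c] t.
have tS : t \in S by rewrite !inE tW // nto connect0.
have oS : o \notin S by rewrite !inE oc1 andbF.
have [x [y [xS yS /and3P[xW yW xy]]]] := connect_cut (cW t o (tW t t1) (cW' o oc1)) tS oS.
have yc : y \in c by have := component_out xS yS xy; rewrite inE yW /= negbK.
have reach o1 : o1 \in c -> y != o1 -> connect (restrict (R o1)) t y.
  move=> o1c yo; apply: (@connect_trans _ _ x).
    move: xS; rewrite inE => /andP[_]; apply: connect_restrictS; apply/subsetP => z.
    by rewrite !inE => /andP[-> zc]; apply: contraNneq zc => ->.
  apply: connect1; rewrite /restrict !inE xW yW yo xy !andbT /=.
  move: xS; rewrite !inE => /andP[/andP[_ xc] _]; by apply: contraNneq xc => ->.
have [yo|yo] := eqVneq y o; last by case: (h1 y yc yo (reach o oc1 yo)).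
have yo' : y != o' by rewrite yo.
by case: (h2 y yc yo' (reach o' oc2 yo')).
Qed.

End WheelFree.

(** [f] is the distance from [r] in the subgraph induced by [B], given by its local properties. *)
Definition levelling (G : sgraph) (B : {set G}) (f : G -> nat) (r : G) : Prop :=
  [/\ r \in B, f r = 0, {in B &, forall u v, adj u v -> f u <= (f v).+1},
      {in B, forall v, 0 < f v -> exists u, [/\ u \in B, adj v u & f v = (f u).+1]}
    & {in B, forall v, f v = 0 -> v = r}].

Lemma levelling_exists (G : sgraph) (B : {set G}) r : conn B -> r \in B ->
  exists f, levelling B f r.
Proof.
move=> cB rB.
pose P v n := exists p, [/\ path (restrict B) r p, last r p = v & size p = n].
have /choice[f fP] : forall v, exists n, v \in B -> P v n /\ forall m, P v m -> n <= m.
  move=> v; have [vB|_] := boolP (v \in B); last by exists 0.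
  have ex : exists n, `[< P v n >].
    by have /connectP[p hp ->] := cB r v rB vB; exists (size p); apply/asboolP; exists p.
  exists (ex_minn ex) => _; case: ex_minnP => n /asboolP Pn nm; split=> // m Pm.
  by apply: nm; apply/asboolP.
exists f; split=> //.
- have [_ h] := fP r rB; apply/eqP; rewrite -leqn0; apply: h.
  by exists [::].
- move=> u v uB vB uv; have [_ hu] := fP u uB; have [[p [hp lp sp]] _] := fP v vB.
  apply: hu; exists (rcons p u); rewrite rcons_path last_rcons size_rcons sp; split=> //.
  by rewrite hp lp /restrict uB vB adj_sym.
- move=> v vB f0; have [[p [hp lp sp]] hv] := fP v vB.
  case: (lastP p) hp lp sp => [|q w]; first by move=> _ _ e; move: f0; rewrite -e.
  rewrite rcons_path last_rcons size_rcons => /andP[hq qw] ew sq; rewrite {w}ew in qw.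
  have /and3P[uB _ uv] := qw; exists (last r q); rewrite adj_sym uv uB; split=> //.
  have [[q' [hq' lq' sq']] hu] := fP _ uB.
  apply/eqP; rewrite eqn_leq -{2}sq ltnS; apply/andP; split.
    apply: hv; exists (rcons q' v); rewrite rcons_path last_rcons size_rcons sq'; split=> //.
    by rewrite hq' lq'.
  by apply: hu; exists q.
- by move=> v vB f0; have [[[|w p] [hp lp sp]] _] := fP v vB => //; move: sp; rewrite f0.
Qed.

(** * Levellings and hubs *)

Section Levels.
Variables (G : sgraph) (x0 : G) (A : {set G}).
Implicit Types (C D E H K S T W X Y : {set G}) (u v w x y z : G) (c q l : seq G).

Hypothesis og : forall c, odd_cycle c -> {subset c <= A} -> 7 < size c.

Variables (B : {set G}) (f : G -> nat) (r : G).
Hypothesis BA : B \subset A.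
Hypothesis lv : levelling B f r.

Definition level i : {set G} := [set v in B | f v == i].

Definition low i : {set G} := [set v in B | f v <= i].

Lemma levelP i v : reflect (v \in B /\ f v = i) (v \in level i).
Proof. by rewrite inE; apply: (iffP andP) => -[? /eqP ?]; split=> //; apply/eqP. Qed.

Lemma level_adj u v : u \in B -> v \in B -> adj u v -> f u <= (f v).+1 /\ f v <= (f u).+1.
Proof.
by move=> uB vB uv; have [_ _ h _ _] := lv; split; apply: h => //; rewrite adj_sym.
Qed.

Lemma level_parent i v : v \in level i.+1 -> exists2 u, u \in level i & adj v u.
Proof.
move=> /levelP[vB fv]; have [_ _ _ h _] := lv.
have [|u [uB uv fu]] := h v vB; first by rewrite fv.
by exists u => //; apply/levelP; split=> //; move: fu; rewrite fv => -[].
Qed.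

Lemma low_conn i : conn (low i).
Proof.
have [rB fr _ h h0] := lv.
apply: (@conn_root _ r) => v; have [n] := ubnP (f v); elim: n v => // n IH v fvn vl.
have := vl; rewrite inE => /andP[vB fvi].
have [/eqP|f0] := posnP (f v); first by move=> /eqP /(h0 v vB) ->; exact: connect0.
have [u [uB uv fu]] := h v vB f0.
have ul : u \in low i by rewrite inE uB; lia.
apply: connect_trans (IH u _ ul) _; first by lia.
by apply: connect1; rewrite /restrict ul vl adj_sym.
Qed.

Lemma level_short_walk c : cycle (@adj G) c -> odd (size c) -> size c <= 7 -> {subset c <= B} -> False.
Proof. by move=> cc oc c7 cB; apply: (no_short_walk x0 og cc oc c7) => z /cB; apply: (subsetP BA). Qed.

Variable k : nat.
Notation M := (level k.+3).
Notation P := (level k.+2).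
Notation Q := (level k.+1).

(** Connect the vertices [a i] by a bipartite set [T] in the lower levels. In [T] the vertex [p i]
    sees only [a i], so it can join the colour class opposite to that of [a i]. For each [b], the
    vertices [p i] whose [a i] has colour [b] are added and the class they join is called [X]; [Y]
    is then a part of [T] and too low to see level [k.+3]. The colouring [c] does not depend on [b],
    so the pigeonhole principle can be applied before [b] is chosen. *)
Lemma hub m (p a : nat -> G) : m <= 7 ->
    (forall i, i < m -> [/\ p i \in P, a i \in Q & adj (p i) (a i)]) ->
    (forall i j, i < m -> j < m -> i != j -> ~~ adj (p i) (p j) /\ ~~ adj (p i) (a j)) ->
  exists c : nat -> bool, forall b, exists X Y,
    [/\ stable X, stable Y, [disjoint X & Y], conn (X :|: Y) &
    [/\ forall i, i < m -> c i = b -> p i \in X,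
        forall x, x \in X -> [/\ x \in B, f x <= k.+2 & f x = k.+2 -> exists2 i, i < m & x = p i] &
        forall y, y \in Y -> y \in B /\ (f y <= k \/ exists2 i, i < m & y = a i)]].
Proof.
move=> m7 pa na.
pose W := low k :|: [set v in [seq a i | i <- iota 0 m]].
have aW i : i < m -> a i \in W.
  by move=> im; rewrite !inE; apply/orP; right; apply: map_f; rewrite mem_iota.
have WP w : w \in W -> w \in B /\ (f w <= k \/ exists2 i, i < m & w = a i).
  rewrite !inE => /orP[/andP[-> fw]|/mapP[i]]; first by split=> //; left.
  rewrite mem_iota add0n => /= im ->; have [_ /levelP[aB fa] _] := pa i im.
  by split=> //; right; exists i.
have [rB fr _ _ _] := lv.
have rl : r \in low k by rewrite inE rB fr.
have cW : conn W.
  apply: (@conn_root _ r) => w wW; have := wW; rewrite in_setU => /orP[wl|].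
    by apply: connect_restrictS (subsetUl _ _) _; apply: low_conn.
  rewrite inE => /mapP[i]; rewrite mem_iota add0n => /= im ew; rewrite ew in wW *.
  have [_ aQ _] := pa i im; have [u /levelP[uB fu] au] := level_parent aQ.
  have ul : u \in low k by rewrite inE uB fu /=.
  apply: (@connect_trans _ _ u).
    by apply: connect_restrictS (subsetUl _ _) _; apply: low_conn.
  by apply: connect1; rewrite /restrict wW adj_sym au in_setU ul.
have WA : W \subset A.
  by apply: subset_trans BA; apply/subsetP => w /WP[].
have [||T [cT TW tT [g [g2 ga]]]] := small_connector x0 og WA cW (tau := [seq a i | i <- iota 0 m]).
- by move=> w /mapP[i]; rewrite mem_iota => /= im ->; apply: aW.
- by rewrite size_map size_iota.
have aT i : i < m -> a i \in T by move=> im; apply: tT; apply: map_f; rewrite mem_iota.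
have TB w : w \in T -> w \in B /\ (f w <= k \/ exists2 i, i < m & w = a i).
  by move=> /(subsetP TW); apply: WP.
have pT i w : i < m -> w \in T -> adj (p i) w -> w = a i.
  move=> im wT pw; have [/levelP[pB fp] _ _] := pa i im; have [wB [fw|[j jm ew]]] := TB w wT.
    have [h _] := level_adj pB wB pw; clear -h fp fw; lia.
  by have [->//|ij] := eqVneq i j; have [_] := na i j im jm ij; rewrite -ew pw.
have pnT i : i < m -> p i \notin T.
  move=> im; apply/negP => /TB[_]; have [/levelP[pB fp] _ _] := pa i im.
  rewrite fp => -[|[j jm e]]; first by lia.
  by have [_ /levelP[_]] := pa j jm; rewrite -e fp; lia.
exists (fun i => g (a i) == 0) => b.
pose Pb := [set x in [seq p i | i <- iota 0 m & (g (a i) == 0) == b]].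
have PbP x : x \in Pb -> exists i, [/\ i < m, (g (a i) == 0) = b & x = p i].
  rewrite inE => /mapP[i]; rewrite mem_filter mem_iota => /andP[/eqP gi /= im] ->.
  by exists i.
pose X := [set t in T | (g t == 0) != b] :|: Pb.
pose Y := [set t in T | (g t == 0) == b].
have Tst e : stable [set t in T | (g t == 0) == e].
  move=> u v; rewrite !inE => /andP[uT /eqP eu] /andP[vT /eqP ev]; apply/negP => uv.
  have := ga u v uT vT uv; have := g2 u uT; have := g2 v vT; move: eu ev.
  by case: e; case: (g u) => [|[|?]] //; case: (g v) => [|[|?]] //.
have XE : [set t in T | (g t == 0) != b] = [set t in T | (g t == 0) == ~~ b].
  by apply/setP => t; rewrite !inE; case: (_ == 0); case: (b).
exists X, Y; split=> //.
- move=> u v; rewrite !in_setU XE => /orP[uX|/PbP[i [im gi ->]]] /orP[vX|/PbP[j [jm gj ->]]].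
  + exact: (Tst (~~ b)).
  + apply/negP; rewrite adj_sym => pu; move: uX; rewrite inE => /andP[uT].
    by rewrite (pT j u jm uT pu) gj; case: (b).
  + apply/negP => pv; move: vX; rewrite inE => /andP[vT].
    by rewrite (pT i v im vT pv) gi; case: (b).
  + have [->|ij] := eqVneq i j; first by rewrite adj_irrefl.
    by have [] := na i j im jm ij.
- exact: Tst.
- rewrite -setI_eq0; apply/eqP/setP => x; rewrite in_setI in_setU in_set0.
  apply/negP => /andP[/orP[|/PbP[i [im _ ->]]]]; rewrite !inE.
    by move=> /andP[_ /negbTE ->]; rewrite andbF.
  by rewrite (negbTE (pnT i im)).
- have -> : X :|: Y = T :|: Pb.
    by apply/setP => x; rewrite !inE; case: (x \in T); case: (_ == b); rewrite ?orbT ?orbF.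
  apply: contrapT => nc.
  have [E|[t tT1]] := set_0Vmem T.
    apply: nc => u v; rewrite !in_setU E !in_set0 /= => /PbP[i [im _ _]].
    by have := aT i im; rewrite E inE.
  apply: nc; apply: (@conn_root _ t) => v; rewrite in_setU => /orP[vT|vP].
    by apply: connect_restrictS (subsetUl _ _) _; apply: cT.
  have [i [im _ ev]] := PbP v vP; have [_ _ pai] := pa i im.
  apply: (@connect_trans _ _ (a i)).
    by apply: connect_restrictS (subsetUl _ _) _; apply: cT => //; apply: aT.
  by apply: connect1; rewrite /restrict !in_setU aT // vP orbT ev adj_sym.
- split.
  + move=> i im gi; rewrite in_setU; apply/orP; right; rewrite inE; apply: map_f.
    by rewrite mem_filter mem_iota im gi eqxx.
  + move=> x; rewrite in_setU => /orP[|/PbP[i [im _ ->]]].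
      rewrite inE => /andP[/TB[xB fx] _]; split=> //.
        by case: fx => [|[i im ->]]; [lia|have [_ /levelP[_ ->]] := pa i im].
      move=> fk; case: fx => [|[i im ex]]; first by lia.
      by have [_ /levelP[_]] := pa i im; rewrite -ex fk; lia.
    by have [/levelP[pB fp] _ _] := pa i im; split=> //; [rewrite fp|exists i].
  + by move=> y; rewrite inE => /andP[/TB].
Qed.

(** Quantifying over all parents [p'] of [v] and all parents [a'] of [p'] leaves these free to be
    chosen later: any choice for a vertex without conflict meets the nonadjacency conditions of
    [hub]. *)
Definition conflict p a v := adj v p || [exists p' in P, adj v p' &&
  [|| adj p' p, adj p' a | [exists a' in Q, adj p' a' && adj a' p]]].

Lemma two_step_kcol (q : G) : q \in B ->
  kcol [set v in M | [exists p' in P, adj v p' && adj p' q]] 1.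
Proof.
move=> qB; apply: kcol_stable => u v; rewrite !inE.
move=> /andP[/andP[uB _] /existsP[u' /and3P[/levelP[u'B _] uu' u'q]]].
move=> /andP[/andP[vB _] /existsP[v' /and3P[/levelP[v'B _] vv' v'q]]].
apply/negP => uv; apply: (@level_short_walk [:: q; u'; u; v; v']) => //=.
  by rewrite adj_sym u'q adj_sym uu' uv vv' v'q.
by move=> z; rewrite !inE => /or4P[|||/orP[]] /eqP ->.
Qed.

Lemma neighbour_kcol (q : G) : q \in B -> kcol [set v in M | adj v q] 1.
Proof.
move=> qB; apply: kcol_stable => u v; rewrite !inE => /andP[/andP[uB _] uq] /andP[/andP[vB _] vq].
apply/negP => uv; apply: (@level_short_walk [:: q; u; v]) => //=.
  by rewrite adj_sym uq uv vq.
by move=> z; rewrite !inE => /or3P[] /eqP ->.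
Qed.

(** The four kinds of conflict are walks from [v] of length 1, 2 or 3 to [p], or of length 2 to [a].
    Adjacent vertices with walks of the same length d to the same end lie on a closed walk of length
    2d + 1, at most 7, so each kind gives a stable set. *)
Lemma conflict_kcol p a : p \in B -> a \in B -> kcol [set v in M | conflict p a v] 4.
Proof.
move=> pB aB.
have walk3 : kcol [set v in M | [exists p' in P, adj v p' && [exists a' in Q, adj p' a' && adj a' p]]] 1.
  apply: kcol_stable => u v; rewrite !inE.
  move=> /andP[/andP[uB _] /existsP[u' /and3P[/levelP[u'B _] uu' /existsP[u2 /and3P[/levelP[u2B _] uu2 u2p]]]]].
  move=> /andP[/andP[vB _] /existsP[v' /and3P[/levelP[v'B _] vv' /existsP[v2 /and3P[/levelP[v2B _] vv2 v2p]]]]].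
  apply/negP => uv; apply: (@level_short_walk [:: p; u2; u'; u; v; v'; v2]) => //=.
    by rewrite adj_sym u2p adj_sym uu2 adj_sym uu' uv vv' vv2 v2p.
  by move=> z; rewrite !inE => /or4P[|||/or4P[]] /eqP ->.
have := kcolU (kcolU (neighbour_kcol pB) (two_step_kcol pB)) (kcolU (two_step_kcol aB) walk3).
apply: kcolS; apply/subsetP => v; rewrite !inE => /andP[-> /orP[->//|/existsP[p' /and3P[p'P vp']]]] /=.
case/or3P => h; apply/orP.
- by left; apply/orP; right; apply/existsP; exists p'; rewrite p'P vp'.
- by right; apply/orP; left; apply/existsP; exists p'; rewrite p'P vp'.
- by right; apply/orP; right; apply/existsP; exists p'; rewrite p'P vp'.
Qed.

Lemma conflictN p a v p' : ~~ conflict p a v -> p' \in P -> adj v p' ->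
  [/\ ~~ adj p' p, ~~ adj p' a & forall a', a' \in Q -> adj p' a' -> ~~ adj a' p].
Proof.
rewrite negb_or => /andP[_ /existsPn /(_ p')] h p'P vp'.
move: h; rewrite p'P vp' /= !negb_or => /and3P[h1 h2 /existsPn h3]; split=> // a' a'Q p'a'.
by have := h3 a'; rewrite a'Q p'a'.
Qed.

End Levels.

(** * Parents with contacts at odd distance on a path *)

Section Contacts.
Variables (G : sgraph) (x0 : G) (A : {set G}).
Implicit Types (C D E H K S T W X Y : {set G}) (u v w x y z : G) (c q l : seq G).
Notation nth := (nth x0).
Notation induced_path := (induced_path x0).

Hypothesis og : forall c, odd_cycle c -> {subset c <= A} -> 7 < size c.
Hypothesis wf : wheel_free G.

Variables (B : {set G}) (f : G -> nat) (r : G).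
Hypothesis BA : B \subset A.
Hypothesis lv : levelling B f r.
Variable k : nat.
Notation M := (level B f k.+3).
Notation P := (level B f k.+2).
Notation Q := (level B f k.+1).
Notation conflict := (conflict B f k).

Definition touch v l := [exists p in P, adj v p && has (adj p) l].

Lemma touchP v l : reflect (exists2 p, p \in P & adj v p /\ has (adj p) l) (touch v l).
Proof.
apply: (iffP existsP) => [[p /and3P[pP vp pl]]|[p pP [vp pl]]]; first by exists p.
by exists p; rewrite pP vp.
Qed.

Definition odd_contact p l lo hi :=
  [/\ lo < hi < size l, odd (hi - lo), adj p (nth l lo) & adj p (nth l hi)].

(** Take the shortest prefix of [l] whose touching vertices need more than 8 colours; its last
    vertex adds one colour, so 9 suffice. Vertices with a parent seeing the prefix in a single
    parity class take 4 colours for each class, 8 in all. So some touching vertex has no such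
    parent, and its parent seeing the prefix sees both classes. The 13 colours pay for the prefix
    (9) and for conflicts with the new pair (4). *)
Lemma window l K n : induced_path l -> {subset l <= M} -> K \subset M ->
    {in K & l, forall v u, u != v /\ ~~ adj u v} ->
    (forall v, v \in K -> touch v l) -> ~ kcol K (13 + n) ->
  exists s p a v K', [/\ p \in P, a \in Q, adj p a, v \in K /\ adj v p &
    [/\ exists lo hi, odd_contact p (take s l) lo hi, K' \subset K, ~ kcol K' n &
        forall u, u \in K' -> ~~ touch u (take s l) /\ ~~ conflict p a u]].
Proof.
move=> il lM KM Kl tl nK.
pose Ks s := [set v in K | touch v (take s l)].
have exs : exists s, `[< ~ kcol (Ks s) 8 >].
  exists (size l); apply/asboolP => h; apply: nK; apply: (@kcol_le _ _ 8); first by lia.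
  by apply: kcolS h; apply/subsetP => v vK; rewrite inE vK take_size tl.
case: (ex_minnP exs) => s /asboolP ns smin.
have ks9 : kcol (Ks s) 9.
  case: s ns smin => [|s] ns smin.
    by exfalso; apply: ns; exists (fun=> 0); split=> [v|u v];
       rewrite inE take0 => /andP[_ /touchP[p _ []]].
  have k8 : kcol (Ks s) 8.
    by apply: contrapT => h; have := smin s (introT (asboolP _) h); rewrite ltnn.
  have [sl|sl] := ltnP s (size l); last first.
    by apply: kcol_le (_ : 8 <= 9) _ => //; move: k8; rewrite /Ks !take_oversize // ltnW.
  have lB : nth l s \in B by have /levelP[] := lM _ (mem_nth x0 sl).
  have := kcolU k8 (two_step_kcol x0 og f BA k lB).
  apply: kcolS; apply/subsetP => v; rewrite !inE => /andP[vK /touchP[p pP [vp pl]]].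
  move: pl; rewrite (take_nth x0 sl) has_rcons => /orP[ps|pl]; apply/orP; [right|left].
    have /levelP[-> ->] := subsetP KM v vK; rewrite eqxx /=.
    by apply/existsP; exists p; rewrite pP vp.
  by rewrite vK; apply/touchP; exists p.
set L := take s l in ns ks9.
have iL : induced_path L by apply: induced_path_take.
have Ll u : u \in L -> u \in l by apply: mem_take.
have L0 : L != [::].
  apply: contra_notN ns => /eqP L0; exists (fun=> 0); split=> [v|u v];
    by rewrite inE -/L L0 => /andP[_ /touchP[p _ []]].
pose E b := [set e in P | [exists u in parity_class L b, adj u e] &&
                          [forall u in parity_class L (~~ b), ~~ adj u e]].
have KE b : kcol [set v in K | [exists e in E b, adj v e]] 4.
  apply: (exclusive_contacts wf (b := b) iL L0).
    by move=> v u vK /Ll; apply: Kl.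
  move=> e; rewrite inE => /and3P[/levelP[eB fe] /existsP[u /andP[ub ue]] /forallP he]; split.
  - by apply/negP => /Ll/lM/levelP[_]; rewrite fe; lia.
  - by apply/negP => /(subsetP KM)/levelP[_]; rewrite fe; lia.
  - by exists u.
  - by move=> w wb; have := he w; rewrite wb.
have [v vKs vE] : exists2 v, v \in Ks s & forall b e, e \in E b -> ~~ adj v e.
  apply: contrapT => h; apply: ns; have := kcolU (KE true) (KE false); apply: kcolS.
  apply/subsetP => v vKs; have vK : v \in K by move: vKs; rewrite inE => /andP[].
  rewrite inE !(inE, vK) /=; apply: contrapT => /negP; rewrite negb_or => /andP[/existsPn h1 /existsPn h2].
  apply: h; exists v => // -[] e eE; apply/negP => ve; [have := h1 e|have := h2 e];
    by rewrite eE ve.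
have /andP[vK /touchP[p pP [vp pL]]] : (v \in K) && touch v L by move: vKs; rewrite inE.
have [/levelP[pB fp]] := pP.
have [a aQ pa] := level_parent lv pP.
have both b : (exists2 u, u \in parity_class L b & adj p u) -> exists2 u, u \in parity_class L (~~ b) & adj p u.
  move=> [u ub pu]; apply: contrapT => h; have pE : p \notin E b by apply: contraL vp; apply: vE.
  case/negP: pE.
  rewrite inE pP /=; apply/andP; split; first by apply/existsP; exists u; rewrite ub adj_sym.
  apply/forallP => w; apply/implyP => wb; apply/negP => wp; apply: h; exists w => //.
  by rewrite adj_sym.
have [u1 [u2 [u1b u2b pu1 pu2]]] : exists u1 u2, [/\ u1 \in parity_class L true,
    u2 \in parity_class L false, adj p u1 & adj p u2].
  have /hasP[u uL pu] := pL.
  have ub : u \in parity_class L (odd (index u L)) by rewrite inE uL eqxx.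
  have [u' ub' pu'] := both _ (ex_intro2 _ _ u ub pu).
  by move: ub ub'; case: (odd _) => ub ub'; [exists u, u'|exists u', u].
exists s, p, a, v, [set u in K | ~~ touch u L && ~~ conflict p a u]; split=> //.
have [/levelP[aB _]] := aQ.
split.
- move: u1b u2b; rewrite !inE => /andP[u1L /eqP o1] /andP[u2L /eqP o2].
  have i1 : index u1 L < size L by rewrite index_mem.
  have i2 : index u2 L < size L by rewrite index_mem.
  have [lt|gt|e] := ltngtP (index u1 L) (index u2 L).
  + by exists (index u1 L), (index u2 L); split; rewrite ?lt ?nth_index // oddB ?o1 ?o2 // ltnW.
  + by exists (index u2 L), (index u1 L); split; rewrite ?gt ?nth_index // oddB ?o1 ?o2 // ltnW.
  + by move: o1; rewrite e o2.
- by apply/subsetP => u; rewrite inE => /andP[].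
- have k13 : kcol (Ks s :|: [set u in M | conflict p a u]) 13.
    by apply: (@kcolU _ _ _ 9 4) => //; apply: (conflict_kcol x0 og f BA k).
  apply: ncolD k13 nK; apply/subsetP => u uK; rewrite !inE uK.
  have /levelP[-> ->] := subsetP KM u uK; rewrite eqxx /=.
  by case: (touch _ _); case: (conflict _ _ _).
- by move=> u; rewrite inE => /and3P[].
Qed.

(** The vertices kept by one window no longer touch the prefix it used, so they touch the rest of
    the path, where the next window is found. This makes the contact intervals disjoint and
    ordered. *)
Lemma windows m l K n : induced_path l -> {subset l <= M} -> K \subset M ->
    {in K & l, forall v u, u != v /\ ~~ adj u v} ->
    (forall v, v \in K -> touch v l) -> ~ kcol K (13 * m + n) ->
  exists (p a : nat -> G) (lo hi : nat -> nat) s K',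
    [/\ forall i, i < m -> [/\ p i \in P, a i \in Q, adj (p i) (a i), odd_contact (p i) l (lo i) (hi i) & hi i < s],
        forall i, i < m -> exists2 v, v \in K & adj v (p i),
        forall i j, i < j < m -> hi i < lo j,
        forall i j, i < m -> j < m -> i != j -> ~~ adj (p i) (p j) /\ ~~ adj (p i) (a j) &
    [/\ K' \subset K, ~ kcol K' n &
        forall u, u \in K' -> ~~ touch u (take s l) /\ forall i, i < m -> ~~ conflict (p i) (a i) u]].
Proof.
elim: m l K => [|m IH] l K il lM KM Kl tl nK.
  exists (fun=> r), (fun=> r), (fun=> 0), (fun=> 0), 0, K; split=> //.
    by move=> i j; rewrite ltn0 andbF.
  split=> // u uK; split=> //; rewrite take0; by apply/negP => /touchP[p _ []].
have [|s [p0 [a0 [v0 [K1 [p0P a0Q pa0 [v0K vp0] [[lo0 [hi0 oc0]] K1K nK1 K1t]]]]]]] :=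
  @window l K (13 * m + n) il lM KM Kl tl _; first by rewrite addnA -mulnS.
have [||||||p [a [lo [hi [s' [K' [pP pK lohi na [K'K1 nK' K't]]]]]]]] := IH (drop s l) K1 => //.
- exact: induced_path_drop.
- by move=> u /mem_drop; apply: lM.
- exact: subset_trans K1K KM.
- by move=> v u /(subsetP K1K) vK /mem_drop; apply: Kl.
- move=> v vK1; have [ntv _] := K1t v vK1; have /touchP[p pP [vp pl]] := tl v (subsetP K1K v vK1).
  apply/touchP; exists p => //; split=> //; move: pl; rewrite -{1}(cat_take_drop s l) has_cat => /orP[h|//].
  by case/touchP: ntv; exists p.
have [/andP[lh0 hs0] od0 al0 ah0] := oc0.
have hisl : hi0 < s by move: hs0; rewrite size_take_min ltn_min => /andP[].
have hil : hi0 < size l by move: hs0; rewrite size_take_min ltn_min => /andP[].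
exists (fun i => if i is i'.+1 then p i' else p0), (fun i => if i is i'.+1 then a i' else a0),
  (fun i => if i is i'.+1 then s + lo i' else lo0), (fun i => if i is i'.+1 then s + hi i' else hi0),
  (s + s'), K'; split.
- move=> [_|i]; first split=> //.
  + split=> //; first by rewrite lh0 hil.
      by move: al0; rewrite nth_take // (ltn_trans lh0).
    by move: ah0; rewrite nth_take.
  + exact: ltn_addr.
  rewrite ltnS => /pP[h1 h2 h3 [/andP[h4 h5] h6 h7 h8] h9]; split=> //; last by rewrite ltn_add2l.
  move: h5 h7 h8; rewrite size_drop !nth_drop => h5 h7 h8.
  by split=> //; [rewrite ltn_add2l h4 -ltn_subRL|rewrite subnDl].
- move=> [_|i]; first by exists v0.
  by rewrite ltnS => /pK[v /(subsetP K1K) vK vp]; exists v.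
- move=> [|i] [|j] //=; first by move=> _; apply: ltn_addr.
  by rewrite !ltnS ltn_add2l; apply: lohi.
- have key i : i < m -> [/\ ~~ adj (p i) p0, ~~ adj (p i) a0 & ~~ adj p0 (a i)].
    move=> im; have [v vK1 vp] := pK i im; have [_ nc] := K1t v vK1.
    have [h1 h2 h3 _ _] := pP i im; have [h4 h5 h6] := conflictN nc h1 vp.
    by split=> //; rewrite adj_sym h6.
  move=> [|i] [|j] //=; rewrite ?ltnS.
  + by move=> _ /key[h1 _ h2] _; rewrite adj_sym.
  + by move=> /key[h1 h2 _].
  + by move=> im jm ij; apply: na.
- split=> //; first exact: subset_trans K'K1 K1K.
  move=> u uK'; have [h1 h2] := K't u uK'; have [h3 h4] := K1t u (subsetP K'K1 u uK').
  split; last by case=> // i; rewrite ltnS; apply: h2.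
  rewrite takeD; apply/negP => /touchP[q qP [uq]]; rewrite has_cat => /orP[hq|hq].
    by case/touchP: h3; exists q.
  by case/touchP: h1; exists q.
Qed.

End Contacts.

(** * Colouring the vertices whose parents see an odd cycle or a path leaving it *)

Section Cleaning.
Variables (G : sgraph) (x0 : G) (A : {set G}).
Implicit Types (C D E H K S T W X Y : {set G}) (u v w x y z : G) (c q l : seq G).
Notation nth := (nth x0).
Notation induced_path := (induced_path x0).
Notation induced_cycle := (induced_cycle x0).

Hypothesis og : forall c, odd_cycle c -> {subset c <= A} -> 7 < size c.
Hypothesis wf : wheel_free G.

Variables (B : {set G}) (f : G -> nat) (r : G).
Hypothesis BA : B \subset A.
Hypothesis lv : levelling B f r.
Variable k : nat.
Notation M := (level B f k.+3).
Notation P := (level B f k.+2).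
Notation Q := (level B f k.+1).
Notation touch := (touch B f k).

Lemma hub_far X Y (a : nat -> G) m :
    (forall i, i < m -> a i \in Q) ->
    (forall x, x \in X -> f x <= k.+2) ->
    (forall y, y \in Y -> y \in B /\ (f y <= k \/ exists2 i, i < m & y = a i)) ->
  {in M, forall v, v \notin X :|: Y} /\ {in Y & M, forall y v, ~~ adj y v}.
Proof.
move=> aQ Xk Yk.
have Yk1 y : y \in Y -> y \in B /\ f y <= k.+1.
  move=> /Yk[yB [h|[i im ->]]]; first by split=> //; apply: leqW.
  by have /levelP[aB ->] := aQ i im.
split=> [v /levelP[vB fv]|y v /Yk1[yB fy] /levelP[vB fv]].
  by rewrite in_setU; apply/negP => /orP[/Xk|/Yk1[_]]; rewrite fv; lia.
by apply/negP => yv; have [_ h] := level_adj lv yB vB yv; rewrite fv in h; lia.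
Qed.

Lemma hub3 (p a : nat -> G) :
    (forall i, i < 3 -> [/\ p i \in P, a i \in Q & adj (p i) (a i)]) ->
    (forall i j, i < 3 -> j < 3 -> i != j -> ~~ adj (p i) (p j) /\ ~~ adj (p i) (a j)) ->
  exists i j X Y, [/\ i < j < 3, p i \in X, p j \in X,
    [/\ stable X, stable Y, [disjoint X & Y] & conn (X :|: Y)] &
    (forall x, x \in X -> [/\ x \in B, f x <= k.+2 & f x = k.+2 -> exists2 i, i < 3 & x = p i]) /\
    (forall y, y \in Y -> y \in B /\ (f y <= k \/ exists2 i, i < 3 & y = a i))].
Proof.
move=> pa na; have [c cP] := hub x0 og BA lv (isT : 3 <= 7) pa na.
have [i [j [ij eij]]] : exists i j, i < j < 3 /\ c i = c j.
  case e0 : (c 0); case e1 : (c 1); case e2 : (c 2);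
    first [by exists 0, 1; rewrite e0 e1|by exists 0, 2; rewrite e0 e2|by exists 1, 2; rewrite e1 e2].
have [X [Y [Xst Yst dXY cXY [pX hX hY]]]] := cP (c i).
have /andP[ij' j3] := ij.
by exists i, j, X, Y; split=> //; apply: pX; rewrite ?eij // (ltn_trans ij').
Qed.

(** Three windows yield three parents, two of which share a hub class; their two odd contacts form a
    wheel with rim [c]. The 40 colours are 13 for each window and 1 for the last vertex of [c],
    removed to obtain an induced path. *)
Lemma odd_cycle_contacts c K : induced_cycle c -> odd (size c) -> {subset c <= M} -> K \subset M ->
    {in K & c, forall v u, u != v /\ ~~ adj u v} ->
  kcol [set v in K | touch v c] 40.
Proof.
move=> ic oc cM KM Kc; apply: contrapT => nk.
have [s3 _ _] := ic.
pose l := take (size c).-1 c.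
have sc : 0 < size c by apply: leq_trans s3.
have il : induced_path l by apply: (induced_cycle_take (n := (size c).-1)) ic; rewrite prednK.
have lM : {subset l <= M} by move=> u /mem_take; apply: cM.
have wc : (size c).-1 < size c by rewrite prednK.
have wB : nth c (size c).-1 \in B by have /levelP[] := cM _ (mem_nth x0 wc).
pose K1 := [set v in K | touch v l].
have nk1 : ~ kcol K1 (13 * 3 + 0).
  apply: ncolD (two_step_kcol x0 og f BA k wB) nk; apply/subsetP => v.
  rewrite in_set => /andP[vK /touchP[p pP [vp pc]]]; rewrite in_setU.
  have cE : c = rcons l (nth c (size c).-1) by rewrite -take_nth // prednK // take_size.
  move: pc; rewrite {1}cE has_rcons => /orP[pw|pl]; apply/orP; [left|right].
    rewrite in_set (subsetP KM v vK) /=; apply/existsP; exists p; by rewrite pP vp.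
  by rewrite in_set vK; apply/touchP; exists p.
have [|||p [a [lo [hi [s [K' [pP _ lohi na _]]]]]]] := windows og wf BA lv il lM _ _ _ nk1.
- by apply: subset_trans KM; apply/subsetP => v; rewrite inE => /andP[].
- by move=> v u; rewrite inE => /andP[vK _] /mem_take; apply: Kc.
- by move=> v; rewrite inE => /andP[].
have [|i [j [X [Y [/andP[ij j3] piX pjX [Xst Yst dXY cXY] [hX hY]]]]]] := hub3 _ na.
  by move=> i /pP[].
have [far1 far2] : {in M, forall v, v \notin X :|: Y} /\ {in Y & M, forall y v, ~~ adj y v}.
  by apply: (@hub_far X Y a 3) => //; [move=> t /pP[]|move=> x /hX[]].
have i3 : i < 3 by apply: ltn_trans j3.
have [_ _ _ [/andP[li1 li2] li3 li4 li5] _] := pP i i3.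
have [_ _ _ [/andP[lj1 lj2] lj3 lj4 lj5] _] := pP j j3.
have lc t : t < size l -> nth l t = nth c t /\ t < size c.
  rewrite size_takel ?leq_pred // => tl; rewrite nth_take //; split=> //.
  by apply: leq_trans tl _; apply: leq_pred.
have hij := lohi i j; rewrite ij j3 in hij.
apply: (wf Xst Yst dXY cXY oc ic (i := lo i) (j := hi i) (k := lo j) (l := hi j)) => //.
- by move=> v /cM; apply: far1.
- by move=> y v yY /cM; apply: far2.
- by apply: ltnW; apply: hij.
- by have [_] := lc _ lj2.
move=> t; rewrite !inE => /or4P[] /eqP ->.
- by exists (p i) => //; have [<- _] := lc (lo i) (ltn_trans li1 li2).
- by exists (p i) => //; have [<- _] := lc (hi i) li2.
- by exists (p j) => //; have [<- _] := lc (lo j) (ltn_trans lj1 lj2).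
- by exists (p j) => //; have [<- _] := lc (hi j) lj2.
Qed.

Lemma take_arc s o i : 0 < i -> i <= size o ->
  take i.+1 (s :: o) = s :: rcons (take i.-1 o) (nth (s :: o) i).
Proof. by case: i => // i _ io; rewrite /= -take_nth. Qed.

Lemma drop_arc s o i : i <= size o ->
  rev (drop i (s :: o)) = rcons (rev (drop i o)) (nth (s :: o) i).
Proof. by move=> io; rewrite (drop_nth x0) ?rev_cons. Qed.

Lemma induced_edge u v : adj u v -> induced_path [:: u; v].
Proof.
move=> uv; split; first by rewrite /= inE andbT; apply: contraTneq uv => ->; rewrite adj_irrefl.
move=> a b /andP[ab b2]; have [-> ->] : a = 0 /\ b = 1 by move: ab b2; rewrite /=; lia.
by rewrite /= uv.
Qed.

Lemma sub_sub (n a b : nat) : a <= b -> b <= n -> n - a - (n - b) = b - a.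
Proof. lia. Qed.

(** Three windows again, hence 39 colours, but here the path has to be completed to an odd rim. A
    vertex [v] surviving the windows has a parent [p] that sees [l], though only after the windows.
    The rim runs from the first contact of [p] back along [l] to [s], over an arc of the cycle to
    its exit, and through [C] to [p]. As [v] touches no vertex of the cycle, [p] creates no chord
    there. *)
Lemma path_contacts s o i l C K :
    induced_cycle (s :: o) -> odd (size (s :: o)) -> 1 < i -> i < size o ->
    {subset s :: o <= M} -> induced_path (s :: l) -> {subset l <= M} ->
    {in l & o, forall u v, u != v /\ ~~ adj u v} ->
    conn C -> C \subset M ->
    (forall u v, u \in C -> v \in (s :: o) ++ l -> u != v /\ (v != nth (s :: o) i -> ~~ adj u v)) ->
    (exists2 u, u \in C & adj (nth (s :: o) i) u) -> K \subset C ->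
  kcol [set v in K | ~~ touch v (s :: o) && touch v l] 39.
Proof.
move=> ic oc i1 io oM isl lM lo_far cC CM Cfar [u0 u0C xu0] KC; apply: contrapT => nk.
set x := nth (s :: o) i in Cfar xu0.
have il : induced_path l by have := induced_path_drop 1 isl; rewrite /= drop0.
have xo : x \in s :: o by apply: mem_nth; rewrite /= ltnS ltnW.
have [_ uo _] := ic; have [usl _] := isl.
have xNl : x \notin l.
  have : x \in o by rewrite /x; case: (i) i1 io => // i' _ io; rewrite /= mem_nth // ltnW.
  by move=> xo'; apply/negP => xl; have [/eqP] := lo_far x x xl xo'.
pose K1 := [set v in K | ~~ touch v (s :: o) && touch v l].
have K1C v : v \in K1 -> v \in C by rewrite inE => /andP[/(subsetP KC)].
have [|||p' [a [lo [hi [s' [K' [pP pK lohi na [K'K nK' K't]]]]]]]] := windows og wf BA lv (m := 3) (n := 0) (K := K1) il lM _ _ _ nk.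
- by apply: subset_trans CM; apply/subsetP => v /K1C.
- move=> v u /K1C vC ul; have [|h1 h2] := Cfar v u vC; first by rewrite mem_cat ul orbT.
  by rewrite eq_sym h1 adj_sym h2 //; apply: contraNneq xNl => <-.
- by move=> v; rewrite inE => /and3P[].
have [v vK'] := ncol_exists nK'.
have vK1 := subsetP K'K v vK'; have vC := K1C v vK1.
have [ntv ncv] := K't v vK'.
have /andP[_ /andP[nto /touchP[p pPl [vp pl]]]] : (v \in K) && (~~ touch v (s :: o) && touch v l) by move: vK1; rewrite inE.
have /levelP[pB fp] := pPl.
pose e := find (adj p) l.
have el : e < size l by rewrite -has_find.
have pe : adj p (nth l e) by apply: nth_find.
have s'e : s' <= e.
  rewrite leqNgt; apply: contra ntv => es; apply/touchP; exists p => //; split=> //.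
  by apply/hasP; exists (nth l e) => //; rewrite -(nth_take x0 es) mem_nth // size_take_min ltn_min es.
have pNl t : t < e -> ~~ adj p (nth l t) by move=> te; apply/negbT; apply: before_find.
have pNo z : z \in s :: o -> ~~ adj p z.
  by move=> zo; apply: contra nto => pz; apply/touchP; exists p => //; split=> //; apply/hasP; exists z.
have pNM z : z \in M -> p != z.
  by move=> /levelP[_ fz]; apply/eqP => ez; move: fz; rewrite -ez fp => /eqP; rewrite ltn_eqF.
pose a' := nth l e.
have a'l : a' \in l by apply: mem_nth.
have xM : x \in M := oM x xo.
pose W := x |: (p |: C).
have [J [iJ JW lJ]] : exists J, [/\ induced_path (x :: J), {subset x :: J <= W} & last x J = p].
  apply: shortest_path; first by rewrite !inE eqxx.
  have cW : conn W.
    rewrite /W; apply: (@conn_add _ (p |: C) u0).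
    - by apply: (conn_add cC vC vp).
    - by rewrite !inE u0C orbT.
    - by rewrite adj_sym.
  by apply: cW; rewrite !inE eqxx ?orbT.
have [q' eJ] : exists q', J = rcons q' p.
  case: (lastP J) lJ => [/= xp|q' w]; last by rewrite last_rcons => ->; exists q'.
  by have := pNM x xM; rewrite -xp eqxx.
rewrite {}eJ in iJ JW lJ => {lJ}.
have q'C z : z \in q' -> z \in C.
  move=> zq; have := JW z; rewrite !inE mem_rcons inE zq !orbT => /(_ isT).
  have [uJ _] := iJ; case/or3P=> [/eqP zx|/eqP zp|//].
    by move: uJ; rewrite /= mem_rcons inE -zx zq orbT.
  by move: uJ; rewrite /= rcons_uniq -zp zq andbF.
have iJa : induced_path (x :: rcons (rcons q' p) a').
  rewrite -rcons_cons -cats1 -rcons_cons; apply: induced_path_cat => //.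
    exact: induced_edge.
  move=> z w; rewrite !inE => zz /eqP ->.
  case/orP: zz => [/eqP ->|/q'C zC]; last first.
    have [|h1 h2] := Cfar z a' zC; first by rewrite mem_cat a'l orbT.
    by split=> //; apply: h2; apply: contraNneq xNl => <-.
  have xo' : x \in o by rewrite /x; case: (i) i1 io => // i' _ io; rewrite /= mem_nth // ltnW.
  have [h1 h2] := lo_far a' x a'l xo'; by rewrite eq_sym h1 adj_sym h2.
(* Both arcs of [s :: o] from [s] to [x] prolong the initial part of [l]. *)
have build R : induced_path (s :: rcons R x) -> {subset rcons R x <= o} ->
    induced_cycle (rev (take e.+1 l) ++ s :: rcons R x ++ rcons q' p).
  move=> iR Ro.
  have takeE : rev (take e.+1 l) = a' :: rev (take e l) by rewrite (take_nth x0) // rev_rcons.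
  have iQ : induced_path (a' :: rcons (rev (take e l) ++ s :: R) x).
    have -> : a' :: rcons (rev (take e l) ++ s :: R) x = rcons (rev (take e.+1 l)) s ++ rcons R x.
      by rewrite takeE cat_rcons rcons_cat rcons_cons.
    apply: induced_path_cat => //.
      rewrite -rev_cons; apply: induced_path_rev.
      by rewrite -[s :: take e.+1 l]/(take e.+2 (s :: l)); apply: induced_path_take.
    by move=> u w; rewrite mem_rev => /mem_take ul /Ro wo; apply: lo_far.
  have -> : rev (take e.+1 l) ++ s :: rcons R x ++ rcons q' p =
            a' :: rcons (rev (take e l) ++ s :: R) x ++ rcons q' p.
    by rewrite takeE /= rcons_cat /= -catA.
  apply: (induced_close iQ iJa); first by case: (q').
  have [uQ _] := iQ.
  have xN : x \notin rev (take e l) ++ s :: R.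
    by move: uQ => /= /andP[_]; rewrite rcons_uniq => /andP[].
  move=> u w uP; have ux : u != x by apply: contraNneq xN => <-.
  have uol : u \in (s :: o) ++ l.
    move: uP; rewrite !mem_cat mem_rev !inE => /or3P[/mem_take ->|->|uR]; rewrite ?orbT //.
    by rewrite (Ro u) ?orbT // mem_rcons inE uR orbT.
  rewrite mem_rcons inE => /orP[/eqP ->|/q'C wC]; last first.
    by have [h1 h2] := Cfar w u wC uol; rewrite eq_sym h1 adj_sym h2.
  have uM : u \in M by move: uol; rewrite mem_cat => /orP[/oM|/lM].
  rewrite eq_sym pNM // adj_sym; split=> //.
  move: uP; rewrite !mem_cat mem_rev => /orP[ut|uR].
    have := ut => /(nthP x0)[t]; rewrite size_takel ?(ltnW el) // => te <-.
    by rewrite nth_take // pNl.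
  apply: pNo; move: uR; rewrite !inE => /orP[->//|uR].
  by rewrite (Ro u) ?orbT // mem_rcons inE uR orbT.
have [R [iR Ro oR]] : exists R, [/\ induced_path (s :: rcons R x), {subset rcons R x <= o} &
    odd (size (rev (take e.+1 l) ++ s :: rcons R x ++ rcons q' p))].
  have [arc1 arc2] := induced_cycle_arcs i1 io ic.
  have i0 : 0 < i by apply: ltn_trans i1.
  have e1 := take_arc s i0 (ltnW io); have e2 := drop_arc s (ltnW io).
  rewrite e1 in arc1; rewrite e2 in arc2.
  set N := size (rev (take e.+1 l)) + size (rcons q' p).
  have s1 : size (rev (take e.+1 l) ++ s :: rcons (take i.-1 o) x ++ rcons q' p) = N + i.+1.
    rewrite size_cat /= size_cat [size (rcons (take _ _) _)]size_rcons size_takel; last by rewrite ltnW // prednK // ltnW.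
    rewrite /N; clear -i0; lia.
  have s2 : size (rev (take e.+1 l) ++ s :: rcons (rev (drop i o)) x ++ rcons q' p) = N + (size o - i).+2.
    by rewrite /N size_cat /= size_cat !size_rcons !size_rev size_drop; clear; lia.
  have [oN|oN] := boolP (odd (N + i.+1)).
    exists (take i.-1 o); split=> //; last by rewrite s1.
    move=> z; rewrite mem_rcons inE => /orP[/eqP ->|/mem_take//].
    by rewrite /x -(prednK i0) /= mem_nth // prednK // ltnW.
  exists (rev (drop i o)); split=> //.
    move=> z; rewrite mem_rcons inE => /orP[/eqP ->|]; last by rewrite mem_rev => /mem_drop.
    by rewrite /x -(prednK i0) /= mem_nth // prednK // ltnW.
  rewrite s2; move: oc oN; rewrite /= !addnS /= !oddD oddB ?(ltnW io) //.
  by case: (odd N); case: (odd (size o)); case: (odd i).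
have icR := build R iR Ro.
set rim := _ ++ _ in oR icR.
have rimM z : z \in rim -> z \in M \/ z = p.
  rewrite /rim mem_cat inE mem_cat mem_rev => /or4P[/mem_take/lM|/eqP ->|/Ro zo|]; try by left.
  - by left; apply: oM; rewrite inE eqxx.
  - by left; apply: oM; rewrite inE zo orbT.
  by rewrite mem_rcons inE => /orP[/eqP ->|/q'C /(subsetP CM)]; [right|left].
have [|i' [j' [X [Y [/andP[ij j3] piX pjX [Xst Yst dXY cXY] [hX hY]]]]]] := hub3 _ na.
  by move=> t /pP[].
have [far1 far2] : {in M, forall v, v \notin X :|: Y} /\ {in Y & M, forall y v, ~~ adj y v}.
  by apply: (@hub_far X Y a 3) => //; [move=> t /pP[]|move=> y /hX[]].
(* The rim now has a vertex [p] in level [k.+2], not covered by [hub_far]. It is outside [X] because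
   the vertices [p' t] have contacts before position [e], and [Y] does not see it because [v] has no
   conflict with the pairs. *)
have pNi t : t < 3 -> p <> p' t.
  move=> t3 ep; have [_ _ _ [/andP[h1 h2] _ h3 _] h4] := pP t t3.
  by have := pNl (lo t); rewrite ep h3 => /(_ (leq_trans (ltn_trans h1 h4) s'e)).
have i3 : i' < 3 by apply: ltn_trans j3.
have [_ _ _ [/andP[li1 li2] li3 li4 li5] li6] := pP i' i3.
have [_ _ _ [/andP[lj1 lj2] lj3 lj4 lj5] lj6] := pP j' j3.
have hij := lohi i' j'; rewrite ij j3 in hij; have {}hij := hij isT.
have rimE t : t <= e -> nth rim (e - t) = nth l t.
  move=> te; rewrite /rim nth_cat size_rev size_takel // ltnS leq_subr nth_rev size_takel //.
    by rewrite nth_take subSS ?subKn // ltnS.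
  by rewrite ltnS leq_subr.
have he : hi j' <= e by apply: ltnW; apply: leq_trans lj6 s'e.
have le : lo j' <= e by apply: leq_trans (ltnW lj1) he.
have hie : hi i' <= e by apply: leq_trans (ltnW hij) le.
have lie : lo i' <= e by apply: leq_trans (ltnW li1) hie.
apply: (wf Xst Yst dXY cXY oR icR (i := e - hi j') (j := e - lo j') (k := e - hi i') (l := e - lo i')).
- move=> z /rimM[/far1//|->]; rewrite in_setU; apply/negP => /orP[/hX[_ _ /(_ fp)[t /pNi]]//|/hY[_]].
  rewrite fp => -[|[t t3 ep]]; first by rewrite ltnNge leqnSn.
  by have [_ /levelP[_]] := pP t t3; rewrite -ep fp => /eqP; rewrite gtn_eqF.
- move=> y z yY /rimM[/(far2 _ _ yY)//|->].
  have [yB [fy|[t t3 ey]]] := hY y yY.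
    by apply/negP => yp; have [_] := level_adj lv yB pB yp; rewrite fp ltnS ltnNge fy.
  by have [_ h _] := conflictN (ncv t t3) pPl vp; rewrite ey adj_sym.
- by apply: ltn_sub2l => //; apply: leq_trans he.
- by apply: leq_sub2l; apply: ltnW.
- by apply: ltn_sub2l => //; apply: leq_trans hie.
- rewrite /rim size_cat size_rev size_takel // ltn_addr //.
  by rewrite ltnS leq_subr.
- by rewrite sub_sub // ltnW.
- by rewrite sub_sub // ltnW.
- move=> t; rewrite !inE => /or4P[] /eqP ->; rewrite rimE //; by [exists (p' j')|exists (p' i')].
Qed.

End Cleaning.

(** * Toggles *)

Section RelWalks.
Variables (T : eqType) (x0 : T) (e : rel T).
Notation nth := (nth x0).
Implicit Types (x v : T) (p : seq T).

Lemma walk_take x p i : path e x p -> i <= size p ->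
  path e x (take i p) /\ last x (take i p) = nth (x :: p) i.
Proof.
move=> hp ip; split.
  by move: hp; rewrite -{1}(cat_take_drop i p) cat_path => /andP[].
have := nth_last x0 (x :: take i p); rewrite [size _]/= size_takel //= => <-.
by rewrite -[x :: take i p]/(take i.+1 (x :: p)) nth_take.
Qed.

Lemma walk_drop x p j : path e x p -> j < size p ->
  [/\ drop j p = nth p j :: drop j.+1 p, path e (nth p j) (drop j.+1 p) &
      last (nth p j) (drop j.+1 p) = last x p].
Proof.
move=> hp jp; have dE := drop_nth x0 jp; split=> //.
  by move: hp; rewrite -{1}(cat_take_drop j p) cat_path dE => /and3P[].
by rewrite -[in RHS](cat_take_drop j p) last_cat dE.
Qed.

Lemma walk_chord x p i j : path e x p -> i <= j -> j < size p -> e (nth (x :: p) i) (nth p j) ->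
  path e x (take i p ++ drop j p) /\ last x (take i p ++ drop j p) = last x p.
Proof.
move=> hp ij jp eij; have ip : i <= size p by apply: leq_trans ij (ltnW jp).
have [h1 h2] := walk_take hp ip; have [h3 h4 h5] := walk_drop hp jp.
by rewrite cat_path h1 last_cat h2 h3 /= eij h4 h5.
Qed.

Lemma walk_detour x p i j v : path e x p -> i <= j -> j < size p ->
    e (nth (x :: p) i) v -> e v (nth p j) ->
  path e x (take i p ++ v :: drop j p) /\ last x (take i p ++ v :: drop j p) = last x p.
Proof.
move=> hp ij jp ei ej; have ip : i <= size p by apply: leq_trans ij (ltnW jp).
have [h1 h2] := walk_take hp ip; have [h3 h4 h5] := walk_drop hp jp.
by rewrite cat_path h1 last_cat h2 h3 /= ei ej h4 h5.
Qed.

Lemma minimal_walk x p : path e x p ->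
    (forall q, path e x q -> last x q = last x p -> size p <= size q) ->
  uniq (x :: p) /\ forall i j, i < j < size (x :: p) -> e (nth (x :: p) i) (nth (x :: p) j) -> j = i.+1.
Proof.
move=> hp pm; split.
  have [q [hq uq sq lq]] : exists q, [/\ path e x q, uniq (x :: q), {subset q <= p} & last x q = last x p].
    by case: (shortenP hp) => q hq uq sq; exists q.
  have pq : size p <= size q by apply: pm.
  apply: (leq_size_uniq uq) => //= z; rewrite !inE => /orP[->//|/sq ->]; exact: orbT.
move=> i [|j] //= /andP[ij jp] eij.
have [h1 h2] := walk_chord hp (ij : i <= j) (jp : j < size p) eij.
have := pm _ h1 h2; rewrite size_cat size_takel ?size_drop; last by apply: leq_trans ij (ltnW jp).
by clear -ij jp => h; move: jp; rewrite ltnS => jp; lia.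
Qed.

Lemma walk_exit x p (S : pred T) : path e x p -> x \in S -> last x p \notin S ->
  exists u v, [/\ u \in x :: p, v \in p, u \in S, v \notin S & e u v].
Proof.
elim: p x => [|v p IH] x /=; first by move=> _ ->.
move=> /andP[xv vp] xS lS; have [vS|vS] := boolP (v \in S); last first.
  by exists x, v; rewrite !inE !eqxx.
have [u [w [h1 h2 h3 h4 h5]]] := IH v vp vS lS.
by exists u, w; split=> //; rewrite inE ?h1 ?h2 orbT.
Qed.

End RelWalks.

(** * An odd cycle through the only bad edge, with an induced path leading to it *)

Section Theta.
Variables (G : sgraph) (x0 : G).
Implicit Types (S : {set G}) (u v y z a : G) (p q b o : seq G).
Notation nth := (nth x0).
Notation induced_path := (induced_path x0).
Notation induced_cycle := (induced_cycle x0).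

Variables (S : {set G}) (g : G -> bool) (a z y : G).
Hypotheses (yS : y \in S) (az : adj a z) (gaz : g a = g z).
Hypothesis gS : {in S &, forall u v, adj u v -> g u = g v ->
  (u == a) && (v == z) || (u == z) && (v == a)}.

Definition cross : rel G := fun u v => restrict S u v && (g u != g v).

Hypothesis caz : connect cross a z.
Hypothesis cya : connect (restrict S) y a.

(* [p] is a shortest path of the bipartite graph [cross] from [a] to [z],
   chosen as near to [y] as possible; [a :: p] closed by the edge [az] is the
   odd cycle. *)
Lemma theta : exists s o b p,
  [/\ [/\ induced_cycle (s :: o), odd (size (s :: o)) & {subset s :: o <= S}],
      [/\ induced_path (y :: b), last y b = s & {subset y :: b <= S}],
      forall u v, u \in y :: b -> u != s -> v \in s :: o -> u != v /\ (v != s -> ~~ adj u v) &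
      [/\ path cross a p, last a p = z & a :: p =i s :: o]].
Proof.
pose W n := `[< exists p, [/\ path cross a p, last a p = z & size p = n] >].
have exW : exists n, W n.
  by have /connectP[p hp e] := caz; exists (size p); apply/asboolP; exists p.
case: (ex_minnP exW) => n /asboolP[p1 [hp1 lp1 sp1]] nmin.
have {}nmin p : path cross a p -> last a p = z -> n <= size p.
  by move=> hp lp; apply: nmin; apply/asboolP; exists p.
pose D d := `[< exists p b, [/\ path cross a p, last a p = z, size p = n &
  [/\ path (restrict S) y b, last y b \in a :: p & size b = d]] >].
have exD : exists d, D d.
  have /connectP[b hb e] := cya; exists (size b); apply/asboolP; exists p1, b.
  by split=> //; split=> //; rewrite -e inE eqxx.
case: (ex_minnP exD) => d /asboolP[p [b [hp lp sp [hb lb sb]]]] dmin.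
have {}dmin p' b' : path cross a p' -> last a p' = z -> size p' = n ->
    path (restrict S) y b' -> last y b' \in a :: p' -> d <= size b'.
  by move=> *; apply: dmin; apply/asboolP; exists p', b'.
clear p1 hp1 lp1 sp1 exW exD W D.
have [up cp] := @minimal_walk _ x0 cross a p hp (fun q hq lq => leq_trans (eq_leq sp) (nmin q hq (etrans lq lp))).
have crossS u v : cross u v -> [/\ u \in S, v \in S, adj u v & g u != g v].
  by move=> /andP[/and3P[]].
have crossC u v : cross u v -> cross v u.
  by move=> /andP[h1 h2]; rewrite /cross restrict_sym h1 eq_sym.
have n0 : 0 < n.
  rewrite -sp; case: (p) lp => //= e; by move: az; rewrite e adj_irrefl.
have step i : i < n -> cross (nth (a :: p) i) (nth p i).
  by move=> ip; move/(pathP x0): hp; apply; rewrite sp.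
have pS v : v \in a :: p -> v \in S.
  move=> /(nthP x0)[i]; rewrite /= sp ltnS leq_eqVlt => /orP[/eqP ->|ip] <-.
    by rewrite -(prednK n0) /=; have [] := crossS _ _ (step n.-1 _); rewrite ?prednK.
  by have [] := crossS _ _ (step i ip).
have gp i : i <= n -> g (nth (a :: p) i) = g a (+) odd i.
  elim: i => [|i IH] ip; first by rewrite addbF.
  have [_ _ _] := crossS _ _ (step i ip); rewrite (IH (ltnW ip)) /=.
  by case: (g (nth p i)); case: (g a); case: (odd i).
have zE : nth (a :: p) n = z by rewrite -sp (nth_last x0 (a :: p)).
have on : ~~ odd n by have := gp n (leqnn _); rewrite zE -gaz; case: (g a); case: (odd n).
have n2 : 1 < n by case: (n) n0 on => [|[|]].
have ic : induced_cycle (a :: p).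
  split=> [||i j /andP[ij jp]]; [by rewrite /= sp|by []|].
  have jn : j <= n by move: jp; rewrite /= sp ltnS.
  have iS : nth (a :: p) i \in S by apply: pS; apply: mem_nth; apply: ltn_trans jp.
  have jS : nth (a :: p) j \in S by apply: pS; apply: mem_nth.
  rewrite /= sp eqSS; apply/idP/idP.
    move=> aij; have [eg|ng] := eqVneq (g (nth (a :: p) i)) (g (nth (a :: p) j)); last first.
      by rewrite (cp i j) ?eqxx // ?ij // /cross /restrict iS jS aij.
    have in0 : 0 < size (a :: p) by [].
    have ip : i < size (a :: p) by apply: ltn_trans jp.
    have np : n < size (a :: p) by rewrite /= sp.
    have := gS iS jS aij eg; rewrite -{1 2}zE.
    have aE (v : G) : (v == a) = (v == nth (a :: p) 0) by [].
    rewrite !aE !(nth_uniq x0) // => /orP[/andP[-> ->]|/andP[/eqP ei /eqP ej]]; first by rewrite orbT.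
    by move: ij; rewrite ej.
  case/orP=> [/eqP ej|/andP[/eqP -> /eqP ->]]; last by rewrite zE.
  by rewrite ej; have [] := crossS _ _ (step i _); rewrite // -ej.
have oc : odd (size (a :: p)) by rewrite /= sp.
have [ub cb] := @minimal_walk _ x0 (restrict S) y b hb (fun q hq lq =>
  leq_trans (eq_leq sb) (@dmin p q hp lp sp hq (eq_ind_r (fun w => w \in a :: p) lb lq))).
have bS v : v \in y :: b -> v \in S.
  by have [_ h] := path_restrict hb; rewrite inE => /orP[/eqP ->|/h].
have ib : induced_path (y :: b).
  split=> // i j /andP[ij jb]; apply/idP/eqP => [aij|ej].
    apply: cb; rewrite ?ij //; rewrite /restrict aij !bS //; apply: mem_nth => //.
    exact: ltn_trans jb.
  rewrite ej; have /pathP h := hb; rewrite ej /= ltnS in jb.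
  by have /and3P[] := h x0 i jb.
have far t v : t < d -> v \in a :: p -> nth (y :: b) t != v /\ (v != last y b -> ~~ adj (nth (y :: b) t) v).
  move=> td vp; have tb : t <= size b by rewrite sb ltnW.
  have [hbt lbt] := walk_take x0 hb tb.
  split.
    apply/eqP => e; have := dmin p (take t b) hp lp sp hbt.
    by rewrite lbt e size_takel // => /(_ vp); rewrite leqNgt td.
  move=> vs; apply/negP => atv.
  have tS : nth (y :: b) t \in S by apply: bS; apply: mem_nth; rewrite /= ltnS.
  have ed : t.+1 = d.
    apply/eqP; rewrite eqn_leq td /=.
    have := dmin p (rcons (take t b) v) hp lp sp.
    rewrite rcons_path last_rcons size_rcons size_takel // hbt lbt; apply=> //.
    by rewrite /= /restrict tS atv pS.
  set u := nth (y :: b) t in atv tS.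
  have us : adj u (last y b).
    have lE : nth (y :: b) d = last y b by rewrite -sb; apply: (nth_last x0 (y :: b)).
    by have [_ h] := ib; rewrite /u -lE h /= ?sb -ed ?eqxx // !ltnSn.
  have uNp : u \notin a :: p.
    apply/negP => uap; have := dmin p (take t b) hp lp sp hbt.
    by rewrite lbt size_takel // => /(_ uap); rewrite leqNgt td.
  have ucross w : w \in a :: p -> adj u w -> cross u w.
    move=> wp uw; rewrite /cross /restrict tS pS // uw /=; apply/eqP => eg.
    have := gS tS (pS w wp) uw eg => /orP[/andP[/eqP ua _]|/andP[/eqP uz _]].
      by move: uNp; rewrite ua inE eqxx.
    by move: uNp; rewrite uz -zE mem_nth //= sp.
  (* If [u] saw two vertices of the path, the detour through [u] would, by parity and by minimality
     of [n], again have length [n]. It contains [u], which is closer to [y] than [d] allows. *)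
  have key i j : i < j <= n -> adj u (nth (a :: p) i) -> adj u (nth (a :: p) j) -> False.
    move=> /andP[ij jn] ui uj.
    have jp : j < size (a :: p) by rewrite /= sp ltnS.
    have ip : i < size (a :: p) by apply: ltn_trans jp.
    have ci := ucross _ (mem_nth x0 ip) ui; have cj := ucross _ (mem_nth x0 jp) uj.
    case: j ij jn uj jp cj => // j ij jn uj jp cj.
    have [h1 h2] := walk_detour hp (ij : i <= j) (jp : j < size p) (crossC _ _ ci) cj.
    set p' := _ ++ _ in h1 h2.
    have sp' : size p' = i + (n - j).+1.
      by rewrite /p' size_cat /= size_takel ?size_drop ?sp //; exact: leq_trans (ij : i <= j) (ltnW jn).
    have [_ _ _ gi] := crossS _ _ ci; have [_ _ _ gj] := crossS _ _ cj.
    have oij : odd i = odd j.+1.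
      move: gi gj; rewrite gp; last exact: leq_trans (ltnW ij) jn.
      by rewrite gp //; case: (g u); case: (g a); case: (odd i); case: (odd j.+1).
    have spn : size p' = n.
      have := nmin p' h1; rewrite h2 lp => /(_ erefl); rewrite sp'.
      move: oij ij jn; clear => /= oij ij jn h.
      have [e|e] : j = i \/ j = i.+1 by lia.
        by move: oij; rewrite e; case: (odd i).
      by rewrite e; lia.
    have := dmin p' (take t b) h1 _ spn hbt; rewrite h2 lp lbt size_takel // => /(_ erefl).
    rewrite -/u /p' inE mem_cat inE eqxx !orbT => /(_ isT).
    by rewrite leqNgt td.
  have /(nthP x0)[i ip ei] := vp; have /(nthP x0)[j jp ej] := lb.
  rewrite /= sp ltnS in ip jp.
  have [ij|ji|eij] := ltngtP i j.
  - by apply: (key i j); rewrite ?ij // ?ei // ej.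
  - by apply: (key j i); rewrite ?ji // ?ei // ej.
  - by move: vs; rewrite -ei -ej eij eqxx.
have eo := rot_index lb; set o := drop _ _ ++ _ in eo.
have mo : a :: p =i last y b :: o by move=> v; rewrite -eo mem_rot.
exists (last y b), o, b, p; split=> //; [split=> //|].
- by rewrite -eo; apply: induced_cycle_rot; rewrite ?index_mem.
- by rewrite -eo size_rot.
- by move=> v; rewrite -mo; apply: pS.
- move=> u v /(nthP x0)[t tb <-] us; rewrite -mo => vp.
  have td : t < d.
    move: tb; rewrite /= sb ltnS leq_eqVlt => /orP[/eqP et|//].
    by move: us; rewrite et -sb; have -> : nth (y :: b) (size b) = last y b := nth_last x0 (y :: b); rewrite eqxx.
  exact: far.
Qed.
End Theta.

(** * Closed walks formed by two chains and two rungs *)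

Section Ladder.
Variables (G : sgraph) (x0 : G).
Implicit Types (u w : nat -> G).

Lemma mkseq_path u a : (forall i, i < a -> adj (u i) (u i.+1)) ->
  exists2 s, mkseq u a.+1 = u 0 :: s & path (@adj G) (u 0) s /\ last (u 0) s = u a.
Proof.
move=> ua; have eq : mkseq u a.+1 = u 0 :: [seq u i | i <- iota 1 a] by [].
exists [seq u i | i <- iota 1 a] => //; split.
  apply/(pathP x0) => i; rewrite size_map size_iota => ia.
  have e : forall t, t < a -> nth x0 [seq u i | i <- iota 1 a] t = u t.+1.
    by move=> t ta; rewrite (nth_map 0) ?size_iota // nth_iota.
  by case: i ia => [|i] ia; rewrite e //= ?e ?ua // ltnW.
by rewrite -[last _ _]/(last x0 (mkseq u a.+1)) -nth_last size_mkseq nth_mkseq.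
Qed.

Lemma ladder_walk u w a b :
    (forall i, i < a -> adj (u i) (u i.+1)) -> (forall i, i < b -> adj (w i) (w i.+1)) ->
    adj (u 0) (w 0) -> adj (u a) (w b) ->
  cycle (@adj G) (mkseq u a.+1 ++ rev (mkseq w b.+1)).
Proof.
move=> ua wb h0 hab.
have [s -> [ps ls]] := mkseq_path ua; have [t -> [pt lt]] := mkseq_path wb.
rewrite /= rcons_cat cat_path ps ls rcons_path {2}rev_cons last_rcons adj_sym h0 andbT.
rewrite lastI rev_rcons /= lt hab -lt rev_path.
by under eq_path => x y do rewrite adj_sym.
Qed.

End Ladder.

Lemma connect_chain (T : finType) (e : rel T) (h : nat -> T) l :
  (forall i, i < l -> e (h i) (h i.+1)) -> connect e (h 0) (h l).
Proof.
elim: l => [|l IH] hl; first exact: connect0.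
apply: connect_trans (connect1 (hl l (ltnSn l))).
by apply: IH => i il; apply: hl; apply: ltnW.
Qed.

(** * A toggle from two chains of a levelling *)

Section Toggle.
Variables (G : sgraph) (x0 : G) (A : {set G}).
Implicit Types (C D E H K S T W X Y : {set G}) (u v w x y z : G) (c q b o l : seq G) (h : nat -> G).
Notation nth := (nth x0).
Notation induced_path := (induced_path x0).
Notation induced_cycle := (induced_cycle x0).

Hypothesis og : forall c, odd_cycle c -> {subset c <= A} -> 7 < size c.

Definition attached C x (U : {set G}) := forall u v, u \in C -> v \in U -> u != v /\ (v != x -> ~~ adj u v).

(* An induced path from [y] to an odd cycle [s :: o]; the two arcs of the cycle
   from [s] to the exit give paths of both parities from [y] to the exit, from
   which [C] is reached. *)
Definition toggle y b s o i C : Prop :=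
  [/\ [/\ induced_cycle (s :: o), odd (size (s :: o)) & 1 < i < size o],
      induced_path (y :: b) /\ last y b = s,
      forall u v, u \in y :: b -> u != s -> v \in s :: o -> u != v /\ (v != s -> ~~ adj u v),
      conn C /\ exists2 u, u \in C & adj (nth (s :: o) i) u
    & attached C (nth (s :: o) i) [set v in (y :: b) ++ (s :: o)]].

Section Core.
Variables (B : {set G}) (f : G -> nat) (y : G).
Hypothesis BA : B \subset A.
Hypothesis lv : levelling B f y.
Notation level := (level B f).

Definition chain h j := (forall i, i <= j -> h i \in level i) /\ (forall i, i < j -> adj (h i) (h i.+1)).

Lemma chain_exists j v : v \in level j -> exists2 h, chain h j & h j = v.
Proof.
elim: j v => [|j IH] v vj.
  by exists (fun=> v) => //; split=> // i; rewrite leqn0 => /eqP ->.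
have [u uj vu] := level_parent lv vj; have [h [h1 h2] hj] := IH u uj.
exists (fun i => if i == j.+1 then v else h i); rewrite ?eqxx //; split=> i.
  by rewrite leq_eqVlt ltnS; case: eqP => [->//|_ /=]; apply: h1.
rewrite ltnS eqSS => ij; rewrite ltn_eqF //; case: eqP => [->|/eqP ne]; first by rewrite hj adj_sym.
by apply: h2; rewrite ltn_neqAle ne.
Qed.

Lemma chain_extend j u v : u \in level j -> v \in level j.+1 -> adj u v ->
  exists2 h, chain h j.+1 & h j = u /\ h j.+1 = v.
Proof.
move=> uj vj uv; have [h [h1 h2] hj] := chain_exists uj.
exists (fun i => if i == j.+1 then v else h i); rewrite ?eqxx ?ltn_eqF //; split=> i.
  by rewrite leq_eqVlt ltnS; case: eqP => [->//|_ /=]; apply: h1.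
rewrite ltnS eqSS => ij; rewrite ltn_eqF //; case: eqP => [->|/eqP ne]; first by rewrite hj.
by apply: h2; rewrite ltn_neqAle ne.
Qed.

(* Two chains from [y] joined by an edge at level [l] form the odd cycle: short
   odd walks being excluded, everything within three levels of [l] lies on it, so
   the path from [y] enters at distance at least two from the exit [qq (minn l j0)]. *)
Lemma toggle_core j j0 tt qq K : chain tt j -> chain qq j -> adj (tt j) (qq j) ->
    j0 <= j <= j0.+1 -> conn K -> K \subset level j ->
    (exists2 u, u \in K & adj (qq j0) u) ->
    (forall u i, u \in K -> i <= j ->
      [/\ u != tt i, u != qq i, ~~ adj u (tt i) & i != j0 -> ~~ adj u (qq i)]) ->
  exists b s o i C, [/\ toggle y b s o i C, {subset (y :: b) ++ (s :: o) <= B},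
     C \subset B :\ y, K \subset C & nth (s :: o) i \in B :\ y].
Proof.
move=> [tl ta] [ql qa] tq /andP[j0j jj0] cK Kj [u0 u0K qu0] Kfar.
have exl : exists i, (i <= j) && adj (tt i) (qq i) by exists j; rewrite leqnn.
case: (ex_minnP exl) => l /andP[lj tql] lmin {exl}.
have {}lmin i : i < l -> ~~ adj (tt i) (qq i).
  move=> il; apply/negP => h; have := lmin i; rewrite h andbT => /(_ (leq_trans (ltnW il) lj)).
  by rewrite leqNgt il.
have tB i : i <= j -> tt i \in B by move=> /tl/levelP[].
have qB i : i <= j -> qq i \in B by move=> /ql/levelP[].
have tf i : i <= j -> f (tt i) = i by move=> /tl/levelP[].
have qf i : i <= j -> f (qq i) = i by move=> /ql/levelP[].
have [yB fy _ _ f0] := lv.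
have t0 : tt 0 = y by apply: f0; [exact: tB|exact: tf].
have q0 : qq 0 = y by apply: f0; [exact: qB|exact: qf].
have lj' i : i <= l -> i <= j by move=> il; apply: leq_trans il lj.
(* Together with the rung at level [l], such an edge would close an odd ladder walk of length at
   most 5 + 2. *)
have short i i' : i <= l -> i' <= l -> l - i + (l - i') <= 5 -> odd (l - i + (l - i')) ->
    ~~ adj (tt i) (qq i').
  move=> il i'l s5 os; apply/negP => h.
  have cw := @ladder_walk _ x0 (fun t => tt (i + t)) (fun t => qq (i' + t)) (l - i) (l - i').
  apply: (no_short_walk x0 og (cw _ _ _ _)).
  - by move=> t; rewrite ltn_subRL addnS => /leq_trans/(_ lj); apply: ta.
  - by move=> t; rewrite ltn_subRL addnS => /leq_trans/(_ lj); apply: qa.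
  - by rewrite !addn0.
  - by rewrite !subnKC.
  - by rewrite size_cat size_rev !size_mkseq addSn addnS /= negbK.
  - by rewrite size_cat size_rev !size_mkseq addSn addnS !ltnS.
  move=> v; rewrite mem_cat mem_rev => /orP[] /mapP[t]; rewrite mem_iota add0n ltnS => /= tl' ->;
    apply: (subsetP BA); [apply: tB|apply: qB]; apply: lj'.
    by clear -tl' il; lia.
  by clear -tl' i'l; lia.
have l0 : 0 < l.
  by case: (l) tql => //; rewrite t0 q0 adj_irrefl.
(* Both chains start at [y], so for smaller [l] the edge from [qq 0] to [qq 1] is one that [short]
   forbids. *)
have l4 : 3 < l.
  rewrite ltnNge; apply/negP => l3.
  apply: (negP (short 0 1 isT l0 _ _)).
  - by clear -l3 l0; lia.
  - by rewrite -(prednK l0) subSS !subn0 oddD /= addNb addbb.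
  - by rewrite t0 -q0; apply: qa; apply: leq_trans lj.
pose S := [set v in [seq tt i | i <- iota 0 l.+1] ++ [seq qq i | i <- iota 0 l.+1]].
have SP v : v \in S -> exists2 i, i <= l & v = tt i \/ v = qq i.
  rewrite inE mem_cat => /orP[] /mapP[i]; rewrite mem_iota /= add0n ltnS => il ->; exists i => //; by [left|right].
have tS i : i <= l -> tt i \in S.
  by move=> il; rewrite inE mem_cat map_f // mem_iota /= ltnS.
have qS i : i <= l -> qq i \in S.
  by move=> il; rewrite inE mem_cat orbC map_f // mem_iota /= ltnS.
have SB v : v \in S -> v \in B.
  by move=> /SP[i /lj' ij [->|->]]; [apply: tB|apply: qB].
have Sf v : v \in S -> f v <= l.
  by move=> /SP[i il [->|->]]; rewrite (tf,qf) // lj'.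
(* An edge of [S] joining levels of equal parity lies within one level and is thus a rung; by
   minimality of [l] the rung at [l] is the only one, as [theta] requires. *)
pose g v := odd (f v).
have adjf u v : u \in S -> v \in S -> adj u v -> f u <= (f v).+1 /\ f v <= (f u).+1.
  by move=> /SB uB /SB vB uv; exact: (level_adj lv uB vB uv).
have stepT i : i < l -> restrict S (tt i) (tt i.+1).
  by move=> il; rewrite /restrict !tS // 1?ltnW // ta // (leq_trans il).
have stepQ i : i < l -> restrict S (qq i) (qq i.+1).
  by move=> il; rewrite /restrict !qS // 1?ltnW // qa // (leq_trans il).
have cross_sym : connect_sym (cross S g).
  by apply: sym_connect_sym => u v; rewrite /cross restrict_sym eq_sym.
have [||||||s [o [b [p [[ic oc cS] [ib lb bS] bo [hp lp pc]]]]]] := @theta G x0 S g (tt l) (qq l) y.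
- by rewrite -t0; apply: tS.
- by [].
- by rewrite /g tf // qf.
- move=> u v uS vS uv guv.
  have [fuv fvu] := adjf u v uS vS uv.
  have fe : f u = f v.
    by move: guv fuv fvu; rewrite /g; clear; lia.
  have [i il ui] := SP u uS; have [i' il' vi'] := SP v vS.
  have ei : i' = i.
    have := fe; case: ui => ->; case: vi' => ->; by rewrite !(tf,qf) ?lj'.
  have key : adj (tt i) (qq i) -> i = l.
    move=> h; apply/eqP; rewrite eqn_leq il leqNgt; apply/negP => /lmin; by rewrite h.
  rewrite ei in vi' => {i' il' ei}; case: ui uv => ->; case: vi' => -> uv.
  + by rewrite adj_irrefl in uv.
  + by rewrite (key uv) !eqxx.
  + by rewrite adj_sym in uv; rewrite (key uv) !eqxx orbT.
  + by rewrite adj_irrefl in uv.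
- apply: (@connect_trans _ _ y).
    rewrite cross_sym -t0; apply: connect_chain => i il.
    by rewrite /cross stepT // /g !tf ?lj' //= ?(ltnW il) //; case: (odd i).
  rewrite -q0; apply: connect_chain => i il.
  by rewrite /cross stepQ // /g !qf ?lj' //= ?(ltnW il) //; case: (odd i).
- by rewrite -t0; apply: connect_chain => i il; apply: stepT.
have cr u v : cross S g u v -> [/\ u \in S, v \in S, adj u v & g u != g v].
  by move=> /andP[/and3P[]].
have crf u v : cross S g u v -> (f u == (f v).+1) || (f v == (f u).+1).
  move=> /cr[uS vS uv guv]; have := adjf u v uS vS uv; move: guv; rewrite /g; clear; lia.
have tqN i t : i <= l -> l <= i + 3 -> i < t <= l -> forall t', t' <= l ->
    (t == t'.+1) || (t' == t.+1) -> ~~ adj (tt t) (qq t') /\ ~~ adj (tt t') (qq t).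
  move=> il li /andP[it tl'] t' tl2 tt'.
  have [h1 h2] : l - t + (l - t') <= 5 /\ odd (l - t + (l - t')).
    by clear -il li it tl' tl2 tt'; split; lia.
  by split; apply: short => //; rewrite addnC.
have exitT i t v : i <= l -> l <= i + 3 -> i < t <= l -> cross S g (tt t) v ->
    v = tt i \/ exists2 t', i < t' <= l & v = tt t'.
  move=> il li itl ctv; have := crf _ _ ctv; have [_ vS atv _] := cr _ _ ctv.
  have /andP[it tl'] := itl; rewrite tf ?lj' //.
  have [t' tl2 [ev|ev]] := SP v vS; rewrite ev ?tf ?qf ?lj' // => ht; last first.
    by have [/negP] := tqN i t il li itl t' tl2 ht; rewrite -ev.
  have [e|ne] := eqVneq t' i; first by left; rewrite e.
  by right; exists t' => //; clear -ne ht it tl2; lia.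
have exitQ i t v : i <= l -> l <= i + 3 -> i < t <= l -> cross S g (qq t) v ->
    v = qq i \/ exists2 t', i < t' <= l & v = qq t'.
  move=> il li itl ctv; have := crf _ _ ctv; have [_ vS atv _] := cr _ _ ctv.
  have /andP[it tl'] := itl; rewrite qf ?lj' //.
  have [t' tl2 [ev|ev]] := SP v vS; rewrite ev ?tf ?qf ?lj' // => ht.
    by have [_ /negP[]] := tqN i t il li itl t' tl2 ht; rewrite -ev adj_sym.
  have [e|ne] := eqVneq t' i; first by left; rewrite e.
  by right; exists t' => //; clear -ne ht it tl2; lia.
have tqlN t : t <= l -> tt l <> qq t /\ qq l <> tt t.
  move=> tl'; split=> e; have := congr1 f e; rewrite qf ?tf ?lj' // => et.
    by move: tql; rewrite e -et adj_irrefl.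
  by move: tql; rewrite e -et adj_irrefl.
(* This close to level [l], changing chains is excluded by [short]. So the path from [tt l], which
   ends on the other chain, has to descend through [tt i]. *)
have on_t i : i <= l -> l <= i + 3 -> tt i \in s :: o.
  move=> il li; rewrite -pc; have [->|ne] := eqVneq i l; first by rewrite inE eqxx.
  pose R := [pred v | v \in [seq tt t | t <- iota i.+1 (l - i)]].
  have RP v : reflect (exists2 t, i < t <= l & v = tt t) (v \in R).
    apply: (iffP mapP) => -[t]; rewrite ?mem_iota => ht ->; exists t => //; rewrite ?mem_iota;
      clear -ht il; lia.
  have [||u [v [_ vp /RP[t ht ->] vR ctv]]] := @walk_exit _ (cross S g) (tt l) p R hp.
  - by apply/RP; exists l => //; clear -ne il; lia.
  - by rewrite lp; apply/RP => -[t /andP[_ tl'] e]; have [_] := tqlN t tl'.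
  have [<-|ex] := exitT i t v il li ht ctv; first by rewrite inE vp orbT.
  by case/RP: vR.
have on_q i : i <= l -> l <= i + 3 -> qq i \in s :: o.
  move=> il li; rewrite -pc; have [->|ne] := eqVneq i l; first by rewrite -lp mem_last.
  pose R := [pred v | v \notin [seq qq t | t <- iota i.+1 (l - i)]].
  have RP v : reflect (exists2 t, i < t <= l & v = qq t) (v \notin R).
    rewrite negbK; apply: (iffP mapP) => -[t]; rewrite ?mem_iota => ht ->; exists t => //; rewrite ?mem_iota;
      clear -ht il; lia.
  have [||u [v [up _ uR /RP[t ht ev] cuv]]] := @walk_exit _ (cross S g) (tt l) p R hp.
  - have [//|/RP[t /andP[_ tl'] e]] := boolP (tt l \in R).
    by have [] := tqlN t tl'.
  - by rewrite lp; apply/RP; exists l => //; clear -ne il; lia.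
  have cvu : cross S g (qq t) u by rewrite /cross restrict_sym eq_sym -ev.
  have [<-//|ex] := exitQ i t u il li ht cvu.
  by have := introT (RP u) ex; rewrite uR.
(* The vertex before [s] on the entering path is off the cycle, hence more than three levels below
   [l], and [s] is at most one level above it. *)
have fs : f s + 3 <= l.
  case: (lastP b) ib lb bS bo => [|b' w] ib lb bS bo; first by rewrite -lb /= fy; clear -l4; lia.
  rewrite last_rcons in lb; rewrite {w}lb in ib bS bo.
  have [ub _] := ib; set u := last y b'.
  have ub' : u \in y :: rcons b' s by rewrite -rcons_cons mem_rcons inE mem_last orbT.
  have us : u != s.
    by apply: contraTneq ub => us; rewrite -rcons_cons rcons_uniq -us mem_last.
  have uo : u \notin s :: o by apply/negP => uo; have [/eqP] := bo u u ub' us uo.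
  have aus : adj u s.
    by have := induced_path_path ib; rewrite rcons_path => /andP[].
  have sS : s \in S by apply: bS; rewrite -rcons_cons mem_rcons inE eqxx.
  have uS := bS u ub'.
  have [_ fsu] := adjf u s uS sS aus.
  have fu : f u + 3 < l.
    have [i il iu] := SP u uS; rewrite ltnNge; apply: contra uo => li.
    by case: iu li => ->; rewrite ?tf ?qf ?lj' // => li; [apply: on_t|apply: on_q].
  by clear -fsu fu; lia.
pose e := minn l j0.
have el : e <= l by apply: geq_minl.
have le : l <= e.+1.
  by rewrite /e; clear -lj jj0; lia.
have eo : qq e \in s :: o by apply: on_q => //; clear -le; lia.
pose i := index (qq e) (s :: o).
have xE : nth (s :: o) i = qq e by apply: nth_index.
have eB : qq e \in B by apply: qB; apply: lj'.
have fe : f (qq e) = e by rewrite qf // lj'.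
have sS : s \in S by apply: cS; rewrite inE eqxx.
have far_s : qq e != s /\ ~~ adj s (qq e).
  split; first by apply/eqP => es; move: fs le; rewrite -es fe; clear; lia.
  by apply/negP => h; have [_] := adjf _ _ sS (qS e el) h; rewrite fe; clear -fs le; lia.
have i1 : 1 < i < size o.
  have [_ _ ac] := ic; have io : i < size (s :: o) by rewrite index_mem.
  have [ne ns] := far_s; have i0 : 0 < i.
    by rewrite lt0n; apply: contraNneq ne => i0; rewrite -xE i0.
  have := ac 0 i; rewrite i0 io xE => /(_ isT) /=; rewrite (negbTE ns) => /esym/negbT.
  by rewrite negb_or eqSS; move: io; rewrite /= -/i; clear -i0; lia.
(* The part of the chain above level [l] links [K] to the exit. *)
pose C := K :|: [set v in [seq qq i | i <- iota l.+1 (j0 - l)]].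
have CP v : v \in C -> v \in K \/ exists2 i, l < i <= j0 & v = qq i.
  rewrite in_setU in_set => /orP[vK|/mapP[t]]; first by left.
  rewrite mem_iota => ti ->; right; exists t => //; clear -ti; lia.
have bcS : {subset (y :: b) ++ (s :: o) <= S}.
  by move=> v; rewrite mem_cat => /orP[/bS|/cS].
exists b, s, o, i, C; rewrite /toggle xE; split=> //.
- split=> //.
  + split.
      apply: (@conn_root _ u0) => v /CP[vK|[t /andP[lt tj] ->]].
        by apply: connect_restrictS (cK u0 v u0K vK); apply: subsetUl.
      have qC t' : t <= t' <= j0 -> qq t' \in C.
        move=> /andP[h1 h2]; rewrite in_setU in_set map_f ?orbT // mem_iota.
        by rewrite (leq_trans lt h1) /= addSn subnKC // (leq_trans (ltnW lt) tj).
      rewrite connect_restrict_sym; apply: (@connect_trans _ _ (qq j0)).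
        have := @connect_chain _ (restrict C) (fun t' => qq (t + t')) (j0 - t).
        rewrite addn0 subnKC //; apply=> t' tt'; rewrite /restrict addnS qa; last first.
          by rewrite ltn_subRL in tt'; apply: leq_trans j0j.
        by rewrite !qC // -?addnS leq_addr -leq_subRL // ltnW.
      by apply: connect1; rewrite /restrict qC ?tj ?leqnn // qu0 in_setU u0K.
    have [jl|lj0] := leqP j0 l.
      by exists u0; rewrite ?in_setU ?u0K // /e (minn_idPr jl).
    exists (qq l.+1); last by rewrite /e (minn_idPl (ltnW lj0)) qa // (leq_trans lj0).
    by rewrite in_setU in_set map_f ?orbT // mem_iota leqnn /= addSn ltnS subnKC // ltnW.
  + move=> u v uC; rewrite in_set => /bcS vS; have [t tl' vt] := SP v vS.
    case/CP: uC => [uK|[i' /andP[li' ij] ->]].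
      have [h1 h2 h3 h4] := Kfar u t uK (lj' t tl').
      case: vt => ->; split=> // ne; apply: h4; apply: contraNneq ne => et.
      by rewrite /e -et (minn_idPr tl').
    have i'j : i' <= j by apply: leq_trans ij j0j.
    have ne : e = l by apply/minn_idPl; apply: ltnW; apply: leq_trans ij.
    have fv : f v <= l by apply: Sf.
    split; first by apply/eqP => ev; move: fv; rewrite -ev qf // leqNgt li'.
    rewrite ne => vl; apply/negP => av.
    have [h1 _] := level_adj lv (qB i' i'j) (SB v vS) av.
    have et : t = l /\ i' = l.+1.
      move: h1; rewrite qf //; case: vt => ->; rewrite ?tf ?qf ?lj' // => h1; clear -h1 tl' li'; lia.
    case: et => et ei; case: vt => ev; last by move: vl; rewrite ev et eqxx.
    rewrite ev et ei in av.
    apply: (@no_short_walk _ x0 A og [:: tt l; qq l; qq l.+1]) => //=.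
      by rewrite tql av andbT qa // -ei.
    move=> w; rewrite !inE => /or3P[] /eqP ->; apply: (subsetP BA); [exact: tB|exact: qB|].
    by apply: qB; rewrite -ei.
- by move=> v /bcS/SB.
- apply/subsetP => v /CP[vK|[t /andP[lt tj] ->]]; rewrite in_setD1; last first.
    have tj' := leq_trans tj j0j.
    by rewrite qB // andbT; apply/eqP => ey; have := qf t tj'; rewrite ey fy; clear -lt; lia.
  have /levelP[-> fv] := subsetP Kj v vK; rewrite andbT; apply/eqP => ey.
  by move: fv; rewrite ey fy; clear -lj l4; lia.
- exact: subsetUl.
- rewrite in_setD1 eB andbT; apply/eqP => ey; move: fe; rewrite ey fy; clear -le l4; lia.
Qed.

End Core.
End Toggle.

(** * Finding toggles in sets that need many colours *)

Section Steps.
Variables (G : sgraph) (x0 : G) (A : {set G}).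
Implicit Types (B C D E H K S T W X Y : {set G}) (u v w x y z : G) (c q b o l : seq G) (h : nat -> G).
Notation nth := (nth x0).
Notation induced_path := (induced_path x0).
Notation toggle := (toggle x0).

Hypothesis og : forall c, odd_cycle c -> {subset c <= A} -> 7 < size c.

(** One palette for even levels and one for odd levels: the factor 2 paid for every levelling. *)
Lemma kcol_levels B f r m : levelling B f r -> (forall j, kcol (level B f j) m) -> kcol B (2 * m).
Proof.
move=> lv /choice[g gP]; have [_ _ _ _ _] := lv.
exists (fun v => odd (f v) * m + g (f v) v); split.
  move=> v vB; have [h _] := gP (f v); have := h v; rewrite inE vB eqxx => /(_ isT).
  by case: (odd _); lia.
move=> u v uB vB uv e.
have [fuv fvu] := level_adj lv uB vB uv.
have [hu _] := gP (f u); have [hv hd] := gP (f v).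
have := hu u; rewrite inE uB eqxx => /(_ isT) {}hu.
have := hv v; rewrite inE vB eqxx => /(_ isT) {}hv.
have fe : f u = f v.
  by move: e hu hv; clear -fuv fvu; case ou : (odd (f u)); case ov : (odd (f v)) => /= *; lia.
have := hd u v; rewrite !inE uB vB fe !eqxx uv => /(_ isT isT isT); apply.
by move: e; rewrite fe; apply: addnI.
Qed.

Lemma kcol_neighbours B v : B \subset A -> v \in A -> kcol (B :&: [set u | adj v u]) 1.
Proof.
move=> BA vA; apply: kcol_stable => u w; rewrite !inE => /andP[uB vu] /andP[wB vw].
apply/negP => uw; apply: (no_short_walk x0 og (c := [:: v; u; w])) => //=.
  by rewrite vu uw adj_sym vw.
by move=> t; rewrite !inE => /or3P[] /eqP -> //; apply: (subsetP BA).
Qed.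

(** In a level that needs many colours, discard in turn the neighbours of a vertex [p] below, of
    some [t] above [p], and of the parent [pq] of some [q] adjacent to [t]. Each neighbourhood is
    stable and costs one colour, whence [m + 3]; the factor 2 is the levelling. The chains through
    [p], [t] and through [pq], [q] are joined by the edge from [t] to [q], and the remaining set
    [K3] is adjacent to none of [p], [t] and [pq]. *)
Lemma toggle_exists y K m : y |: K \subset A -> conn K -> y \notin K ->
    (exists2 u, u \in K & adj y u) -> ~ kcol K (2 * (m + 3)) ->
  exists b s o i C K', [/\ toggle y b s o i C, {subset (y :: b) ++ (s :: o) <= y |: K},
     C \subset K, K' \subset C & ~ kcol K' m /\ nth (s :: o) i \in K].
Proof.
move=> BA cK yK [u0 u0K yu0] nK; set B := y |: K in BA.
have cB : conn B by apply: (conn_add cK u0K); rewrite adj_sym.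
have yB : y \in B by rewrite in_setU1 eqxx.
have [f lv] := levelling_exists cB yB.
have [j nj] : exists j, ~ kcol (level B f j) (m + 3).
  apply: contrapT => h; apply: nK; apply: (@kcolS _ B); first exact: subsetUr.
  by apply: kcol_levels lv _ => j; apply: contrapT => hj; apply: h; exists j.
case: j nj => [|j] nj.
  exfalso; apply: nj; apply: kcol_le (_ : 1 <= _) _; first by rewrite addnS.
  have [_ _ _ _ h0] := lv; apply: kcol_stable => u v /levelP[uB fu] /levelP[vB fv].
  by rewrite (h0 u uB fu) (h0 v vB fv) adj_irrefl.
have lB i : level B f i \subset B by apply/subsetP => v /levelP[].
have lA i : level B f i \subset A by apply: subset_trans BA.
have [H Hj [cH nH]] := ncol_component nj.
have [v0 v0H] := ncol_exists nH.
have [p pj v0p] := level_parent lv (subsetP Hj v0 v0H).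
have sub1 (S : {set G}) v : S \subset level B f j.+1 -> v \in B -> kcol (S :&: [set u | adj v u]) 1.
  by move=> Sj vB; apply: kcol_neighbours; [apply: subset_trans Sj (lA _)|apply: (subsetP BA)].
have Bl i v : v \in level B f i -> v \in B by move=> /levelP[].
have [K1 [cK1 K1H nK1 [t [x1 [tH x1K1 tx1]]]]] :
    exists K1, [/\ conn K1, K1 \subset H :\: [set u | adj p u], ~ kcol K1 (m + 2) &
      exists t x, [/\ t \in H :&: [set u | adj p u], x \in K1 & adj t x]].
  apply: (ncol_component_adj (k := 1)) => //; first by rewrite addnCA.
    by apply: sub1 => //; apply: Bl pj.
  by exists v0; rewrite !inE v0H adj_sym.
have tj : t \in level B f j.+1 by apply: (subsetP Hj); move: tH; rewrite inE => /andP[].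
have pt : adj p t by move: tH; rewrite !inE => /andP[].
have K1j : K1 \subset level B f j.+1.
  by apply: subset_trans Hj; apply: subset_trans K1H _; apply: subsetDl.
have K1p v : v \in K1 -> ~~ adj p v by move=> /(subsetP K1H); rewrite !inE => /andP[].
have [K2 [cK2 K2K nK2 [q [x2 [qK x2K2 qx2]]]]] :
    exists K2, [/\ conn K2, K2 \subset K1 :\: [set u | adj t u], ~ kcol K2 (m + 1) &
      exists (q x : G), [/\ q \in K1 :&: [set u | adj t u], x \in K2 & adj q x]].
  apply: (ncol_component_adj (k := 1)) => //; first by rewrite addnCA.
    by apply: sub1 => //; apply: Bl tj.
  by exists x1; rewrite !inE x1K1.
have [qK1 tq] : q \in K1 /\ adj t q by move: qK; rewrite !inE => /andP[].
have qj := subsetP K1j q qK1.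
have K2K1 v : v \in K2 -> v \in K1 by move=> /(subsetP K2K); rewrite in_setD => /andP[].
have K2t v : v \in K2 -> ~~ adj t v by move=> /(subsetP K2K); rewrite !inE => /andP[].
have K2j : K2 \subset level B f j.+1 by apply/subsetP => v /K2K1/(subsetP K1j).
have [pq pqj qpq] := level_parent lv qj.
have cKq : conn (q |: K2) by apply: (conn_add cK2 x2K2); rewrite adj_sym.
have Kqj : q |: K2 \subset level B f j.+1 by rewrite subUset sub1set qj.
have [K3 [cK3 K3K nK3 [r [x3 [rK x3K3 rx3]]]]] :
    exists K3, [/\ conn K3, K3 \subset (q |: K2) :\: [set u | adj pq u], ~ kcol K3 m &
      exists r x, [/\ r \in (q |: K2) :&: [set u | adj pq u], x \in K3 & adj r x]].
  apply: (ncol_component_adj (k := 1)) => //.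
  - by rewrite addnC => h; apply: nK2; apply: kcolS h; apply: subsetUr.
  - by apply: sub1 => //; apply: Bl pqj.
  - by exists q; rewrite !inE eqxx adj_sym qpq.
have K3pq v : v \in K3 -> ~~ adj pq v by move=> /(subsetP K3K); rewrite !inE => /andP[].
have K3K2 v : v \in K3 -> v \in K2.
  move=> vK3; have := subsetP K3K v vK3; rewrite in_setD in_setU1 => /andP[_ /orP[/eqP vq|//]].
  by have := K3pq v vK3; rewrite vq adj_sym qpq.
have K3j : K3 \subset level B f j.+1 by apply/subsetP => v /K3K2/(subsetP K2j).
have [tt ct [ttp ttt]] := chain_extend lv pj tj pt.
have [|qq cq [qqp qqq]] := chain_extend lv pqj qj; first by rewrite adj_sym.
have tNK1 : t \notin K1 by apply/negP => /K1p; rewrite pt.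
have finish j0 (Kp : {set G}) : j0 <= j.+1 <= j0.+1 -> conn Kp -> Kp \subset level B f j.+1 ->
    K3 \subset Kp -> (exists2 u, u \in Kp & adj (qq j0) u) ->
    (forall u, u \in Kp -> [/\ u != t, u != q, ~~ adj u t & ~~ adj u p]) ->
    (forall u, u \in Kp -> (j0 != j.+1 -> ~~ adj u q) /\ (j0 != j -> ~~ adj u pq)) ->
  exists b s o i C K', [/\ toggle y b s o i C, {subset (y :: b) ++ (s :: o) <= y |: K},
     C \subset K, K' \subset C & ~ kcol K' m /\ nth (s :: o) i \in K].
  move=> hj0 cKp Kpj K3p ex h1 h2.
  have [||b [s [o [i [C [tg bB CB KC xB]]]]]] := toggle_core x0 og BA lv ct cq _ hj0 cKp Kpj ex.
  - by rewrite ttt qqq.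
  - move=> u i uK; have /levelP[uB fu] := subsetP Kpj u uK.
    have [ut uq aut aup] := h1 u uK; have [h3 h4] := h2 u uK.
    have [[tl _] [ql _]] := (ct, cq).
    rewrite leq_eqVlt => /orP[/eqP ->|]; first by rewrite ttt qqq; split=> // ne; apply: h3; rewrite eq_sym.
    rewrite ltnS => ij; have ij1 : i <= j.+1 := leqW ij.
    have /levelP[tB ft] := tl i ij1; have /levelP[qB fq] := ql i ij1.
    have ne : f u <> i by move: fu => -> ei; move: ij; rewrite -ei ltnn.
    have [ij'|ij'] := eqVneq i j.
      rewrite ij' ttp qqp in ft fq *; split=> //.
      + by apply/eqP => e; apply: ne; rewrite e ft.
      + by apply/eqP => e; apply: ne; rewrite e fq.
      + by move=> ne'; apply: h4; rewrite eq_sym.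
    have lt : i < j by rewrite ltn_neqAle ij'.
    split.
    + by apply/eqP => e; apply: ne; rewrite e ft.
    + by apply/eqP => e; apply: ne; rewrite e fq.
    + by apply/negP => a; have [h _] := level_adj lv uB tB a; rewrite fu ft ltnS leqNgt lt in h.
    + by move=> _; apply/negP => a; have [h _] := level_adj lv uB qB a; rewrite fu fq ltnS leqNgt lt in h.
  have BK v : v \in B :\ y -> v \in K by rewrite in_setD1 in_setU1 => /andP[/negbTE ->].
  exists b, s, o, i, C, K3; split=> //.
  - by apply/subsetP => v /(subsetP CB)/BK.
  - exact: subset_trans K3p KC.
  - by split=> //; apply: BK.
have K3far u : u \in K3 -> [/\ u != t, u != q, ~~ adj u t & ~~ adj u p].
  move=> uK; have u2 := K3K2 u uK; have u1 := K2K1 u u2; split.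
  - by apply: contraNneq tNK1 => <-.
  - by apply/eqP => uq; have := K3pq u uK; rewrite uq adj_sym qpq.
  - by rewrite adj_sym K2t.
  - by rewrite adj_sym K1p.
(* [K3] is attached to the second chain at [q] if [q] still sees it, and otherwise at [pq] by way of
   [r]. *)
have [[x xK3 qx]|nq] := pselect (exists2 x, x \in K3 & adj q x).
  apply: (finish j.+1 K3) => //.
  - by rewrite leqnn leqnSn.
  - by exists x; rewrite // qqq.
  - by move=> u uK; rewrite eqxx; split=> // _; rewrite adj_sym K3pq.
have [rKq pqr] : r \in q |: K2 /\ adj pq r by move: rK; rewrite in_setI inE => /andP[].
have rq : r != q by apply/eqP => e; apply: nq; exists x3; rewrite // -e.
have rK2 : r \in K2 by move: rKq; rewrite in_setU1 (negbTE rq).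
apply: (finish j (r |: K3)) => //.
- by rewrite leqnSn leqnn.
- by apply: (conn_add cK3 x3K3); rewrite adj_sym.
- by rewrite subUset sub1set K3j (subsetP K2j).
- exact: subsetUr.
- by exists r; rewrite ?in_setU1 ?eqxx // qqp.
- move=> u; rewrite in_setU1 => /orP[/eqP ->|]; last exact: K3far.
  split=> //; first by apply: contraNneq tNK1 => <-; apply: K2K1.
    by rewrite adj_sym K2t.
  by rewrite adj_sym K1p // K2K1.
- move=> u uK; split=> [_|]; last by rewrite eqxx.
  apply/negP => uq; move: uK; rewrite in_setU1 => /orP[/eqP ur|uK]; last first.
    by apply: nq; exists u; rewrite // adj_sym.
  rewrite {u}ur in uq; apply: (@no_short_walk _ x0 A og [:: pq; r; q]) => //=.
    by rewrite pqr uq qpq.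
  move=> w; rewrite !inE => /or3P[] /eqP ->; [apply: (subsetP (lA j) _ pqj)|apply: (subsetP (lA j.+1))|].
    exact: (subsetP K2j).
  exact: (subsetP (lA j.+1)).
Qed.

(** Choose a component [H] of [K :\: Rm] that needs many colours and go from [x] through [C] until a
    vertex [y] sees [H] for the first time. A toggle from [y] into [H] is then prolonged back to
    [x]: before [y] the path has no neighbour in [H]. Its exit lies in [H], hence avoids [Rm]. *)
Lemma step x C K (Rm : {set G}) m r : x |: C \subset A -> conn C -> x \notin C -> K \subset C ->
    (exists2 u, u \in C & adj x u) -> kcol (K :&: Rm) r -> ~ kcol K (r + 2 * (m + 3)) ->
  exists b s o i C' K', [/\ toggle x b s o i C', {subset (x :: b) ++ (s :: o) <= x |: C},
    C' \subset C, K' \subset C' &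
    [/\ K' \subset K :\: Rm, ~ kcol K' m, nth (s :: o) i \in K :\: Rm & {subset b <= C}]].
Proof.
move=> BA cC xC KC [u0 u0C xu0] kR nK; set W := x |: C in BA.
have nK' : ~ kcol (K :\: Rm) (2 * (m + 3)).
  apply: ncolD kR nK; apply/subsetP => v vK; rewrite in_setU in_setI in_setD vK.
  by case: (v \in Rm).
have [H HK [cH nH]] := ncol_component nK'.
have HC : H \subset C by apply: subset_trans HK _; apply: subset_trans (subsetDl _ _) KC.
have [v0 v0H] := ncol_exists nH.
have xW : x \in W by rewrite in_setU1 eqxx.
have cW : conn W by apply: (conn_add cC u0C); rewrite adj_sym.
pose Z := [set v in W :\: H | [exists u in H, adj v u]].
have xWH : x \in W :\: H by rewrite in_setD xW andbT; apply: contra xC => /(subsetP HC).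
have [z zZ cxz] : exists2 z, z \in Z & connect (restrict (W :\: H)) x z.
  have v0W : v0 \in W by rewrite in_setU1 (subsetP HC) ?orbT.
  have xS : x \in component (W :\: H) x by rewrite inE xWH connect0.
  have v0S : v0 \notin component (W :\: H) x by rewrite !inE v0H.
  have [u [v [uS vS /and3P[uW vW uv]]]] := connect_cut (cW x v0 xW v0W) xS v0S.
  have := component_out uS vS uv; rewrite in_setD vW andbT negbK => vH.
  move: uS; rewrite inE => /andP[uWH cxu]; exists u => //.
  by rewrite inE uWH /=; apply/existsP; exists v; rewrite vH.
have [q [iq qW lq]] := shortest_path x0 xWH cxz.
have hz : has (mem Z) (x :: q) by apply/hasP; exists z => //; rewrite -lq mem_last.
pose t := find (mem Z) (x :: q); have tq : t < size (x :: q) by rewrite -has_find.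
pose y := nth (x :: q) t; pose b1 := take t q.
have tq' : t <= size q by move: tq; rewrite /= ltnS.
have yZ : y \in Z by apply: (nth_find x0 hz).
have lb1 : last x b1 = y.
  by have := nth_last x0 (x :: b1); rewrite /= size_takel // => <-; rewrite -[x :: b1]/(take t.+1 (x :: q)) nth_take.
have ib1 : induced_path (x :: b1) by rewrite -[x :: b1]/(take t.+1 (x :: q)); apply: induced_path_take.
have b1W v : v \in x :: b1 -> v \in W :\: H.
  by move=> vb; apply: qW; apply: (@mem_take t.+1 _ (x :: q)).
have b1Z v : v \in x :: b1 -> v != y -> v \notin Z.
  rewrite -[x :: b1]/(take t.+1 (x :: q)) => /(nthP x0)[i]; rewrite size_takel // => it <-.
  rewrite nth_take // => ne; apply/negbT; apply: (before_find x0 (a := mem Z)).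
  by move: it; rewrite ltnS leq_eqVlt => /orP[/eqP e|//]; rewrite e eqxx in ne.
have b1H v u : v \in x :: b1 -> v != y -> u \in H -> v != u /\ ~~ adj v u.
  move=> vb vy uH; have := b1W v vb; rewrite in_setD => /andP[vH vW]; split.
    by apply: contraNneq vH => ->.
  apply: contra (b1Z v vb vy) => vu; rewrite inE in_setD vH vW /=.
  by apply/existsP; exists u; rewrite uH.
have [yWH yH] : y \in W :\: H /\ exists2 u, u \in H & adj y u.
  by move: yZ; rewrite inE => /andP[-> /existsP[u /andP[uH yu]]]; split=> //; exists u.
have yNH : y \notin H by move: yWH; rewrite in_setD => /andP[].
have yHW : y |: H \subset W.
  by rewrite subUset sub1set; move: yWH; rewrite in_setD => /andP[_ ->]; apply: subset_trans HC (subsetUr _ _).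
have [b2 [s [o [i [C' [K' [tg bo CH KC' [nK2 xH]]]]]]]] := toggle_exists (subset_trans yHW BA) cH yNH yH nH.
have [[ic oc io] [ib2 lb2] bfar [cC' eC'] aC'] := tg.
have b2H u : u \in b2 -> u \in H.
  move=> ub; have := bo u; rewrite mem_cat inE ub orbT in_setU1 => /(_ isT) /orP[/eqP uy|//].
  by have [] := ib2; rewrite /= -uy ub.
have eqb : x :: b1 ++ b2 = rcons (belast x b1) y ++ b2 by rewrite -lb1 -lastI.
have ib : induced_path (x :: b1 ++ b2).
  rewrite eqb; apply: induced_path_cat => //; first by rewrite -lb1 -lastI.
  move=> v u vb ub; have := ib1; rewrite lastI lb1 => -[]; rewrite rcons_uniq => /andP[yb _] _.
  apply: b1H; [by apply: mem_belast| |exact: b2H].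
  by apply: contraNneq yb => <-.
have memb v : v \in x :: b1 ++ b2 -> v \in y :: b2 \/ v \in x :: b1 /\ v != y.
  rewrite -cat_cons mem_cat => /orP[vb|vb]; last by left; rewrite inE vb orbT.
  by have [->|ne] := eqVneq v y; [left; apply: mem_head|right].
have oH v : v \in s :: o -> v = y \/ v \in H.
  move=> vo; have := bo v; rewrite mem_cat vo orbT in_setU1 => /(_ isT) /orP[/eqP|]; by [left|right].
have subW v : v \in (x :: b1 ++ b2) ++ (s :: o) -> v \in W.
  rewrite mem_cat => /orP[/memb[vb|[vb _]]|vo].
  - by apply: (subsetP yHW); apply: bo; rewrite mem_cat vb.
  - by have := b1W v vb; rewrite in_setD => /andP[].
  - by apply: (subsetP yHW); apply: bo; rewrite mem_cat vo orbT.
exists (b1 ++ b2), s, o, i, C', K'; split=> //.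
- split=> //.
  + by split=> //; rewrite last_cat lb1.
  + move=> u v /memb[ub|[ub uy]] us vo; first exact: bfar.
    case: (oH v vo) => [vy|vH]; last by have [] := b1H u v ub uy vH.
    rewrite {v}vy in vo *; split=> // ys.
    by have [/eqP] := bfar y y (mem_head _ _) ys vo.
  + move=> u v uC; rewrite inE mem_cat => /orP[/memb[vb|[vb vy]]|vo].
    * by apply: aC' => //; rewrite inE mem_cat vb.
    * have uH := subsetP CH u uC; have [h1 h2] := b1H v u vb vy uH.
      by rewrite eq_sym adj_sym.
    * by apply: aC' => //; rewrite inE mem_cat vo orbT.
- exact: subset_trans CH HC.
- split=> //; first by apply: subset_trans HK; apply: subset_trans KC' CH.
    exact: (subsetP HK).
  move=> v vb; have := subW v; rewrite mem_cat inE vb orbT in_setU1 => /(_ isT) /orP[/eqP vx|//].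
  by have [] := ib; rewrite /= -vx vb.
Qed.

End Steps.

(** * Ropes *)

Section Ropes.
Variables (G : sgraph) (x0 : G).
Implicit Types (B C D E H K T U W X Y : {set G}) (u v w x z : G) (c b o l L S : seq G) (y p a : nat -> G).
Notation nth := (nth x0).
Notation induced_path := (induced_path x0).
Notation toggle := (toggle x0).

Lemma toggle_paths x b s o i C : toggle x b s o i C -> exists S : bool -> seq G,
  [/\ forall e, [/\ induced_path (x :: S e), last x (S e) = nth (s :: o) i, odd (size (S e)) = e,
                  0 < size (S e) & {subset S e <= b ++ (s :: o)}]
    & {subset (x :: b) ++ (s :: o) <= (x :: S true) ++ (x :: S false)}].
Proof.
move=> [[ic oc /andP[i1 io]] [ib lb] bfar _ _]; set z := nth (s :: o) i.
have [arc1 arc2] := induced_cycle_arcs i1 io ic.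
have i0 : 0 < i by apply: ltn_trans i1.
have e1 := take_arc x0 s i0 (ltnW io); have e2 := drop_arc x0 s (ltnW io).
rewrite e1 -/z in arc1; rewrite e2 -/z in arc2.
have zo : z \in o by rewrite /z -(prednK i0) /= mem_nth // prednK // ltnW.
have build R : induced_path (s :: rcons R z) -> {subset R <= o} ->
    [/\ induced_path (x :: b ++ rcons R z), last x (b ++ rcons R z) = z,
        0 < size (b ++ rcons R z) & {subset b ++ rcons R z <= b ++ (s :: o)}].
  move=> iR Ro; have Ro' v : v \in rcons R z -> v \in o.
    by rewrite mem_rcons inE => /orP[/eqP ->|/Ro].
  split.
  - have -> : x :: b ++ rcons R z = rcons (belast x b) s ++ rcons R z by rewrite -lb -lastI.
    apply: induced_path_cat => //; first by rewrite -lb -lastI.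
    have := ib; rewrite lastI lb => -[]; rewrite rcons_uniq => /andP[sb _] _.
    have [_ /andP[so _] _] := ic.
    move=> u v ub /Ro' vo.
    have us : u != s by apply: contraNneq sb => <-.
    have vs : v != s by apply: contraNneq so => <-.
    have [|h1 h2] := bfar u v (mem_belast ub) us; first by rewrite inE vo orbT.
    by split=> //; apply: h2.
  - by rewrite last_cat last_rcons.
  - by rewrite size_cat size_rcons addnS.
  - by move=> v; rewrite !mem_cat => /orP[->//|/Ro' vo]; rewrite inE vo !orbT.
have [b1 b2 b3 b4] := build _ arc1 (fun v => @mem_take i.-1 _ o v).
have [|c1 c2 c3 c4] := build _ arc2 _.
  by move=> v; rewrite mem_rev => /mem_drop.
set S1 := b ++ rcons (take _ _) z in b1 b2 b3 b4; set S2 := b ++ rcons (rev _) z in c1 c2 c3 c4.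
have s12 : odd (size S2) = ~~ odd (size S1).
  rewrite /S1 /S2 !size_cat !size_rcons size_rev size_drop size_takel; last first.
    by rewrite (leq_trans (leq_pred _)) // ltnW.
  move: oc; rewrite /= prednK // !oddD /= oddB ?(ltnW io) //.
  by case: (odd (size b)); case: (odd (size o)); case: (odd i).
have cover v : v \in (x :: b) ++ (s :: o) -> (v \in x :: S1) || (v \in x :: S2).
  rewrite mem_cat => /orP[vb|vo].
    by move: vb; rewrite !inE !mem_cat => /orP[->//|->]; rewrite orbT.
  have [vs|vs] := eqVneq v s.
    have : v \in x :: b by rewrite vs -lb mem_last.
    by rewrite !inE !mem_cat => /orP[->//|->]; rewrite orbT.
  move: vo; rewrite inE (negbTE vs) /= -(cat_take_drop i.-1 o) mem_cat => /orP[vt|vd].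
    by rewrite in_cons /S1 mem_cat mem_rcons in_cons vt !orbT.
  move: vd; rewrite (drop_nth x0) ?prednK ?(ltnW io) // inE => /orP[vz|vd].
    have -> : v = z by rewrite /z -(prednK i0) (eqP vz).
    by rewrite in_cons /S1 mem_cat mem_rcons mem_head !orbT.
  by rewrite orbC in_cons /S2 mem_cat mem_rcons in_cons mem_rev vd !orbT.
exists (fun e => if odd (size S1) == e then S1 else S2); split.
  by move=> e; case: eqP => ne; split=> //; rewrite s12; move: ne; case: (odd _); case: (e).
move=> v /cover; rewrite mem_cat.
by case: (odd (size S1)) => //=; rewrite orbC.
Qed.

Lemma last_nth_cons z L : last z L = nth (z :: L) (size L).
Proof. exact: esym (nth_last x0 (z :: L)). Qed.

(** [e i] prescribes the parity of the segment from [y i] to [y i.+1], and [t] gives the positions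
    of the spots. The two paths [l1] and [l2] take opposite arcs and so cover the whole rope;
    [clean_vertex] relies on them because contacts are controlled along induced paths. *)
Definition rope j y U :=
  (forall e : nat -> bool, exists L (t : nat -> nat),
    [/\ induced_path (y 0 :: L), {subset y 0 :: L <= U}, t 0 = 0 /\ t j = size L,
        forall i, i <= j -> nth (y 0 :: L) (t i) = y i
      & forall i, i < j -> t i < t i.+1 /\ odd (t i.+1) = odd (t i) (+) e i]) /\
  exists l1 l2, [/\ induced_path (y 0 :: l1) /\ last (y 0) l1 = y j,
    induced_path (y 0 :: l2) /\ last (y 0) l2 = y j,
    {subset y 0 :: l1 <= U}, {subset y 0 :: l2 <= U} &
    forall v, v \in U -> (v \in y 0 :: l1) || (v \in y 0 :: l2)].

Lemma rope0 y : rope 0 y [set y 0].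
Proof.
have i1 : induced_path [:: y 0] by split=> // i j /andP[ij]; rewrite /= ltnS leqn0 => /eqP j0; rewrite j0 in ij.
have sU : {subset [:: y 0] <= [set y 0]} by move=> v; rewrite !inE.
split.
  by move=> e; exists [::], (fun=> 0); split=> // i; rewrite leqn0 => /eqP ->.
by exists [::], [::]; split=> // v; rewrite !inE orbb.
Qed.

Lemma attached_glue C x U z L S : attached C x U -> induced_path (z :: L) -> last z L = x ->
    {subset z :: L <= U} -> induced_path (x :: S) -> {subset S <= C} ->
  induced_path (z :: L ++ S).
Proof.
move=> aC iL lL LU iS SC.
have -> : z :: L ++ S = rcons (belast z L) x ++ S by rewrite -lL -lastI.
apply: induced_path_cat => //; first by rewrite -lL -lastI.
have := iL; rewrite lastI lL => -[]; rewrite rcons_uniq => /andP[xb _] _.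
move=> u v ub /SC vC; have ux : u != x by apply: contraNneq xb => <-.
have [h1 h2] := aC v u vC (LU u (mem_belast ub)).
by rewrite eq_sym adj_sym h1 h2.
Qed.

Lemma rope_extend j y U C C' b s o i : rope j y U -> attached C (y j) U ->
    toggle (y j) b s o i C' -> {subset (y j :: b) ++ (s :: o) <= y j |: C} -> y j.+1 = nth (s :: o) i ->
  rope j.+1 y (U :|: [set v in (y j :: b) ++ (s :: o)]).
Proof.
move=> [rp [l1 [l2 [[il1 ll1] [il2 ll2] l1U l2U Ul]]]] aC tg bC yE.
set U' := _ :|: _.
have [S [SP Scov]] := toggle_paths tg.
have SC e v : v \in S e -> v \in C.
  have [[/andP[xS _] _] _ _ _ sS] := SP e.
  move=> vS; have := bC v; rewrite mem_cat inE -orbA -mem_cat sS // orbT in_setU1 => /(_ isT).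
  by case/orP=> [/eqP vx|//]; move: xS; rewrite -vx vS.
have sub l e : {subset y 0 :: l <= U} -> {subset y 0 :: l ++ S e <= U'}.
  move=> lU v; rewrite -cat_cons mem_cat in_setU => /orP[/lU->//|vS].
  have [_ _ _ _ sS] := SP e.
  by rewrite inE mem_cat inE -orbA -mem_cat sS ?orbT.
have ext l e : induced_path (y 0 :: l) -> last (y 0) l = y j -> {subset y 0 :: l <= U} ->
    induced_path (y 0 :: l ++ S e) /\ last (y 0) (l ++ S e) = y j.+1.
  move=> il ll lU; have [iS lS _ _ _] := SP e; split; last by rewrite last_cat ll lS yE.
  by apply: (attached_glue aC il ll lU iS); apply: SC.
split.
  move=> e; have [L [t [iL LU [t0 tj] tE tS]]] := rp e.
  have lL : last (y 0) L = y j by rewrite -(tE j) // tj last_nth_cons.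
  have [iS lS oS pS _] := SP (e j).
  have [iL' lL'] := ext L (e j) iL lL LU.
  exists (L ++ S (e j)), (fun i => if i <= j then t i else size L + size (S (e j))); split=> //.
  - exact: sub.
  - by rewrite t0 ltnn size_cat.
  - move=> i'; rewrite leq_eqVlt ltnS => /orP[/eqP ->|ij].
      by rewrite ltnn -size_cat -lL' last_nth_cons.
    rewrite ij -[RHS]tE // -cat_cons nth_cat.
    suff -> : t i' < size (y 0 :: L) by [].
    rewrite /= ltnS -tj; elim: (j) ij tS => [|j' IH]; first by rewrite leqn0 => /eqP -> .
    rewrite leq_eqVlt ltnS => /orP[/eqP ->//|ij] tS; apply: leq_trans (IH ij _) _.
      by move=> i'' hi; apply: tS; apply: ltnW.
    by have [/ltnW] := tS j' (ltnSn j').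
  - move=> i'; rewrite ltnS => ij; rewrite ij; move: (ij); rewrite leq_eqVlt => /orP[/eqP ei|ij'].
      by rewrite ei ltnn tj oddD oS; split=> //; rewrite -[X in X < _]addn0 ltn_add2l.
    by rewrite ij'; apply: tS.
have [k1 k2] := ext l1 true il1 ll1 l1U; have [k3 k4] := ext l2 false il2 ll2 l2U.
exists (l1 ++ S true), (l2 ++ S false); split=> //; try exact: sub.
have yl l : last (y 0) l = y j -> y j \in y 0 :: l by move=> <-; apply: mem_last.
move=> v; rewrite in_setU inE -!cat_cons !(mem_cat _ (y 0 :: _)) => /orP[/Ul/orP[->//|->]|/Scov].
  by rewrite orbT.
rewrite mem_cat !inE => /orP[] /orP[/eqP ->|->]; rewrite ?orbT //.
  by have := yl l1 ll1; rewrite inE => ->.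
by have := yl l1 ll1; rewrite inE => ->.
Qed.

Lemma rope_eq j y y' U : (forall i, i <= j -> y i = y' i) -> rope j y U -> rope j y' U.
Proof.
move=> e [rp [l1 [l2 [il1 il2 l1U l2U Ul]]]]; rewrite (e 0) // (e j) // in il1 il2 l1U l2U Ul.
split; last by exists l1, l2.
move=> par; have [L [t [iL LU t0 tE tS]]] := rp par; rewrite (e 0) // in iL LU tE.
by exists L, t; split=> // i ij; rewrite tE ?e.
Qed.

End Ropes.

(** * Growing a rope together with parents for its spots *)

Section States.
Variables (G : sgraph) (x0 : G) (A : {set G}).
Implicit Types (C D E H K T U W X Y : {set G}) (u v w x z : G) (c b o l L S : seq G) (y p a : nat -> G).
Notation nth := (nth x0).
Notation toggle := (toggle x0).
Notation rope := (rope x0).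

Hypothesis og : forall c, odd_cycle c -> {subset c <= A} -> 7 < size c.

Variables (B : {set G}) (f : G -> nat) (r : G).
Hypothesis BA : B \subset A.
Hypothesis lv : levelling B f r.
Variable k : nat.
Notation M := (level B f k.+3).
Notation P := (level B f k.+2).
Notation Q := (level B f k.+1).
Notation conflict := (conflict B f k).

Variable H : {set G}.
Hypothesis HM : H \subset M.

Definition spots j y p a :=
  (forall i, i <= j -> [/\ p i \in P, a i \in Q, adj (p i) (a i) & adj (p i) (y i)]) /\
  (forall i i', i <= j -> i' <= j -> i != i' -> ~~ adj (p i) (p i') /\ ~~ adj (p i) (a i')).

Definition state j y p a U C K :=
  [/\ rope j y U, spots j y p a, attached C (y j) U,
      conn C /\ (exists2 u, u \in C & adj (y j) u)
    & [/\ y j \notin C, K \subset C, U \subset H & C \subset H]].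

Lemma rope_end j y U : rope j y U -> y j \in U.
Proof. by move=> [_ [l1 [_ [[_ <-] _ l1U _ _]]]]; apply: l1U; apply: mem_last. Qed.

Lemma conflicts_kcol j y p a : spots j y p a ->
  kcol [set v in M | [exists i : 'I_j.+1, conflict (p i) (a i) v]] (4 * j.+1).
Proof.
move=> [sp _]; have pB i : i <= j -> p i \in B by move=> /sp[/levelP[]].
have aB i : i <= j -> a i \in B by move=> /sp[_ /levelP[]].
suff : forall m, m <= j.+1 -> kcol [set v in M | [exists i : 'I_j.+1, (i < m) && conflict (p i) (a i) v]] (4 * m).
  move=> /(_ j.+1 (leqnn _)); apply: kcolS; apply/subsetP => v; rewrite !inE => /andP[-> /existsP[i ci]].
  by apply/existsP; exists i; rewrite ltn_ord.
elim=> [|m IH] mj.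
  by exists (fun=> 0); split=> [v|u v]; rewrite !inE => /andP[_ /existsP[i]].
have := kcolU (IH (ltnW mj)) (conflict_kcol x0 og f BA k (pB m mj) (aB m mj)).
rewrite mulnS addnC; apply: kcolS; apply/subsetP => v; rewrite !inE => /andP[-> /existsP[i /andP[im ci]]] /=.
move: im; rewrite ltnS leq_eqVlt => /orP[/eqP ei|im]; first by rewrite -ei ci orbT.
by apply/orP; left; apply/existsP; exists i; rewrite im.
Qed.

(** The colours pay for the conflicts with the [j.+1] earlier spots and for one application of
    [step]. The exit of the new toggle is free of conflicts, so any parent of it and any parent of
    that parent can be taken for the new spot. *)
Lemma state_step j y p a U C K m : state j y p a U C K -> ~ kcol K (4 * j.+1 + 2 * (m + 3)) ->
  exists b s o i y' p' a' C' K',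
    [/\ toggle (y j) b s o i C', {subset (y j :: b) ++ (s :: o) <= y j |: C}, ~ kcol K' m,
        [/\ y' j.+1 = nth (s :: o) i, C' \subset C & forall i, i <= j -> y' i = y i] &
        state j.+1 y' p' a' (U :|: [set v in (y j :: b) ++ (s :: o)]) C' K'].
Proof.
move=> [rp sp aC [cC eC] [yC KC UH CH]] nK.
have HA v : v \in H -> v \in A by move=> /(subsetP HM)/levelP[/(subsetP BA)].
have yU := rope_end rp.
have yCA : y j |: C \subset A.
  by apply/subsetP => v; rewrite in_setU1 => /orP[/eqP ->|/(subsetP CH)/HA//]; apply/HA/(subsetP UH).
have kR : kcol (K :&: [set v in M | [exists i : 'I_j.+1, conflict (p i) (a i) v]]) (4 * j.+1).
  by apply: kcolS (conflicts_kcol sp); apply: subsetIr.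
have [b [s [o [i [C' [K' [tg bC C'C K'C [K'K nK' xK bC']]]]]]]] := step x0 og yCA cC yC KC eC kR nK.
set z := nth (s :: o) i in xK; have [[ic oc io] _ _ [cC' eC'] aC'] := tg.
have zo : z \in s :: o.
  by apply: mem_nth; case/andP: io => _ io; rewrite /= ltnS ltnW.
have [zK zR] : z \in K /\ forall i', i' <= j -> ~~ conflict (p i') (a i') z.
  move: xK; rewrite in_setD in_set => /andP[zR zK]; split=> // i' ij.
  move: zR; rewrite (subsetP HM) ?(subsetP CH) ?(subsetP KC) //= => /existsPn /(_ (Ordinal (ij : i' < j.+1))).
  by [].
have zM : z \in M by apply: (subsetP HM); apply: (subsetP CH); apply: (subsetP KC).
have [pz pzP zpz] := level_parent lv zM.
have [az azQ paz] := level_parent lv pzP.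
pose upd (g : nat -> G) v i' := if i' == j.+1 then v else g i'.
have updE g v i' : i' <= j -> upd g v i' = g i'.
  by move=> ij; rewrite /upd ltn_eqF.
have updS g v : upd g v j.+1 = v by rewrite /upd eqxx.
exists b, s, o, i, (upd y z), (upd p pz), (upd a az), C', K'; split=> //.
  by split=> // i' ij; rewrite updE.
split.
- have := @rope_extend _ x0 j (upd y z) U C C' b s o i.
  rewrite updE // updS; apply=> //; apply: rope_eq rp => i' ij; by rewrite updE.
- have [sp1 sp2] := sp; split.
    move=> i'; rewrite leq_eqVlt ltnS => /orP[/eqP ->|ij]; last by rewrite !updE //; apply: sp1.
    by rewrite !updS (adj_sym _ z); split.
  have key i' : i' <= j -> [/\ ~~ adj pz (p i'), ~~ adj pz (a i') & ~~ adj (p i') az].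
    move=> ij; have [h1 h2 h3] := conflictN (zR i' ij) pzP zpz.
    by split=> //; rewrite adj_sym h3.
  move=> i1 i2; rewrite leq_eqVlt ltnS => /orP[/eqP ->|ij1]; rewrite leq_eqVlt ltnS => /orP[/eqP ->|ij2].
  + by rewrite eqxx.
  + by have [] := key i2 ij2; rewrite !updS !updE.
  + by have [h1 _ h3] := key i1 ij1; rewrite !updS !updE // adj_sym.
  + by rewrite !updE //; apply: sp2.
- rewrite updS => u v uC; rewrite in_setU => /orP[vU|]; last exact: aC'.
  have [h1 h2] := aC u v (subsetP C'C u uC) vU; split=> // vz.
  have [ve|ve] := eqVneq v (y j); last exact: h2.
  by have [|_] := aC' u v uC; [rewrite inE mem_cat ve inE eqxx|apply].
- by rewrite updS.
- rewrite updS; split=> //.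
  + apply/negP => zC; have [|/eqP] := aC' z z zC; first by rewrite inE mem_cat zo orbT.
    by rewrite eqxx.
  + rewrite subUset UH /=; apply/subsetP => v; rewrite inE => /bC; rewrite in_setU1 => /orP[/eqP ->|].
      exact: (subsetP UH).
    exact: (subsetP CH).
  + exact: subset_trans CH.
Qed.

Fixpoint bound j n m := if n is n'.+1 then 4 * j.+1 + 2 * (bound j.+1 n' m + 3) else m.

Lemma state_steps n j y p a U C K m : state j y p a U C K -> ~ kcol K (bound j n m) ->
  exists y' p' a' U' C' K',
    [/\ state (j + n) y' p' a' U' C' K', y' 0 = y 0, C' \subset C, U' \subset U :|: C & ~ kcol K' m].
Proof.
elim: n j y p a U C K => [|n IH] j y p a U C K st nK.
  by exists y, p, a, U, C, K; rewrite addn0; split=> //; apply: subsetUl.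
have [b [s [o [i [y1 [p1 [a1 [C1 [K1 [tg bC nK1 [_ C1C y1E] st1]]]]]]]]]] := state_step st nK.
have [y2 [p2 [a2 [U2 [C2 [K2 [st2 e2 C2C U2U nK2]]]]]]] := IH _ _ _ _ _ _ _ st1 nK1.
exists y2, p2, a2, U2, C2, K2; rewrite addnS -addSn; split=> //.
- by rewrite e2 y1E.
- exact: subset_trans C1C.
- apply: subset_trans U2U _; rewrite !subUset (subset_trans C1C (subsetUr _ _)) subsetUl /= andbT.
  apply/subsetP => v; rewrite inE => /bC; rewrite in_setU1 in_setU => /orP[/eqP ->|->]; rewrite ?orbT //.
  by have [/rope_end -> _ _ _ _] := st.
Qed.

End States.

(** * Closing the rope *)

Section Closing.
Variables (G : sgraph) (x0 : G) (A : {set G}).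
Implicit Types (C D E K T U W X Y : {set G}) (u v w x z : G) (c b o l L S q : seq G) (y p a : nat -> G).
Notation nth := (nth x0).
Notation induced_path := (induced_path x0).
Notation toggle := (toggle x0).
Notation rope := (rope x0).

Hypothesis og : forall c, odd_cycle c -> {subset c <= A} -> 7 < size c.
Hypothesis wf : wheel_free G.

Variables (B : {set G}) (f : G -> nat) (r : G).
Hypothesis BA : B \subset A.
Hypothesis lv : levelling B f r.
Variable k : nat.
Notation M := (level B f k.+3).
Notation P := (level B f k.+2).
Notation Q := (level B f k.+1).
Notation touch := (touch B f k).

(** 119 = 1 + 40 + 39 + 39: the neighbours of the exit, the vertices touching the last odd cycle,
    and the vertices touching one of two paths that lead from this cycle back along the rope. The
    cycle and the two paths cover the rope, so the parents of any other vertex of [K] see none of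
    it. *)
Lemma clean_vertex j y U C b s o i C' K :
    rope j y U -> attached C (y j) U -> toggle (y j) b s o i C' ->
    {subset (y j :: b) ++ (s :: o) <= y j |: C} ->
    attached C' (nth (s :: o) i) (U :|: [set v in (y j :: b) ++ (s :: o)]) ->
    U :|: [set v in (y j :: b) ++ (s :: o)] \subset M -> C' \subset M -> K \subset C' ->
    ~ kcol K 119 ->
  exists v (p : G), [/\ v \in C', p \in P, adj v p &
    forall u, u \in U :|: [set v in (y j :: b) ++ (s :: o)] -> ~~ adj p u].
Proof.
move=> [_ [l1 [l2 [[il1 ll1] [il2 ll2] l1U l2U Ul]]]] aC tg bC aC' UM CM KC nK.
set U' := _ :|: _ in aC' UM *; have [[ic oc io] [ib lb] bfar [cC' eC'] _] := tg.
have /andP[i1 io'] := io; set x := nth (s :: o) i in aC' eC'.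
have xo : x \in s :: o by apply: mem_nth; rewrite /= ltnS ltnW.
have oU v : v \in s :: o -> v \in U' by move=> vo; rewrite in_setU inE mem_cat vo !orbT.
have bU v : v \in y j :: b -> v \in U' by move=> vb; rewrite in_setU inE mem_cat vb orbT.
have oM : {subset s :: o <= M} by move=> v /oU/(subsetP UM).
have bCC v : v \in b -> v \in C.
  move=> vb; have := bC v; rewrite mem_cat inE vb orbT in_setU1 => /(_ isT) /orP[/eqP vy|//].
  by have [] := ib; rewrite /= -vy vb.
(* The path is read backwards from [s], and [s] is dropped because [path_contacts] counts it with
   the cycle. *)
pose l' l := behead (rev (y 0 :: l ++ b)).
have path_l l : induced_path (y 0 :: l) -> last (y 0) l = y j -> {subset y 0 :: l <= U} ->
   [/\ induced_path (s :: l' l), {subset l' l <= U'}, {in l' l & o, forall u v, u != v /\ ~~ adj u v} &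
       forall u, u \in y 0 :: l ++ b -> u = s \/ u \in l' l].
  move=> il ll lU.
  have revE : rev (y 0 :: l ++ b) = s :: l' l.
    by rewrite /l' lastI last_cat ll lb rev_rcons.
  have ilb : induced_path (y 0 :: l ++ b) by apply: (attached_glue aC il ll lU ib).
  have memE u : (u \in s :: l' l) = (u \in y 0 :: l ++ b) by rewrite -revE mem_rev.
  have ilr : induced_path (s :: l' l) by rewrite -revE; apply: induced_path_rev.
  have slN : s \notin l' l by have [/andP[]] := ilr.
  have mem' u : u \in l' l -> u \in U \/ u \in y j :: b.
    move=> ul; have := memE u; rewrite inE ul orbT -cat_cons mem_cat => /esym /orP[/lU|ub]; first by left.
    by right; rewrite inE ub orbT.
  split=> //.
  - by move=> u /mem'[uU|/bU//]; rewrite in_setU uU.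
  - move=> u v ul vo; have [/andP[so _] _] : uniq (s :: o) /\ True by split=> //; have [] := ic.
    have us : u != s by apply: contraNneq slN => <-.
    have vs : v != s by apply: contraNneq so => <-.
    have vo' : v \in s :: o by rewrite inE vo orbT.
    have fromb : u \in y j :: b -> u != v /\ ~~ adj u v.
      by move=> ub; have [h1 h2] := bfar u v ub us vo'; split=> //; apply: h2.
    case: (mem' u ul) => [uU|//].
    have [uy|uy] := eqVneq u (y j); first by apply: fromb; rewrite uy inE eqxx.
    have vy : v != y j.
      apply/eqP => vy; have ys : y j != s by rewrite -vy.
      by have [] := bfar (y j) v (mem_head _ _) ys vo'; rewrite vy eqxx.
    have vC : v \in C.
      by have := bC v; rewrite mem_cat vo' orbT in_setU1 (negbTE vy) => /(_ isT).
    by have [h1 h2] := aC v u vC uU; rewrite eq_sym adj_sym h1 h2.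
  - by move=> u; rewrite -memE inE => /orP[/eqP|]; [left|right].
have [p1 p2 p3 p4] := path_l l1 il1 ll1 l1U; have [q1 q2 q3 q4] := path_l l2 il2 ll2 l2U.
have cfar l : {subset l' l <= U'} -> forall u v, u \in C' -> v \in (s :: o) ++ l' l ->
    u != v /\ (v != x -> ~~ adj u v).
  by move=> lU u v uC; rewrite mem_cat => /orP[/oU|/lU]; apply: aC'.
have KM : K \subset M by apply: subset_trans CM.
have xB : x \in B by have /levelP[] := oM x xo.
pose K1 := K :\: [set v in M | adj v x].
have nK1 : ~ kcol K1 118.
  apply: ncolD (neighbour_kcol x0 og f BA k xB) nK; apply/subsetP => v vK.
  by rewrite in_setU in_setD vK andbT; case: (v \in [set _ in _ | _]).
have K1K : K1 \subset K by apply: subsetDl.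
have k2 : kcol [set v in K1 | touch v (s :: o)] 40.
  apply: (odd_cycle_contacts og wf BA lv ic oc oM); first exact: subset_trans KM.
  move=> v u vK1 uo; have vK := subsetP K1K v vK1.
  have [h1 h2] := aC' v u (subsetP KC v vK) (oU u uo); rewrite eq_sym adj_sym; split=> //.
  have [ux|] := eqVneq u x; last exact: h2.
  by move: vK1; rewrite ux in_setD inE (subsetP KM v vK) => /andP[].
have k3 : kcol [set v in K1 | ~~ touch v (s :: o) && touch v (l' l1)] 39.
  apply: (path_contacts og wf BA lv ic oc i1 io' oM p1 _ p3 cC' CM (cfar _ p2) eC').
    by move=> u /p2/(subsetP UM).
  exact: subset_trans KC.
have k4 : kcol [set v in K1 | ~~ touch v (s :: o) && touch v (l' l2)] 39.
  apply: (path_contacts og wf BA lv ic oc i1 io' oM q1 _ q3 cC' CM (cfar _ q2) eC').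
    by move=> u /q2/(subsetP UM).
  exact: subset_trans KC.
have [v vK1 [nt1 nt2 nt3]] : exists2 v, v \in K1 & [/\ ~~ touch v (s :: o), ~~ touch v (l' l1) & ~~ touch v (l' l2)].
  apply: contrapT => h; apply: nK1; apply: kcolS (kcolU (kcolU k2 k3) k4); apply/subsetP => v vK1.
  have inK (T : {set G}) (R : pred G) : v \in T -> (v \in [set u in T | R u]) = R v.
    by move=> vT; rewrite in_set vT.
  rewrite !in_setU !inK //; apply: contrapT => /negP; rewrite !negb_or => /andP[/andP[h1 h2] h3].
  by apply: h; exists v => //; move: h2 h3; rewrite h1 /= => h2 h3.
have vK := subsetP K1K v vK1; have vC := subsetP KC v vK.
have [p pP vp] := level_parent lv (subsetP CM v vC).
exists v, p; split=> // u uU; apply/negP => pu.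
have touchN l : ~~ touch v l -> u \notin l.
  by move=> h; apply: contra h => ul; apply/touchP; exists p => //; split=> //; apply/hasP; exists u.
have uo : u \notin s :: o := touchN _ nt1.
have us : u <> s by move=> us; move: uo; rewrite us inE eqxx.
have N1 : u \notin y 0 :: l1 ++ b.
  by apply/negP => /p4[//|]; apply/negP; apply: touchN.
have N2 : u \notin y 0 :: l2 ++ b.
  by apply/negP => /q4[//|]; apply/negP; apply: touchN.
move: uU; rewrite in_setU inE mem_cat (negbTE uo) orbF => /orP[/Ul/orP[ul|ul]|].
- by move: N1; rewrite -cat_cons mem_cat ul.
- by move: N2; rewrite -cat_cons mem_cat ul.
rewrite inE => /orP[/eqP uy|ub]; move: N1; rewrite -cat_cons mem_cat; last by rewrite ub orbT.
by rewrite uy -ll1 mem_last.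
Qed.

(** The return leads through [C] to [v], down by [p], through levels at most [k.+1], which cannot
    see level [k.+3], and up by [p0] to [y0]. A shortest path in this union has no contact with [U]
    except at its ends. *)
Lemma closing_path x (y0 : G) U C v (p p0 : G) : conn C -> C \subset M -> U \subset M ->
    attached C x U -> (exists2 u, u \in C & adj x u) -> v \in C -> p \in P -> adj v p ->
    (forall u, u \in U -> ~~ adj p u) -> p0 \in P -> adj p0 y0 ->
    (forall u, u \in U -> u != y0 -> ~~ adj p0 u) -> x \in U -> y0 \in U -> x != y0 -> ~~ adj x y0 ->
  exists q, [/\ induced_path (x :: rcons q y0), q != [::], {subset q <= B} &
    forall u z, u \in U -> u != x -> u != y0 -> z \in q -> u != z /\ ~~ adj u z].
Proof.
move=> cC CM UM aC [u0 u0C xu0] vC pP vp pU p0P p0y p0U xU yU xy naxy.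
have [p1 p1Q pp1] := level_parent lv pP; have [p2 p2Q pp2] := level_parent lv p0P.
pose D := low B f k.+1.
have QD u : u \in Q -> u \in D by move=> /levelP[uB fu]; rewrite inE uB fu leqnn.
pose W := x |: (C :|: (p |: (y0 |: (p0 |: D)))).
have cW : conn W.
  have p2p : adj p2 p0 by rewrite adj_sym.
  have c1 : conn (p0 |: D) := conn_add (low_conn BA lv (i := k.+1)) (QD p2 p2Q) p2p.
  have c2 : conn (y0 |: (p0 |: D)) by apply: (conn_add c1 _ p0y); rewrite in_setU1 eqxx.
  have c3 : conn (p |: (y0 |: (p0 |: D))).
    apply: (conn_add c2 (u := p1)); last by rewrite adj_sym.
    by rewrite !in_setU1 QD ?orbT.
  have c4 : conn (C :|: (p |: (y0 |: (p0 |: D)))).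
    apply: (connU cC c3 vC (v := p)); last by rewrite vp orbT.
    by rewrite in_setU1 eqxx.
  by apply: (conn_add c4 (u := u0)); rewrite ?in_setU ?u0C // adj_sym.
have xW : x \in W by rewrite in_setU1 eqxx.
have yW : y0 \in W by rewrite !in_setU !in_set1 eqxx !orbT.
have [J [iJ JW lJ]] := shortest_path x0 xW (cW x y0 xW yW).
have [q eJ] : exists q, J = rcons q y0.
  case: (lastP J) lJ => [/= e|q' w]; last by rewrite last_rcons => ->; exists q'.
  by move: xy; rewrite e eqxx.
rewrite {}eJ in iJ JW {lJ}.
have qW z : z \in q -> [\/ z \in C, z = p, z = p0 | z \in D].
  move=> zq; have [uJ _] := iJ; have := JW z; rewrite inE mem_rcons inE zq !orbT => /(_ isT).
  have zx : z != x by apply: contraTneq uJ => <-; rewrite /= mem_rcons inE zq orbT.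
  have zy : z != y0.
    by apply: contraTneq uJ => e; rewrite -rcons_cons rcons_uniq -e inE zq orbT.
  rewrite !in_setU !in_set1 (negbTE zx) (negbTE zy) /=.
  by case/or4P => [h|/eqP h|/eqP h|h]; [apply: Or41|apply: Or42|apply: Or43|apply: Or44].
exists q; split=> //.
- apply: contraNneq naxy => q0; rewrite q0 in iJ.
  exact: (induced_path_adj (a := 0) iJ isT).
- move=> z /qW[/(subsetP CM)/levelP[]|->|->|] //; try by [have /levelP[] := pP|have /levelP[] := p0P].
  by rewrite inE => /andP[].
- move=> u z uU ux uy zq; have /levelP[uB fu] := subsetP UM u uU.
  have diff w i : w \in level B f i -> i != k.+3 -> u != w.
    by move=> /levelP[_ fw] ne; apply: contraNneq ne => e; rewrite -fw -e fu.
  case: (qW z zq) => [zC|->|->|].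
  + by have [h1 h2] := aC z u zC uU; rewrite eq_sym adj_sym h1 h2.
  + by rewrite adj_sym pU // (diff p k.+2) // ltn_eqF.
  + by rewrite adj_sym p0U // (diff p0 k.+2) // ltn_eqF.
  + rewrite inE => /andP[zB fz]; split.
      by apply/eqP => e; move: fu fz; rewrite e => ->; rewrite ltnNge leqnSn.
    by apply/negP => uz; have [h _] := level_adj lv uB zB uz; move: h; rewrite fu ltnS leqNgt ltnS fz.
Qed.

(** An edge in level i and two descents to the root would form a closed walk of length 2i + 1, at
    most 7. *)
Lemma level_stable i : i <= 3 -> stable (level B f i).
Proof.
case: i => [|i] i3.
  move=> u v /levelP[uB fu] /levelP[vB fv]; have [_ _ _ _ h0] := lv.
  by rewrite (h0 u uB fu) (h0 v vB fv) adj_irrefl.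
move=> u v ul vl; apply/negP => uv.
have [hu [hu1 hu2] hui] := chain_exists lv ul; have [hv [hv1 hv2] hvi] := chain_exists lv vl.
have [_ _ _ _ h0] := lv.
have e0 : hu 0 = hv 0.
  have /levelP[h1 h2] := hu1 0 isT; have /levelP[h3 h4] := hv1 0 isT.
  by rewrite (h0 _ h1 h2) (h0 _ h3 h4).
apply: (no_short_walk x0 og (ladder_walk x0 (u := hu) (w := fun t => hv t.+1) (a := i.+1) (b := i) hu2 _ _ _)).
- by move=> t ti; apply: hv2.
- by rewrite e0; apply: hv2.
- by rewrite hui hvi.
- by rewrite size_cat size_rev !size_mkseq; clear; lia.
- by rewrite size_cat size_rev !size_mkseq; clear -i3; lia.
move=> w; rewrite mem_cat mem_rev => /orP[] /mapP[t]; rewrite mem_iota add0n => /= ti ->;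
  apply: (subsetP BA).
  by have /levelP[] := hu1 t ti.
by have /levelP[] := hv1 t.+1 ti.
Qed.

Lemma deep_level m : 0 < m -> ~ kcol B (2 * m) -> exists j, ~ kcol (level B f j.+3) m.
Proof.
move=> m0 nB; apply: contrapT => h; apply: nB; apply: kcol_levels lv _ => j.
have [j3|j3] := leqP j 3.
  by apply: kcol_le m0 _; apply: kcol_stable; apply: level_stable.
apply: contrapT => hj; apply: h; exists (j - 3).
by rewrite -[_.+3]addn3 subnK // ltnW.
Qed.

End Closing.

Lemma five_bools (c : nat -> bool) : exists i j l, [/\ i < j, j < l, l < 5, c j = c i & c l = c i].
Proof.
case e0 : (c 0); case e1 : (c 1); case e2 : (c 2); case e3 : (c 3); case e4 : (c 4);
  first [by exists 0, 1, 2; rewrite e0 e1 e2|by exists 0, 1, 3; rewrite e0 e1 e3|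
         by exists 0, 1, 4; rewrite e0 e1 e4|by exists 0, 2, 3; rewrite e0 e2 e3|
         by exists 0, 2, 4; rewrite e0 e2 e4|by exists 0, 3, 4; rewrite e0 e3 e4|
         by exists 1, 2, 3; rewrite e1 e2 e3|by exists 1, 2, 4; rewrite e1 e2 e4|
         by exists 1, 3, 4; rewrite e1 e3 e4|by exists 2, 3, 4; rewrite e2 e3 e4].
Qed.

(** * The wheel of a closed rope, and the colour count *)

Section Final.
Variables (G : sgraph) (x0 : G) (A : {set G}).
Implicit Types (C D E K T U W X Y : {set G}) (u v w x z : G) (c b o l L S q : seq G) (y p a : nat -> G).
Notation nth := (nth x0).
Notation induced_path := (induced_path x0).
Notation induced_cycle := (induced_cycle x0).
Notation rope := (rope x0).
Notation state := (state x0).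

Hypothesis og : forall c, odd_cycle c -> {subset c <= A} -> 7 < size c.
Hypothesis wf : wheel_free G.

Lemma rope_wheel (B : {set G}) f r k (H : {set G}) y p a U q :
    B \subset A -> levelling B f r -> H \subset level B f k.+3 ->
    rope 5 y U -> spots B f k 4 y p a -> U \subset H -> {subset q <= H} ->
    induced_path (y 5 :: rcons q (y 0)) -> q != [::] ->
    (forall u z, u \in U -> u != y 5 -> u != y 0 -> z \in q -> u != z /\ ~~ adj u z) ->
  False.
Proof.
move=> BA lv HM [rp _] [sp1 sp2] UH qH iq q0 qfar.
have [||c cP] := @hub _ x0 A og B f r BA lv k 5 p a isT.
- by move=> i i5; have [] := sp1 i i5.
- by move=> i j i5 j5 ij; have [] := sp2 i j i5 j5 ij.
have [i [j [l [ij jl l5 cj cl]]]] := five_bools c.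
have [X [Y [Xst Yst dXY cXY [pX hX hY]]]] := cP (c i).
(* Segment [i] and segment [j] are odd, the other ones between [y i] and [y l]
   even; segment 4 comes after [y l] and fixes the parity of the rim. *)
have [L [t [iL LU [t0 t5] tE tS]]] := rp (fun m => [|| m == i, m == j | (m == 4) && odd (size q)]).
have par m : m <= 5 -> odd (t m) = (i < m) (+) (j < m) (+) ((4 < m) && odd (size q)).
  elim: m => [|m IH] m5; first by rewrite t0.
  have [_ ->] := tS m m5; rewrite IH; last exact: ltnW.
  rewrite !ltnS; clear -ij jl l5 m5; move: (odd (size q)) => s; lia.
have mono m m' : m < m' -> m' <= 5 -> t m < t m'.
  elim: m' => // m' IH; rewrite ltnS leq_eqVlt => /orP[/eqP ->|mm] m5.
    by have [] := tS m' m5.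
  by apply: ltn_trans (IH mm (ltnW m5)) _; have [] := tS m' m5.
have j5 : j < 5 by apply: ltn_trans l5.
have i5 : i < 5 by apply: ltn_trans j5.
have tL m : m < 5 -> t m < size L by move=> m5; rewrite -t5; apply: mono.
have [L' eL] : exists L', L = rcons L' (y 5).
  have lL : last (y 0) L = y 5 by rewrite (last_nth_cons x0) -t5 tE.
  case: (lastP L) lL (tL 0 isT) => [|L' w] //; rewrite last_rcons => -> _; by exists L'.
have yN : y 5 \notin y 0 :: L' by have [] := iL; rewrite eL -rcons_cons rcons_uniq => /andP[].
have ic : induced_cycle (y 0 :: rcons L' (y 5) ++ q).
  apply: induced_close => //; first by rewrite -eL.
  move=> u z uL zq; have uN0 : u != y 0.
    have [] := iL; rewrite /= eL mem_rcons inE negb_or -andbA => /and3P[_ yL _] _.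
    by apply: contraNneq yL => <-.
  have uN5 : u != y 5 by apply: contraNneq yN => <-; rewrite inE uL orbT.
  have [|h1 h2] := qfar u z _ uN5 uN0 zq; last by [].
  by apply: LU; rewrite inE eL mem_rcons inE uL !orbT.
rewrite -eL in ic; set rim := _ :: _ in ic.
have so : size rim = (size L).+1 + size q by rewrite /rim /= size_cat.
have oc : odd (size rim).
  rewrite so oddD [odd _.+1]/= -t5 par // i5 j5 /=.
  by case: (odd (size q)).
have rimM v : v \in rim -> v \in level B f k.+3.
  by rewrite /rim -cat_cons mem_cat => /orP[/LU/(subsetP UH)|/qH] /(subsetP HM).
have [far1 far2] : {in level B f k.+3, forall v, v \notin X :|: Y} /\
    {in Y & level B f k.+3, forall w v, ~~ adj w v}.
  by apply: (hub_far BA lv (a := a) (m := 5)) => //; [move=> m m5; have [] := sp1 m m5|move=> x /hX[]].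
have rimE m : m < 5 -> nth rim (t m) = y m.
  by move=> m5; rewrite /rim -cat_cons nth_cat /= ltnS ltnW ?tL // tE // ltnW.
have mij := mono i j ij (ltnW j5); have mjl := mono j l jl (ltnW l5).
(* The middle spot serves as both inner contacts. *)
apply: (wf Xst Yst dXY cXY oc ic (i := t i) (j := t j) (k := t j) (l := t l)) => //.
- by move=> v /rimM; apply: far1.
- by move=> z v zY /rimM; apply: far2.
- by rewrite so addSn ltnS (leq_trans (ltnW (tL l l5))) // leq_addr.
- rewrite oddB ?(ltnW mij) // (par j (ltnW j5)) (par i (ltnW i5)).
  by clear -ij jl l5; move: (odd (size q)) => s; lia.
- rewrite oddB ?(ltnW mjl) // (par j (ltnW j5)) (par l (ltnW l5)).
  by clear -ij jl l5; move: (odd (size q)) => s; lia.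
move=> m; rewrite !inE => hm.
have [n [n5 em cn]] : exists n, [/\ n < 5, m = t n & c n = c i].
  by case/or4P: hm => /eqP ->; [exists i|exists j|exists j|exists l].
by exists (p n); rewrite ?pX // em rimE //; have [] := sp1 n n5.
Qed.

(** The factors 2 belong to the outer and the inner levelling. The summand 1 pays for the neighbours
    of [p0], [bound 0 4] for four toggles, [4 * 5 + 2 * (119 + 3)] for the fifth, and 119 for
    [clean_vertex]. *)
Lemma kcol_girth : kcol A (2 * (2 * (1 + bound 0 4 (4 * 5 + 2 * (119 + 3))))).
Proof.
apply: contrapT => /ncol_component[B BA [cB nB]].
have [r rB] := ncol_exists nB; have [f lv] := levelling_exists cB rB.
have [k nM] := deep_level x0 og BA lv (isT : 0 < 2 * (1 + _)) nB.
have [H HM [cH nH]] := ncol_component nM.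
have HA : H \subset A.
  by apply: subset_trans BA; apply/subsetP => v /(subsetP HM)/levelP[].
have [r' rH] := ncol_exists nH; have [g lvH] := levelling_exists cH rH.
have [k' nM'] := deep_level x0 og HA lvH (isT : 0 < 1 + _) nH.
have [K0 K0M [cK0 nK0]] := ncol_component nM'.
have MH i : level H g i \subset H by apply/subsetP => v /levelP[].
have [v0 v0K] := ncol_exists nK0.
have [p0 p0P v0p] := level_parent lvH (subsetP K0M v0 v0K).
have p0A : p0 \in A by apply: (subsetP HA); apply: (subsetP (MH _)) p0P.
(* The rope starts at a neighbour [y0] of [p0] and continues among nonneighbours of [p0], so that it
   can be closed through [p0]. *)
have [||K1 [cK1 K1K nK1 [y0 [x1 [y0K x1K yx]]]]] :=
    @ncol_component_adj _ K0 [set u | adj p0 u] 1 _ cK0 nK0.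
- apply: (kcol_neighbours x0 og) => //; apply: subset_trans HA.
  by apply: subset_trans K0M (MH _).
- by exists v0; rewrite !inE v0K adj_sym.
have [y0K0 p0y] : y0 \in K0 /\ adj p0 y0 by move: y0K; rewrite in_setI in_set => /andP[].
have K1P u : u \in K1 -> u \in K0 /\ ~~ adj p0 u.
  by move/(subsetP K1K); rewrite in_setD in_set => /andP[].
have y0M : y0 \in level B f k.+3 by apply: (subsetP HM); apply: (subsetP (MH _)); apply: (subsetP K0M).
have [q0 q0P yq] := level_parent lv y0M; have [a0 a0Q qa] := level_parent lv q0P.
have K0H : K0 \subset H by apply: subset_trans K0M (MH _).
have K1K0 : K1 \subset K0 by apply/subsetP => u /K1P[].
have st0 : state B f k H 0 (fun=> y0) (fun=> q0) (fun=> a0) [set y0] K1 K1.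
  split.
  - exact: (rope0 x0 (fun=> y0)).
  - split; first by move=> i _; split=> //; rewrite adj_sym.
    by move=> i i'; rewrite !leqn0 => /eqP -> /eqP ->.
  - move=> u v uK; rewrite inE => /eqP ->; split; last by rewrite eqxx.
    by apply/eqP => e; have [_] := K1P u uK; rewrite e p0y.
  - by split=> //; exists x1.
  - split=> //; first by apply/negP => /K1P[_]; rewrite p0y.
      by rewrite sub1set (subsetP K0H).
    exact: subset_trans K0H.
have [y [p [a [U [C [K [st e0 CK1 UK1 nK]]]]]]] := state_steps og BA lv HM st0 nK1.
rewrite add0n in st.
(* The fifth toggle is grown separately because [clean_vertex] needs its odd cycle. *)
have [b [s [o [i [y' [p' [a' [C' [K' [tg bC nK' [yE CC yy] st']]]]]]]]]] := state_step og BA lv HM st nK.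
set U' := _ :|: _ in st'.
have [rp sp aC [cC eC] [yC KC UH CH]] := st; have [rp' sp' aC' [cC' eC'] [yC' KC' UH' CH']] := st'.
have y0E : y' 0 = y0 by rewrite yy // e0.
have U'K v : v \in U' -> v = y0 \/ v \in K1.
  have UP w : w \in U -> w = y0 \/ w \in K1.
    by move=> /(subsetP UK1); rewrite in_setU in_set1 => /orP[/eqP|]; [left|right].
  rewrite in_setU => /orP[/UP//|]; rewrite inE => /bC; rewrite in_setU1 => /orP[/eqP ->|vC].
    by apply: UP; apply: rope_end rp.
  by right; apply: (subsetP CK1).
have y0U : y0 \in U'.
  have [_ [l1 [_ [[_ _] _ l1U _ _]]]] := rp'; rewrite -y0E; apply: l1U; exact: mem_head.
have yU := rope_end rp'.
have UM : U' \subset level H g k'.+3.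
  by apply/subsetP => v /U'K[->|/K1P[vK _]]; apply: (subsetP K0M).
have CM : C' \subset level H g k'.+3.
  apply: subset_trans CC _; apply: subset_trans CK1 _; exact: subset_trans K1K0 K0M.
have [v [pv [vC pvP vp pvU]]] : exists v (pv : G), [/\ v \in C', pv \in level H g k'.+2, adj v pv &
    forall u, u \in U' -> ~~ adj pv u].
  apply: (clean_vertex og wf HA lvH rp aC tg bC) KC' nK' => //; by rewrite -yE.
have [y5N0 ny5] : y' 5 != y0 /\ ~~ adj (y' 5) y0.
  have [rp1 _] := rp'; have [L [t [iL LU [t0 t5] tE tS]]] := rp1 (fun=> true).
  have s2 : 1 < size L.
    rewrite -t5; have [h0 _] := tS 0 isT; have [h1 _] := tS 1 isT; have [h2 _] := tS 2 isT.
    have [h3 _] := tS 3 isT; have [h4 _] := tS 4 isT; clear -h0 h1 h2 h3 h4; lia.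
  have y5E : y' 5 = nth (y' 0 :: L) (size L) by rewrite -t5 tE.
  have y0E' : y0 = nth (y' 0 :: L) 0 by rewrite -y0E.
  have [uL aL] := iL; rewrite y5E y0E'; split.
    by rewrite nth_uniq //= -lt0n ltnW.
  by rewrite adj_sym aL /= ?ltnS ?leqnn ?gtn_eqF // ltnW.
have p0U u : u \in U' -> u != y0 -> ~~ adj p0 u.
  by move=> /U'K[->|/K1P[]//]; rewrite eqxx.
have [q [iq qN qH qfar]] := closing_path x0 HA lvH cC' CM UM aC' eC' vC pvP vp pvU p0P p0y p0U yU y0U y5N0 ny5.
have [sp1 sp2] := sp'.
apply: (rope_wheel BA lv HM rp' (p := p') (a := a') _ UH' qH) => //.
- by split=> [m m4|m m' m4 m'4]; [apply: sp1; apply: leqW|apply: sp2; apply: leqW].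
- by rewrite y0E.
- by move=> u z uU u5 u0; apply: qfar; rewrite -?y0E.
Qed.

End Final.

Lemma triangle_free_odd_cycle (G : sgraph) c : triangle_free G -> @odd_cycle G c -> 4 < size c.
Proof.
move=> tf /and4P[c2 oc uc cc].
have c3 : size c != 3.
  apply/eqP => c3; apply: tf; exists [set v in c]; split; last first.
    by rewrite cardsE (card_uniqP uc).
  case: c c3 cc {c2 oc uc} => [|u [|v [|w []]]] //= _ /and4P[uv vw wu _] x y.
  rewrite !inE => /or3P[] /eqP -> /or3P[] /eqP ->; rewrite ?eqxx // => _;
    by [|rewrite adj_sym].
by move: c2 oc c3; case: (size c) => [|[|[|[|[|n]]]]].
Qed.

Lemma kcol_colourable (G : sgraph) k : kcol [set: G] k -> colourable G k.
Proof.
move=> [f [fk fa]]; exists (fun i : 'I_k => [set v | f v == i :> nat]); split.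
  move=> i u v; rewrite !inE => /eqP fu /eqP fv; apply/negP => uv.
  by apply: (fa u v) => //; rewrite fu fv.
apply/setP => v; rewrite in_setT; apply/bigcupP.
by exists (Ordinal (fk v (in_setT v))); rewrite ?inE.
Qed.

Theorem theorem3p5 (R : realType) (G : sgraph) :
  triangle_free G -> t_perfect R G -> colourable G 199052.
Proof.
move=> tf tp; apply: kcol_colourable.
(* This number is 18046: one colour for each of the two deleted stable sets and 18044 for the
   rest. *)
apply: (@kcol_le _ _ (1 + 1 + 2 * (2 * (1 + bound 0 4 (4 * 5 + 2 * (119 + 3)))))).
  have -> m : bound 0 4 m =
      4 * 1 + 2 * (4 * 2 + 2 * (4 * 3 + 2 * (4 * 4 + 2 * (m + 3) + 3) + 3) + 3) by [].
  have -> : 199052 = 199 * 1000 + 52 by [].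
  lia.
apply: contrapT => nG; have [x0 _] := ncol_exists nG.
(* Odd cycles have at least 5 vertices here; [S1] meets those of length 5, and [S2] those of length
   7 that remain. *)
have [S1 S1st g1] := @hit_odd_cycles R G tp [set: G] 2 isT (fun c oc _ => triangle_free_odd_cycle tf oc).
have [S2 S2st g2] := @hit_odd_cycles R G tp ([set: G] :\: S1) 3 isT g1.
set A := _ :\: S2 in g2; apply: nG.
have og c : odd_cycle c -> {subset c <= A} -> 7 < size c.
  by move=> oc cA; apply: ltnW; apply: g2.
have := kcolU (kcolU (kcol_stable S1st) (kcol_stable S2st)) (kcol_girth x0 og (t_perfect_wheel_free tp)).
by apply: kcolS; apply/subsetP => v _; rewrite !inE; case: (v \in S1); case: (v \in S2).
Qed.
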